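(* Let $\beta>0$, let $m\ge1$ be an integer, and let $\omega_m^0,\rho_m^0\in H^2(0,1)$ vanish at $y=0$ and $y=1$. If $\beta^2>1/4$, assume in addition that $$\int_0^1\phi_{u,m}(z)F_m(z,0)\,dz=\int_0^1\phi_{l,m}(z)F_m(z,1)\,dz=0.$$ Then $$\lim_{\varepsilon\to0^+}\big\|\psi^-_{m,\varepsilon}(\cdot,y_0)-\psi^+_{m,\varepsilon}(\cdot,y_0)\big\|_{L^2_y(0,1)}=0,\qquad y_0\in\{0,1\}.$$
   Context: Let $\Delta_m=\partial_y^2-m^2$. For $\varepsilon>0$, $\psi^\pm_{m,\varepsilon}(\cdot,y_0)$ is the solution, with homogeneous Dirichlet conditions at $y=0,1$, of $$\Delta_m\psi^\pm_{m,\varepsilon}+\beta^2\frac{\psi^\pm_{m,\varepsilon}}{(y-y_0\pm i\varepsilon)^2}=\frac{\omega_m^0}{y-y_0\pm i\varepsilon}-\beta^2\frac{\rho_m^0}{(y-y_0\pm i\varepsilon)^2}.$$ $F_m(z,0)=\Delta_m\rho_m^0(z)-\frac1{\beta^2}\Delta_m(z\,\omega_m^0(z))$ and $F_m(z,1)=\Delta_m\rho_m^0(z)-\frac1{\beta^2}\Delta_m((z-1)\omega_m^0(z))$. For $\beta^2>1/4$, let $\nu=\sqrt{\beta^2-1/4}$, $M_{0,\gamma}(\zeta)=e^{-\zeta/2}\zeta^{\frac12+\gamma}\sum_{s\ge0}\frac{(\frac12+\gamma)_s}{(1+2\gamma)_s\,s!}\zeta^s$ (Whittaker function, principal branch, $(a)_s=a(a+1)\cdots(a+s-1)$)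 and $M_\pm(\zeta)=M_{0,\pm i\nu}(2m\zeta)$. Then $\phi_{u,m}(y)=M_+(1)M_-(y)-M_-(1)M_+(y)$ and $\phi_{l,m}(y)=M_+(1)M_-(1-y)-M_-(1)M_+(1-y)$. *)

(* Defs.v *)
(* A function R -> R[i] is differentiated, integrated, and tested for continuity
   or measurability through its real and imaginary parts. *)
From HB Require Import structures.
From mathcomp Require Export all_boot all_order all_algebra.
From mathcomp Require Export all_classical all_reals all_analysis.
From mathcomp Require Export complex.

Set Implicit Arguments.
Unset Strict Implicit.
Unset Printing Implicit Defensive.

Import Order.TTheory GRing.Theory Num.Theory.
Import numFieldNormedType.Exports.

Local Open Scope classical_set_scope.
Local Open Scope complex_scope.
Local Open Scope ring_scope.

Section ComplexValued.
Context {R : realType}.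
Implicit Types (f g : R -> R[i]) (phi : R -> R) (D : set R) (x : R).

Definition rePart f : R -> R := fun x => complex.Re (f x).
Definition imPart f : R -> R := fun x => complex.Im (f x).

Definition ccontinuous D f :=
  {within D, continuous (rePart f)} /\ {within D, continuous (imPart f)}.

Definition cderivable f x := derivable (rePart f) x 1 /\ derivable (imPart f) x 1.

Definition cderive f : R -> R[i] :=
  fun x => derive1 (rePart f) x +i* derive1 (imPart f) x.

Definition cintegral D f : R[i] :=
  (\int[lebesgue_measure]_(x in D) rePart f x)%R
    +i* (\int[lebesgue_measure]_(x in D) imPart f x)%R.

Definition cseries (u : nat -> R[i]) : R[i] :=
  limn (series (fun s => complex.Re (u s)))
    +i* limn (series (fun s => complex.Im (u s))).

(* Extended-real valued: finiteness of the norm is not presupposed. *)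
Definition L2norm f : \bar R :=
  ('N[@lebesgue_measure R]_(2%:E)
     [EFin \o ((fun x => Normc.normc (f x)) \_ `]0%R, 1%R[)])%E.

Definition inL2 f :=
  [/\ measurable_fun (`]0, 1[ : set R) (rePart f), measurable_fun (`]0, 1[ : set R) (imPart f)
    & (L2norm f < +oo)%E].

(* Test functions are C^1 with compact support in (0,1), the usual choice for
   Sobolev spaces on an interval. *)
Definition test_function phi :=
  [/\ forall x, derivable phi x 1, continuous (derive1 phi : R -> R)
    & exists a b : R, [/\ 0 < a, b < 1 & forall x, x \notin `[a, b] -> phi x = 0]].

Definition weak_derivative f g :=
  inL2 g /\ forall phi, test_function phi ->
    cintegral `]0, 1[ (fun x => (derive1 phi x)%:C * f x)
    = - cintegral `]0, 1[ (fun x => (phi x)%:C * g x).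

Definition inH1 f := inL2 f /\ exists g, weak_derivative f g.
Definition inH2 f := inL2 f /\ exists g, weak_derivative f g /\ inH1 g.

(* Elements of H^2(0,1) vanishing at 0 and 1; f is the continuous
   representative on [0,1], so that its boundary values are meaningful. *)
Definition inH2_Dirichlet f :=
  [/\ inH2 f, ccontinuous `[0, 1] f, f 0 = 0 & f 1 = 0].

(* A weak derivative in L^2(0,1), unique up to null sets (0 if none exists). *)
Definition wderive f : R -> R[i] :=
  xget (fun=> 0) [set g | weak_derivative f g].

End ComplexValued.

Section Whittaker.
Context {R : realType}.

(* Principal branch of x^a for real x > 0; equal to 0 at x = 0 if Re a <> 0. *)
Definition cpow (x : R) (a : R[i]) : R[i] :=
  (x `^ complex.Re a)%:C
    * (cos (complex.Im a * ln x) +i* sin (complex.Im a * ln x)).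

Definition pochhammer (a : R[i]) (s : nat) : R[i] :=
  \prod_(j < s) (a + j%:R).

(* M_{0,gamma}, on the nonnegative reals. *)
Definition whittakerM0 (gamma : R[i]) (x : R) : R[i] :=
  (expR (- x / 2))%:C * cpow x (2^-1 + gamma)
    * cseries (fun s => pochhammer (2^-1 + gamma) s
                        / (pochhammer (1 + 2 * gamma) s * (s`!)%:R)
                        * (x ^+ s)%:C).

Definition nu (beta : R) : R := Num.sqrt (beta ^+ 2 - 4^-1).

Definition Mplus (beta : R) (m : nat) (x : R) : R[i] :=
  whittakerM0 (0 +i* nu beta) (2 * m%:R * x).
Definition Mminus (beta : R) (m : nat) (x : R) : R[i] :=
  whittakerM0 (0 -i* nu beta) (2 * m%:R * x).

Definition phi_u (beta : R) (m : nat) (y : R) : R[i] :=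
  Mplus beta m 1 * Mminus beta m y - Mminus beta m 1 * Mplus beta m y.
Definition phi_l (beta : R) (m : nat) (y : R) : R[i] :=
  Mplus beta m 1 * Mminus beta m (1 - y)
    - Mminus beta m 1 * Mplus beta m (1 - y).

End Whittaker.

Section Problem.
Context {R : realType}.

(* Delta_m on H^2(0,1), where second derivatives are only L^2 functions. *)
Definition wDelta (m : nat) (f : R -> R[i]) : R -> R[i] :=
  fun z => wderive (wderive f) z - m%:R ^+ 2 * f z.

Definition Fm (beta : R) (m : nat) (omega rho : R -> R[i]) (z y0 : R) : R[i] :=
  wDelta m rho z
    - ((beta ^+ 2)^-1)%:C * wDelta m (fun x => (x - y0)%:C * omega x) z.

Definition Delta (m : nat) (f : R -> R[i]) : R -> R[i] :=
  fun y => cderive (cderive f) y - m%:R ^+ 2 * f y.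

(* psi solves the Dirichlet problem with denominators y - y0 + i d, d being
   eps for psi^+ and - eps for psi^-. *)
Definition Dirichlet_solution (beta : R) (m : nat) (omega rho : R -> R[i])
    (y0 d : R) (psi : R -> R[i]) :=
  [/\ ccontinuous `[0, 1] psi, psi 0 = 0, psi 1 = 0
    & forall y : R, 0 < y < 1 ->
      [/\ cderivable psi y, cderivable (cderive psi) y
        & let z := (y - y0) +i* d in
          Delta m psi y + (beta ^+ 2)%:C * (psi y / z ^+ 2)
          = omega y / z - (beta ^+ 2)%:C * (rho y / z ^+ 2)]].

End Problem.

(* Main.v *)
(* The half sums p and half differences q of psi^+ and psi^-, taken for the real
   and for the imaginary part of the data separately, solve a real 2x2 system,
   and psi^- - psi^+ is 2 (q_2 - i q_1), so that it suffices to show q -> 0 uniformly.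
   The reflection y -> 1 - y reduces y0 = 1 to y0 = 0.  For H^2 data vanishing at
   both ends, omega and rho are O(y).
   If beta^2 <= 1/4, (p^2 + q^2) / y and then q^2 / y are subsolutions in the
   variable ln y up to controlled sources, and the maximum principle gives
   |q|^2 = O(1 / ln (1/eps)).
   If beta^2 > 1/4, the energy x |u'|^2 - u u' + beta^2 u^2 / x, x = y + eps, is
   bounded in terms of M = eps |psi'(0)|^2.  The current J = p q' - q p' vanishes at
   both ends and is produced at a rate beta^2 wim |psi|^2 near 0, hence J(d) controls M.
   On [d, 1], up to O(eps), q solves the limit equation, so q = q'(1) U + O(eps)
   with U the solution of U'' = (m^2 - beta^2 / y^2) U vanishing at 1; then J(d) is
   q'(1) times the integral over [d, 1] of U (omega / y - beta^2 rho / y^2), up to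
   small terms.  As U is a multiple of phi_u, two integrations by parts show that
   this integral vanishes in the limit exactly under the orthogonality hypothesis.
   Hence M -> 0, and then q -> 0. *)
From mathcomp Require Import ring lra measurable_realfun.
Require Import Defs.

Set Implicit Arguments.
Unset Strict Implicit.
Unset Printing Implicit Defensive.

Import Order.TTheory GRing.Theory Num.Theory.
Import numFieldNormedType.Exports.

Local Open Scope classical_set_scope.
Local Open Scope complex_scope.
Local Open Scope ring_scope.

(** * Calculus on the real line *)

(** The threshold 1/4 is Hardy's constant: the indicial roots 1/2 +- sqrt (1/4 - beta^2) of u'' +
    beta^2 u / y^2 = 0 are real up to it and complex beyond. Below it |psi|^2 / y is convex in ln y
    up to sources; above it this convexity is lost, and precisely there the quadratic form of the
    energy is definite. The difficulty is uniformity in eps across the layer y ~ eps, where the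
    coefficient is not close to beta^2 / y^2. The shift x = y + eps is chosen because the real and
    imaginary coefficients differ from x^-2 and 0 by O(eps / x^3). In the energy identity this costs
    a rate eps / x^2, whose integral over (0,1) is at most 1 for every eps. The layer then enters
    through one number only, the energy M at y = 0. A bound on M merely bounds q. Smallness has to
    come from the far field: the current J transports M from the layer to a distance d, where the
    limit problem determines it. Every loss is either sqrt d with a constant independent of d, or a
    power of eps with a constant depending on d, so d is fixed first and eps -> 0 afterwards. The
    data being only H^2, the integrations by parts are carried out weakly, against cut-off C^2
    functions. *)

Ltac pos := repeat first [ assumption
  | lazymatch goal with
    | |- is_true (0 <= _ ^+ 2) => apply: sqr_ge0
    | |- is_true (0 <= `|_|) => apply: normr_ge0
    | |- is_true (0 <= Num.sqrt _) => apply: sqrtr_ge0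
    | |- is_true (0 <= expR _) => apply: expR_ge0
    | |- is_true (0 <= _ - _) => rewrite subr_ge0
    | |- is_true (0 <= _ + _) => apply: addr_ge0
    | |- is_true (0 <= _ * _) => apply: mulr_ge0
    | |- is_true (0 <= _ ^-1) => rewrite invr_ge0
    | |- is_true (0 <= _ ^+ _) => apply: exprn_ge0
    | |- is_true (0 < _ * _) => apply: mulr_gt0
    | |- is_true (0 < _ - _) => rewrite subr_gt0
    | |- is_true (0 < _ + _) => apply: addr_gt0
    | |- is_true (0 < _ ^-1) => rewrite invr_gt0
    | |- is_true (0 < _ ^+ _) => apply: exprn_gt0
    | |- is_true (0 < Num.sqrt _) => rewrite sqrtr_gt0
    | |- is_true (0 < expR _) => apply: expR_gt0
    end | apply: ltW; assumption | done ].

Section Calculus.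
Context {R : realType}.
Implicit Types (f g df dg : R -> R) (x a b : R).

Lemma is_derive_add f g x a b : is_derive x 1 f a -> is_derive x 1 g b ->
  is_derive x 1 (fun y => f y + g y) (a + b).
Proof. by move=> *; apply: is_deriveD. Qed.

Lemma is_derive_sub f g x a b : is_derive x 1 f a -> is_derive x 1 g b ->
  is_derive x 1 (fun y => f y - g y) (a - b).
Proof. by move=> *; apply: is_deriveB. Qed.

Lemma is_derive_opp f x a : is_derive x 1 f a ->
  is_derive x 1 (fun y => - f y) (- a).
Proof. by move=> *; apply: is_deriveN. Qed.

Lemma is_derive_mul f g x a b : is_derive x 1 f a -> is_derive x 1 g b ->
  is_derive x 1 (fun y => f y * g y) (a * g x + f x * b).
Proof.
move=> fa gb; have H := is_deriveM fa gb; apply: (is_derive_eq H).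
by rewrite /GRing.scale /=; ring.
Qed.

Lemma is_derive_exp f x a n : is_derive x 1 f a ->
  is_derive x 1 (fun y => f y ^+ n) (n%:R * f x ^+ n.-1 * a).
Proof.
move=> fa; have -> : (fun y => f y ^+ n) = f ^+ n.
  by apply/funext => y; rewrite exprfctE.
exact: is_deriveX.
Qed.

Lemma is_derive_inv f x a : f x != 0 -> is_derive x 1 f a ->
  is_derive x 1 (fun y => (f y)^-1) (- a / f x ^+ 2).
Proof.
move=> fx0 fa; have H := is_deriveV fx0 fa; apply: (is_derive_eq H).
by rewrite /GRing.scale /=; field.
Qed.

Lemma is_derive_const (c x : R) : is_derive x 1 (fun=> c) 0.
Proof. exact: is_derive_cst. Qed.

Lemma is_derive_idfun x : is_derive x 1 (fun y : R => y) 1.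
Proof. exact: is_derive_id. Qed.

Lemma is_derive_chain f g x a b :
  is_derive (g x) 1 f a -> is_derive x 1 g b ->
  is_derive x 1 (fun y => f (g y)) (a * b).
Proof. exact: is_derive1_comp. Qed.

Lemma is_derive_sqrt f x a : 0 < f x -> is_derive x 1 f a ->
  is_derive x 1 (fun y => Num.sqrt (f y)) ((2 * Num.sqrt (f x))^-1 * a).
Proof. by move=> fx fa; apply: is_derive_chain => //; apply: is_derive1_sqrt. Qed.

Lemma is_derive_expf f x a : is_derive x 1 f a ->
  is_derive x 1 (fun y => expR (f y)) (expR (f x) * a).
Proof. by move=> fa; apply: is_derive_chain => //. Qed.

Lemma is_derive_lnf f x a : 0 < f x -> is_derive x 1 f a ->
  is_derive x 1 (fun y => ln (f y)) ((f x)^-1 * a).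
Proof. by move=> fx fa; apply: is_derive_chain => //; apply: is_derive1_ln. Qed.

Lemma is_derive_cosf f x a : is_derive x 1 f a ->
  is_derive x 1 (fun y => cos (f y)) (- sin (f x) * a).
Proof. by move=> fa; apply: is_derive_chain => //. Qed.

Lemma is_derive_sinf f x a : is_derive x 1 f a ->
  is_derive x 1 (fun y => sin (f y)) (cos (f x) * a).
Proof. by move=> fa; apply: is_derive_chain => //. Qed.

Definition cont_itv a b f : Prop := {within `[a, b], continuous f}.

Lemma cont_itv_cst a b (c : R) : cont_itv a b (fun=> c).
Proof. by apply: continuous_subspaceT => x; apply: cvg_cst. Qed.

Lemma cont_itv_id a b : cont_itv a b (fun x => x).
Proof. by apply: continuous_subspaceT => x; apply: cvg_id. Qed.

Lemma cont_itv_add a b f g : cont_itv a b f -> cont_itv a b g ->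
  cont_itv a b (fun x => f x + g x).
Proof. by move=> cf cg x; apply: cvgD; [exact: cf | exact: cg]. Qed.

Lemma cont_itv_opp a b f : cont_itv a b f -> cont_itv a b (fun x => - f x).
Proof. by move=> cf x; apply: cvgN; exact: cf. Qed.

Lemma cont_itv_mul a b f g : cont_itv a b f -> cont_itv a b g ->
  cont_itv a b (fun x => f x * g x).
Proof. by move=> cf cg x; apply: cvgM; [exact: cf | exact: cg]. Qed.

Lemma cont_itv_exp a b f n : cont_itv a b f -> cont_itv a b (fun x => f x ^+ n).
Proof.
move=> cf; elim: n => [|n IH].
  by rewrite (_ : (fun _ => _) = fun=> 1) //; apply: cont_itv_cst.
rewrite (_ : (fun _ => _) = fun x => f x * f x ^+ n); first exact: cont_itv_mul.
by apply/funext => x; rewrite exprS.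
Qed.

Lemma cont_itv_inv a b f : cont_itv a b f ->
  (forall x, a <= x <= b -> f x != 0) -> cont_itv a b (fun x => (f x)^-1).
Proof.
move=> cf f0; apply: (@within_continuous_comp _ _ _ _ f (fun x => x^-1)) => //.
move=> z; rewrite inE /= => -[x]; rewrite in_itv /= => xab <-.
exact: inv_continuous (f0 _ xab).
Qed.

Lemma cont_itv_ln a b f : cont_itv a b f ->
  (forall x, a <= x <= b -> 0 < f x) -> cont_itv a b (fun x => ln (f x)).
Proof.
move=> cf f0; apply: (@within_continuous_comp _ _ _ _ f (fun x => ln x)) => //.
move=> z; rewrite inE /= => -[x]; rewrite in_itv /= => xab <-.
exact: continuous_ln (f0 _ xab).
Qed.

Lemma cont_itv_comp a b f g : cont_itv a b f -> continuous g ->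
  cont_itv a b (fun x => g (f x)).
Proof. by move=> cf cg x; apply: (@within_continuous_comp _ _ _ _ f g) => // z _. Qed.

Lemma cont_itv_expR a b f : cont_itv a b f -> cont_itv a b (fun x => expR (f x)).
Proof. by move=> cf; apply: cont_itv_comp => //; apply: continuous_expR. Qed.

Lemma cont_itv_sqrt a b f : cont_itv a b f -> cont_itv a b (fun x => Num.sqrt (f x)).
Proof. by move=> cf; apply: cont_itv_comp => //; apply: sqrt_continuous. Qed.

Lemma cont_itv_sub (a b c d : R) f : a <= c -> d <= b ->
  cont_itv a b f -> cont_itv c d f.
Proof.
move=> ac db; apply: continuous_subspaceW => x /=; rewrite !in_itv /=.
by move=> /andP[cx xd]; rewrite (le_trans ac cx) (le_trans xd db).
Qed.

Lemma cont_itv_derive a b f df :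
  (forall x, a <= x <= b -> is_derive x 1 f (df x)) -> cont_itv a b f.
Proof.
move=> fd; apply: derivable_within_continuous => x; rewrite in_itv /= => xab.
by have [] := fd _ xab.
Qed.

Lemma MVT_oo a b f df : a < b -> (forall x, a < x < b -> is_derive x 1 f (df x)) ->
  cont_itv a b f ->
  exists c, a < c < b /\ f b - f a = df c * (b - a).
Proof.
move=> ab fd fc; have fd' x : x \in `]a, b[ -> is_derive x 1 f (df x).
  by rewrite in_itv /= => /fd.
by have [c] := MVT ab fd' fc; rewrite in_itv /= => cab e; exists c.
Qed.

Lemma derive_ge0_le a b f df : a <= b ->
  (forall x, a < x < b -> is_derive x 1 f (df x)) ->
  cont_itv a b f -> (forall x, a < x < b -> 0 <= df x) ->
  f a <= f b.
Proof.
rewrite le_eqVlt => /predU1P[->//|ab] fd fc df0.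
have [c [/df0 dc e]] := MVT_oo ab fd fc.
by rewrite -subr_ge0 e; apply: mulr_ge0 => //; rewrite subr_ge0 ltW.
Qed.

Lemma derive_le_dist a b f df K : a <= b ->
  (forall x, a < x < b -> is_derive x 1 f (df x)) ->
  cont_itv a b f -> (forall x, a < x < b -> `|df x| <= K) ->
  `|f b - f a| <= K * (b - a).
Proof.
rewrite le_eqVlt => /predU1P[->|ab] fd fc dfK.
  by rewrite !subrr normr0 mulr0.
have [c [cab ->]] := MVT_oo ab fd fc.
have ba : 0 <= b - a by rewrite subr_ge0 ltW.
by rewrite normrM (ger0_norm ba) ler_wpM2r // dfK.
Qed.

Lemma cont_itv_bounded (a b : R) (f : R -> R) : a <= b -> cont_itv a b f ->
  exists2 K, 0 <= K & forall x, a <= x <= b -> `|f x| <= K.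
Proof.
move=> ab cf.
have [c1 _ H1] := EVT_max ab cf; have [c2 _ H2] := EVT_min ab cf.
exists (`|f c1| + `|f c2|) => [|x xab]; first by pos.
have xI : x \in `[a, b] by rewrite in_itv.
have := H1 _ xI; have := H2 _ xI.
have := ler_norm (f c1); have := ler_norm (- f c2); rewrite normrN => *.
have ? := normr_ge0 (f c1); have ? := normr_ge0 (f c2).
by rewrite ler_norml; apply/andP; split; lra.
Qed.

End Calculus.

Ltac der := repeat lazymatch goal with
  | |- is_derive _ _ (fun _ => ?c) _ => apply: is_derive_const
  | |- is_derive _ _ (fun y => y) _ => apply: is_derive_idfun
  | |- is_derive _ _ (fun y => (@?f y) - (@?g y)) _ => eapply (is_derive_sub (f := f) (g := g))
  | |- is_derive _ _ (fun y => (@?f y) + (@?g y)) _ => eapply (is_derive_add (f := f) (g := g))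
  | |- is_derive _ _ (fun y => - (@?f y)) _ => eapply (is_derive_opp (f := f))
  | |- is_derive _ _ (fun y => (@?f y) * (@?g y)) _ => eapply (is_derive_mul (f := f) (g := g))
  | |- is_derive _ _ (fun y => (@?f y) ^-1) _ => eapply (is_derive_inv (f := f))
  | |- is_derive _ _ (fun y => (@?f y) ^+ ?n) _ => eapply (is_derive_exp (f := f) n)
  | |- is_derive _ _ (fun y => expR (@?f y)) _ => eapply (is_derive_expf (f := f))
  | |- is_derive _ _ (fun y => ln (@?f y)) _ => eapply (is_derive_lnf (f := f))
  | |- is_derive _ _ (fun y => cos (@?f y)) _ => eapply (is_derive_cosf (f := f))
  | |- is_derive _ _ (fun y => sin (@?f y)) _ => eapply (is_derive_sinf (f := f))
  | |- is_derive _ _ (fun y => Num.sqrt (@?f y)) _ => eapply (is_derive_sqrt (f := f))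
  | |- is_derive _ _ _ _ => eassumption
  | |- _ => idtac
  end.

Ltac cont := repeat lazymatch goal with
  | |- cont_itv _ _ (fun _ => ?c) => apply: cont_itv_cst
  | |- cont_itv _ _ (fun y => y) => apply: cont_itv_id
  | |- cont_itv _ _ (fun y => (@?f y) + (@?g y)) => apply (cont_itv_add (f := f) (g := g))
  | |- cont_itv _ _ (fun y => - (@?f y)) => apply (cont_itv_opp (f := f))
  | |- cont_itv _ _ (fun y => (@?f y) * (@?g y)) => apply (cont_itv_mul (f := f) (g := g))
  | |- cont_itv _ _ (fun y => (@?f y) ^-1) => apply (cont_itv_inv (f := f))
  | |- cont_itv _ _ (fun y => (@?f y) ^+ ?n) => apply (cont_itv_exp (f := f) (n := n))
  | |- cont_itv _ _ (fun y => expR (@?f y)) => apply (cont_itv_expR (f := f))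
  | |- cont_itv _ _ (fun y => ln (@?f y)) => apply (cont_itv_ln (f := f))
  | |- cont_itv _ _ (fun y => Num.sqrt (@?f y)) => apply (cont_itv_sqrt (f := f))
  | |- cont_itv _ _ _ => eassumption
  | |- _ => idtac
  end.

(** * Coefficients and sources near the singular point *)

Section Weights.
Context {R : realType}.
Implicit Types e y : R.

(* With z = y + i e, the real part of z^-2 and minus its imaginary part. *)
Definition wre e y : R := (y ^+ 2 - e ^+ 2) / (y ^+ 2 + e ^+ 2) ^+ 2.
Definition wim e y : R := 2 * e * y / (y ^+ 2 + e ^+ 2) ^+ 2.

Lemma sqnorm_gt0 e y : 0 < e -> 0 < y ^+ 2 + e ^+ 2.
Proof. by move=> e0; apply: ltr_wpDl; pos. Qed.

Lemma wim_ge0 e y : 0 < e -> 0 <= y -> 0 <= wim e y.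
Proof. by move=> e0 y0; rewrite /wim; pos. Qed.

Lemma wim_le e y : 0 < e -> wim e y <= (y ^+ 2 + e ^+ 2)^-1.
Proof.
move=> e0; have r0 := sqnorm_gt0 y e0.
rewrite -subr_ge0 (_ : _ - _ = (y - e) ^+ 2 / (y ^+ 2 + e ^+ 2) ^+ 2).
  by pos.
by rewrite /wim; field; rewrite gt_eqF.
Qed.

Lemma wre_le e y : 0 < e -> `|wre e y| <= (y ^+ 2 + e ^+ 2)^-1.
Proof.
move=> e0; have r0 := sqnorm_gt0 y e0.
rewrite ler_norml -subr_ge0 -(subr_ge0 (wre e y)).
rewrite (_ : _ - - _ = 2 * y ^+ 2 / (y ^+ 2 + e ^+ 2) ^+ 2); last first.
  by rewrite /wre; field; rewrite gt_eqF.
rewrite (_ : _^-1 - _ = 2 * e ^+ 2 / (y ^+ 2 + e ^+ 2) ^+ 2); last first.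
  by rewrite /wre; field; rewrite gt_eqF.
by apply/andP; split; pos.
Qed.

Lemma invsq_le e y : 0 < e -> 0 < y -> (y ^+ 2 + e ^+ 2)^-1 <= y ^- 2.
Proof.
move=> e0 y0; rewrite lef_pV2 ?posrE ?sqnorm_gt0 ?exprn_gt0 //.
by rewrite lerDl sqr_ge0.
Qed.

Lemma invsq_sub_wre e y : 0 < e -> 0 < y ->
  0 <= y ^- 2 - wre e y <= 4 * e ^+ 2 / y ^+ 4.
Proof.
move=> e0 y0; have r0 := sqnorm_gt0 y e0.
rewrite (_ : _ - _ = e ^+ 2 * (3 * y ^+ 2 + e ^+ 2) / (y ^+ 2 * (y ^+ 2 + e ^+ 2) ^+ 2)); last first.
  by rewrite /wre; field; rewrite !gt_eqF.
have ee := sqr_ge0 e; have yy := sqr_ge0 y.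
apply/andP; split.
  by pos.
rewrite -subr_ge0.
rewrite (_ : _ - _ = e ^+ 2 * (y ^+ 4 + 7 * y ^+ 2 * e ^+ 2 + 4 * e ^+ 4) / (y ^+ 4 * (y ^+ 2 + e ^+ 2) ^+ 2)); last first.
  by field; rewrite !gt_eqF.
have e4 : 0 <= e ^+ 4 by pos.
have y4 : 0 <= y ^+ 4 by pos.
by pos.
Qed.

Lemma wim_le_cube e y : 0 < e -> 0 < y -> wim e y <= 2 * e / y ^+ 3.
Proof.
move=> e0 y0; have r0 := sqnorm_gt0 y e0.
rewrite -subr_ge0 (_ : _ - _ = 2 * e * (2 * y ^+ 2 * e ^+ 2 + e ^+ 4) / (y ^+ 3 * (y ^+ 2 + e ^+ 2) ^+ 2)).
  by pos.
by rewrite /wim; field; rewrite !gt_eqF.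
Qed.

(** In the variable x = y + e the bound holds down to y = 0. Multiplied by x it is of order e / x^2,
    with an integral bounded independently of e; this and the analogous bound for [wre] make the
    energy estimate uniform. *)
Lemma wim_le_shift e y : 0 < e -> 0 <= y -> wim e y <= 8 * e / (y + e) ^+ 3.
Proof.
move=> e0 y0; have r0 := sqnorm_gt0 y e0; have x0 : 0 < y + e by rewrite ltr_wpDl.
rewrite -subr_ge0 (_ : _ - _ = 2 * e * (3 * y ^+ 4 - 3 * y ^+ 3 * e + 5 * y ^+ 2 * e ^+ 2 - y * e ^+ 3 + 4 * e ^+ 4) / ((y + e) ^+ 3 * (y ^+ 2 + e ^+ 2) ^+ 2)).
  apply: divr_ge0; last by pos.
  apply: mulr_ge0; first by pos.
  (* A decomposition into squares, which shows the sign of this quartic form in y and e. *)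
  have -> : 3 * y ^+ 4 - 3 * y ^+ 3 * e + 5 * y ^+ 2 * e ^+ 2 - y * e ^+ 3 + 4 * e ^+ 4 = 3 * (y * (y - e / 2)) ^+ 2 + (2 * e * y - e ^+ 2 / 4) ^+ 2 + 63 / 16 * e ^+ 4 + (y * e) ^+ 2 / 4 by field.
  by pos.
by rewrite /wim; field; rewrite !gt_eqF.
Qed.

Lemma invsq_shift_sub_wre e y : 0 < e -> 0 <= y ->
  `|(y + e) ^- 2 - wre e y| <= 8 * e / (y + e) ^+ 3.
Proof.
move=> e0 y0; have r0 := sqnorm_gt0 y e0; have x0 : 0 < y + e by rewrite ltr_wpDl.
have D : (y + e) ^- 2 - wre e y = 2 * e * (- y ^+ 3 + y ^+ 2 * e + y * e ^+ 2 + e ^+ 3) / ((y + e) ^+ 2 * (y ^+ 2 + e ^+ 2) ^+ 2).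
  by rewrite /wre; field; rewrite !gt_eqF.
have N : `|- y ^+ 3 + y ^+ 2 * e + y * e ^+ 2 + e ^+ 3| <= (y + e) ^+ 3.
  have Y : 0 <= y ^+ 2 * e by pos.
  have Z : 0 <= y * e ^+ 2 by pos.
  have ? : 0 <= y ^+ 3 by pos.
  have ? : 0 <= e ^+ 3 by pos.
  by rewrite ler_norml; apply/andP; split; rewrite -subr_ge0; lra.
rewrite D normrM normrM normfV (ger0_norm (_ : 0 <= 2 * e)); last by pos.
rewrite (ger0_norm (_ : 0 <= (y + e) ^+ 2 * _)); last by pos.
have -> : 8 * e / (y + e) ^+ 3 = 2 * e * (4 * (y ^+ 2 + e ^+ 2) ^+ 2 / (y + e)) / ((y + e) ^+ 2 * (y ^+ 2 + e ^+ 2) ^+ 2).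
  by field; rewrite !gt_eqF.
apply: ler_wpM2r; first by pos.
apply: ler_wpM2l; first by pos.
apply: (le_trans N); rewrite ler_pdivlMr // -exprSr.
rewrite (_ : (y + e) ^+ 4 = ((y + e) ^+ 2) ^+ 2); last by ring.
rewrite (_ : 4 * _ ^+ 2 = (2 * (y ^+ 2 + e ^+ 2)) ^+ 2); last by ring.
rewrite ler_pXn2r // ?nnegrE; [|by pos|by pos].
by rewrite -subr_ge0 (_ : _ - _ = (y - e) ^+ 2) ?sqr_ge0 //; ring.
Qed.

Lemma id_div_sqnorm_le e y : 0 < e -> 0 <= y -> y / (y ^+ 2 + e ^+ 2) <= 2 / (y + e).
Proof.
move=> e0 y0; have r0 := sqnorm_gt0 y e0; have x0 : 0 < y + e by rewrite ltr_wpDl.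
rewrite -subr_ge0 (_ : _ - _ = (y ^+ 2 / 2 + e ^+ 2 + (y - e) ^+ 2/2 + e ^+ 2 / 2) / ((y + e) * (y ^+ 2 + e ^+ 2))).
  by pos.
by field; rewrite !gt_eqF.
Qed.

(* Real and imaginary part of w / z - B r / z^2. *)
Definition srcre (B w r e y : R) := w * y / (y ^+ 2 + e ^+ 2) - B * r * wre e y.
Definition srcim (B w r e y : R) := - (w * e / (y ^+ 2 + e ^+ 2)) + B * r * wim e y.

(** Both data vanish linearly at the singular point. This reduces the double pole carried by [r] to
    a simple one, with a constant that does not depend on e. *)
Lemma srcre_le (B C w r e y : R) : 0 <= B -> 0 <= C -> 0 < e -> e <= 1 ->
  0 <= y <= 1 -> `|w| <= C * y -> `|r| <= C * y ->
  `|srcre B w r e y| <= 2 * C * (1 + B) / (y + e).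
Proof.
move=> B0 C0 e0 e1 /andP[y0 y1] wC rC.
have r0 := sqnorm_gt0 y e0; have x0 : 0 < y + e by rewrite ltr_wpDl.
have yx := id_div_sqnorm_le e0 y0.
have Cr : C * y / (y ^+ 2 + e ^+ 2) <= 2 * C / (y + e).
  by rewrite -mulrA [2 * C]mulrC -mulrA; apply: ler_wpM2l.
have H1 : `|w * y / (y ^+ 2 + e ^+ 2)| <= 2 * C / (y + e).
  rewrite -mulrA normrM (ger0_norm (_ : 0 <= y / _)); last by pos.
  have y1' : y / (y ^+ 2 + e ^+ 2) * y <= 1.
    by rewrite mulrAC ler_pdivrMr // mul1r lerDl sqr_ge0.
  apply: le_trans (_ : C * y * (y / (y ^+ 2 + e ^+ 2)) <= _).
    by apply: ler_wpM2r => //; pos.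
  apply: le_trans (_ : C <= _).
    by rewrite -mulrA -[leRHS]mulr1; apply: ler_wpM2l => //; rewrite mulrC.
  by rewrite ler_pdivlMr // [2 * C]mulrC; apply: ler_wpM2l => //; lra.
have H2 : `|B * r * wre e y| <= B * (2 * C / (y + e)).
  rewrite -mulrA normrM (ger0_norm B0); apply: ler_wpM2l => //.
  by apply: le_trans Cr; rewrite normrM; apply: ler_pM => //; apply: wre_le.
apply: le_trans (ler_normB _ _) _; apply: le_trans (lerD H1 H2) _.
by lra.
Qed.

Lemma srcim_le (B C w r e y : R) : 0 <= B -> 0 <= C -> 0 < e -> e <= 1 ->
  0 <= y <= 1 -> `|w| <= C * y -> `|r| <= C * y ->
  `|srcim B w r e y| <= 2 * C * (1 + B) / (y + e).
Proof.
move=> B0 C0 e0 e1 /andP[y0 y1] wC rC.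
have r0 := sqnorm_gt0 y e0; have x0 : 0 < y + e by rewrite ltr_wpDl.
have yx := id_div_sqnorm_le e0 y0.
have Cr : C * y / (y ^+ 2 + e ^+ 2) <= 2 * C / (y + e).
  by rewrite -mulrA [2 * C]mulrC -mulrA; apply: ler_wpM2l.
have H1 : `|- (w * e / (y ^+ 2 + e ^+ 2))| <= 2 * C / (y + e).
  apply: le_trans Cr; rewrite normrN -mulrA normrM.
  rewrite (ger0_norm (_ : 0 <= e / _)); last by pos.
  have ie : e / (y ^+ 2 + e ^+ 2) <= (y ^+ 2 + e ^+ 2)^-1.
    by rewrite -[leRHS]mul1r; apply: ler_wpM2r => //; pos.
  by apply: ler_pM => //; pos.
have H2 : `|B * r * wim e y| <= B * (2 * C / (y + e)).
  rewrite -mulrA normrM (ger0_norm B0); apply: ler_wpM2l => //.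
  apply: le_trans Cr; rewrite normrM (ger0_norm (wim_ge0 _ _)) //.
  by apply: ler_pM => //; [exact: wim_ge0 | apply: wim_le].
apply: le_trans (ler_normD _ _) _; apply: le_trans (lerD H1 H2) _.
by lra.
Qed.

(** For real data the imaginary part of the source is due to e alone, so it is O(e) at a fixed
    distance from 0; within the layer y ~ e only [srcim_le] is of use. *)
Lemma srcim_le_eps (B C w r e y : R) : 0 <= B -> 0 <= C -> 0 < e -> 0 < y <= 1 ->
  `|w| <= C * y -> `|r| <= C * y ->
  `|srcim B w r e y| <= C * (1 + 2 * B) * e / y ^+ 2.
Proof.
move=> B0 C0 e0 /andP[y0 y1] wC rC.
have r0 := sqnorm_gt0 y e0.
have iy := invsq_le e0 y0.
have H1 : `|- (w * e / (y ^+ 2 + e ^+ 2))| <= C * e / y ^+ 2.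
  rewrite normrN normrM normrM (gtr0_norm e0) (ger0_norm (_ : 0 <= _^-1)); last by pos.
  apply: ler_pM => //; first by pos.
    by pos.
  apply: ler_wpM2r; first by pos.
  by apply: le_trans wC _; rewrite -[leRHS]mulr1; apply: ler_wpM2l.
have H2 : `|B * r * wim e y| <= B * (C * y * (2 * e / y ^+ 3)).
  rewrite -mulrA normrM (ger0_norm B0); apply: ler_wpM2l => //.
  rewrite normrM (ger0_norm (wim_ge0 _ _)) //; last exact: ltW.
  by apply: ler_pM => //; [apply: wim_ge0 => //; exact: ltW | apply: wim_le_cube].
apply: le_trans (ler_normD _ _) _; apply: le_trans (lerD H1 H2) _.
by rewrite -subr_ge0 (_ : _ - _ = 0) //; field; rewrite gt_eqF.
Qed.

Lemma srcre_lim (B C w r e y : R) : 0 <= B -> 0 <= C -> 0 < e -> 0 < y <= 1 ->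
  `|w| <= C * y -> `|r| <= C * y ->
  `|srcre B w r e y - (w / y - B * r / y ^+ 2)| <= C * (1 + 4 * B) * e ^+ 2 / y ^+ 4.
Proof.
move=> B0 C0 e0 /andP[y0 y1] wC rC.
have r0 := sqnorm_gt0 y e0.
have yn : y != 0 by rewrite gt_eqF.
have yy : C * y <= C by rewrite -[leRHS]mulr1; apply: ler_wpM2l.
have /andP[W0 W1] := invsq_sub_wre e0 y0.
have -> : srcre B w r e y - (w / y - B * r / y ^+ 2) =
   B * r * (y ^- 2 - wre e y) - w * (e ^+ 2 / (y * (y ^+ 2 + e ^+ 2))).
  by rewrite /srcre; field; rewrite yn gt_eqF.
have H1 : `|B * r * (y ^- 2 - wre e y)| <= B * C * (4 * e ^+ 2 / y ^+ 4).
  rewrite normrM normrM (ger0_norm B0) (ger0_norm W0).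
  by apply: ler_pM => //; [pos|apply: ler_wpM2l => //; apply: le_trans yy].
have H2 : `|w * (e ^+ 2 / (y * (y ^+ 2 + e ^+ 2)))| <= C * (e ^+ 2 / y ^+ 4).
  rewrite normrM (ger0_norm (_ : 0 <= e ^+ 2 / _)); last by pos.
  apply: ler_pM => //; first by pos.
    exact: le_trans yy.
  apply: ler_wpM2l; first by pos.
  rewrite lef_pV2 ?posrE; [|by pos|by pos].
  rewrite (_ : y ^+ 4 = y * (y * y ^+ 2)); last by ring.
  apply: ler_wpM2l; first exact: ltW.
  apply: le_trans (_ : y ^+ 2 <= _); last by rewrite lerDl sqr_ge0.
  by rewrite -[leRHS]mul1r; apply: ler_wpM2r => //; pos.
apply: le_trans (ler_normB _ _) _; apply: le_trans (lerD H1 H2) _.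
by rewrite -subr_ge0 (_ : _ - _ = 0) //; field.
Qed.

End Weights.

(** * The real system *)

Set Typeclasses Depth 3.

Section RealSystem.
Context {R : realType}.
Implicit Types (B C e y : R) (om rh p q dp dq : R -> R).

(** The two real parts of one complex equation: since z^-2 = wre - i wim, p + i q solves the
    equation of psi^+ for y0 = 0 and the real data [om], [rh]. The derivatives are continuous up to
    the end points, so that the slopes at 0 and 1 make sense. *)
Record real_sol B (m2 : R) om rh e p q dp dq : Prop := RealSol {
  rs_cp : cont_itv 0 1 p; rs_cq : cont_itv 0 1 q;
  rs_cdp : cont_itv 0 1 dp; rs_cdq : cont_itv 0 1 dq;
  rs_p0 : p 0 = 0; rs_p1 : p 1 = 0; rs_q0 : q 0 = 0; rs_q1 : q 1 = 0;
  rs_dp : forall y, 0 < y < 1 -> is_derive y 1 p (dp y);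
  rs_dq : forall y, 0 < y < 1 -> is_derive y 1 q (dq y);
  rs_ddp : forall y, 0 < y < 1 -> is_derive y 1 dp
    (m2 * p y - B * (wre e y * p y + wim e y * q y) + srcre B (om y) (rh y) e y);
  rs_ddq : forall y, 0 < y < 1 -> is_derive y 1 dq
    (m2 * q y - B * (wre e y * q y - wim e y * p y) + srcim B (om y) (rh y) e y) }.

(* Maximum principle for functions convex in ln y. *)
Lemma log_convex_le0 (a b : R) (g dg ddg : R -> R) : 0 <= a ->
  cont_itv a b g -> (forall y, a < y < b -> is_derive y 1 g (dg y)) ->
  (forall y, a < y < b -> is_derive y 1 (fun z => z * dg z) (ddg y)) ->
  (forall y, a < y < b -> 0 <= ddg y) -> g a <= 0 -> g b <= 0 ->
  forall y, a <= y <= b -> g y <= 0.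
Proof.
move=> a0 cg Dg Dh h0 ga gb y /andP[ay yb]; rewrite leNgt; apply/negP => gy.
have ay' : a < y.
  by rewrite lt_neqAle ay andbT; apply/eqP => ya; move: gy; rewrite -ya ltNge ga.
have yb' : y < b.
  by rewrite lt_neqAle yb andbT; apply/eqP => ya; move: gy; rewrite ya ltNge gb.
have [c1 [/andP[ac1 c1y] e1]] : exists c, a < c < y /\ g y - g a = dg c * (y - a).
  apply: MVT_oo => //; last exact: cont_itv_sub cg.
  by move=> x /andP[ax xy]; apply: Dg; rewrite ax (lt_trans xy).
have [c2 [/andP[yc2 c2b] e2]] : exists c, y < c < b /\ g b - g y = dg c * (b - y).
  apply: MVT_oo => //; last exact: cont_itv_sub cg.
  by move=> x /andP[ax xy]; apply: Dg; rewrite xy (lt_trans ay').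
have d1 : 0 < dg c1.
  by rewrite -(pmulr_lgt0 _ (_ : 0 < y - a)) ?subr_gt0 // -e1; lra.
have d2 : dg c2 < 0.
  by rewrite -(pmulr_llt0 _ (_ : 0 < b - y)) ?subr_gt0 // -e2; lra.
have c12 : c1 < c2 := lt_trans c1y yc2.
have : c1 * dg c1 <= c2 * dg c2.
  apply: (@derive_ge0_le _ _ _ (fun z => z * dg z) ddg); first exact: ltW.
  - by move=> x /andP[h1 h2]; apply: Dh; rewrite (lt_trans ac1) //= (lt_trans h2).
  - apply: (@cont_itv_derive _ _ _ _ ddg) => x /andP[h1 h2]; apply: Dh.
    by rewrite (lt_le_trans ac1) //= (le_lt_trans h2).
  - by move=> x /andP[h1 h2]; apply: h0; rewrite (lt_trans ac1) //= (lt_trans h2).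
have c10 : 0 < c1 := le_lt_trans a0 ac1.
have := mulr_gt0 c10 d1; have := mulr_gt0 (lt_trans c10 c12) (_ : 0 < - dg c2).
by rewrite oppr_gt0 => /(_ d2); lra.
Qed.

(** * The case beta^2 <= 1/4: comparison in the variable ln y *)

Section Subcritical.
Variables (B m2 C e : R) (om rh p q dp dq : R -> R).
Hypotheses (B0 : 0 <= B) (B14 : B <= 4^-1) (m20 : 0 <= m2) (C0 : 0 <= C).
Hypotheses (e0 : 0 < e) (e1 : e <= 1).
Hypothesis omC : forall y, 0 <= y <= 1 -> `|om y| <= C * y.
Hypothesis rhC : forall y, 0 <= y <= 1 -> `|rh y| <= C * y.
Hypothesis sol : real_sol B m2 om rh e p q dp dq.

Let Cs := 2 * C * (1 + B).

(** The constant depends on e and serves only qualitatively: it makes |psi|^2 / y tend to 0 at 0 and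
    its supremum finite. *)
Lemma sol_linear_bound : exists2 L, 0 <= L &
  forall y, 0 <= y <= 1 -> p y ^+ 2 + q y ^+ 2 <= L * y ^+ 2.
Proof.
have [K1 K10 H1] := cont_itv_bounded ler01 (rs_cdp sol).
have [K2 K20 H2] := cont_itv_bounded ler01 (rs_cdq sol).
exists (K1 ^+ 2 + K2 ^+ 2); first by pos.
have aux f df K : cont_itv 0 1 f -> f 0 = 0 ->
    (forall y, 0 < y < 1 -> is_derive y 1 f (df y)) ->
    (forall y, 0 <= y <= 1 -> `|df y| <= K) ->
    forall y, 0 <= y <= 1 -> f y ^+ 2 <= (K * y) ^+ 2.
  move=> cf f0 Df bf y /andP[y0 y1].
  have : `|f y - f 0| <= K * (y - 0).
    apply: (derive_le_dist y0) (cont_itv_sub _ _ cf) _ => // x /andP[x0 xy].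
      by apply: Df; rewrite x0 (lt_le_trans xy).
    by apply: bf; rewrite ltW //= ltW // (lt_le_trans xy).
  rewrite f0 !subr0 => h; rewrite -[f y ^+ 2]real_normK ?num_real //.
  by rewrite ler_pXn2r // ?nnegrE ?normr_ge0 // (le_trans (normr_ge0 _) h).
move=> y y01; rewrite mulrDl -!exprMn; apply: lerD.
  exact: (aux _ _ _ (rs_cp sol) (rs_p0 sol) (rs_dp sol) H1).
exact: (aux _ _ _ (rs_cq sol) (rs_q0 sol) (rs_dq sol) H2).
Qed.

Lemma normr_le_sqrt (u V y : R) : 0 <= V -> 0 <= y -> u ^+ 2 <= V ^+ 2 * y ->
  `|u| <= V * Num.sqrt y.
Proof.
move=> V0 y0 h; rewrite -(@ler_pXn2r _ 2) // ?nnegrE ?mulr_ge0 ?sqrtr_ge0 //.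
by rewrite real_normK ?num_real // exprMn sqr_sqrtr.
Qed.

(** A bootstrap step. For psi = p + i q and g = |psi|^2 / (2 z), the quantity (z g')' is |psi' - psi
    / (2 z)|^2 + |psi|^2 (1 / (4 z^2) - B wre) + m2 |psi|^2 plus sources, and the second term is
    nonnegative because wre <= z^-2 and B <= 1/4. By the assumed bound the sources are at most 2 Cs
    V / sqrt z, which is (z h')' for h = 8 Cs V sqrt z. *)
Lemma sol_bound_improve V : 0 <= V ->
  (forall y, 0 < y <= 1 -> p y ^+ 2 + q y ^+ 2 <= V ^+ 2 * y) ->
  forall y, 0 < y <= 1 -> p y ^+ 2 + q y ^+ 2 <= 16 * Cs * V * y.
Proof.
move=> V0 HV y /andP[y0 y1].
have Cs0 : 0 <= Cs by rewrite /Cs; pos.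
have [L L0 HL] := sol_linear_bound.
pose f z := (p z ^+ 2 + q z ^+ 2) / (2 * z) + 8 * Cs * V * Num.sqrt z.
suff fy : f y <= 8 * Cs * V.
  have : (p y ^+ 2 + q y ^+ 2) / (2 * y) <= 8 * Cs * V.
    by apply: le_trans fy; rewrite lerDl; pos.
  by rewrite ler_pdivrMr; [lra | pos].
apply/ler_addgt0Pr => eta eta0.
(* The division by z forbids starting at 0. [al] is so small that the linear bound makes the first
   term of [f] at most eta there. *)
pose al := Num.min y (2 * eta / (L + 1)).
have al0 : 0 < al by rewrite lt_min y0 /= divr_gt0 // ?mulr_gt0 // ltr_wpDl.
have aly : al <= y by rewrite ge_min lexx.
have al1 : al <= 1 := le_trans aly y1.
have fal : f al <= 8 * Cs * V + eta.
  rewrite addrC; apply: lerD.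
    apply: (le_trans (ler_wpM2r _ (HL al _))); first by pos.
      by rewrite al1 ltW.
    have : al <= 2 * eta / (L + 1) by rewrite ge_min lexx orbT.
    rewrite ler_pdivlMr ?ltr_wpDl // => h.
    have -> : L * al ^+ 2 / (2 * al) = L * al / 2 by field; rewrite gt_eqF.
    lra.
  rewrite -[leRHS]mulr1; apply: ler_wpM2l; first by pos.
  by rewrite -(sqrtr1 R) ler_wsqrtr.
pose df z := (p z * dp z + q z * dq z) / z - (p z ^+ 2 + q z ^+ 2) / (2 * z ^+ 2) +
   4 * Cs * V / Num.sqrt z.
pose ddf z := (dp z - p z / (2 * z)) ^+ 2 + (dq z - q z / (2 * z)) ^+ 2
  + (p z ^+ 2 + q z ^+ 2) * ((4 * z ^+ 2)^-1 - B * wre e z)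
  + m2 * (p z ^+ 2 + q z ^+ 2) + (p z * srcre B (om z) (rh z) e z
  + q z * srcim B (om z) (rh z) e z + 2 * Cs * V / Num.sqrt z).
rewrite -subr_le0.
apply: (@log_convex_le0 al 1 (fun z => f z - (8 * Cs * V + eta)) df ddf); rewrite ?aly //.
- exact: ltW.
- rewrite /f; cont; try by apply: cont_itv_sub (rs_cp sol) => //; exact: ltW.
    by apply: cont_itv_sub (rs_cq sol) => //; exact: ltW.
  by move=> x /andP[ax _]; rewrite gt_eqF // mulr_gt0 // (lt_le_trans al0).
- move=> z /andP[az z1]; have z0 : 0 < z := lt_trans al0 az.
  have hp := rs_dp sol (y := z); have hq := rs_dq sol (y := z).
  rewrite z0 z1 in hp hq; have {}hp := hp isT; have {}hq := hq isT.
  have sz : Num.sqrt z != 0 by rewrite gt_eqF // sqrtr_gt0.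
  rewrite /f; eapply is_derive_eq; first by der; rewrite // mulf_neq0 // gt_eqF.
  by rewrite /df /=; field; rewrite sz gt_eqF.
- move=> z /andP[az z1]; have z0 : 0 < z := lt_trans al0 az.
  have hp := rs_dp sol (y := z); have hq := rs_dq sol (y := z).
  have hdp := rs_ddp sol (y := z); have hdq := rs_ddq sol (y := z).
  rewrite z0 z1 in hp hq hdp hdq; have {}hp := hp isT; have {}hq := hq isT.
  have {}hdp := hdp isT; have {}hdq := hdq isT.
  have sz : Num.sqrt z != 0 by rewrite gt_eqF // sqrtr_gt0.
  rewrite /df; eapply is_derive_eq.
    by der; rewrite // ?mulf_neq0 // ?expf_neq0 // gt_eqF.
  rewrite /ddf /=; have zz : z = Num.sqrt z ^+ 2 by rewrite sqr_sqrtr // ltW.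
  set r := Num.sqrt z in sz zz *.
  move: (srcre _ _ _ _ _) (srcim _ _ _ _ _) (wre _ _) (wim _ _) (p z) (q z) (dp z) (dq z) => *.
  by rewrite zz; field; rewrite sz.
- move=> z /andP[az z1]; have z0 : 0 < z := lt_trans al0 az.
  have zI : 0 <= z <= 1 by rewrite !ltW.
  have zI' : 0 < z <= 1 by rewrite z0 ltW.
  have s1 := srcre_le B0 C0 e0 e1 zI (omC zI) (rhC zI).
  have s2 := srcim_le B0 C0 e0 e1 zI (omC zI) (rhC zI).
  have Cz : Cs / (z + e) <= Cs / z.
    by apply: ler_wpM2l => //; rewrite lef_pV2 ?posrE ?addr_gt0 // lerDl ltW.
  have pV : `|p z| <= V * Num.sqrt z.
    by apply: normr_le_sqrt => //; [exact: ltW|apply: le_trans (HV _ zI'); rewrite lerDl sqr_ge0].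
  have qV : `|q z| <= V * Num.sqrt z.
    by apply: normr_le_sqrt => //; [exact: ltW|apply: le_trans (HV _ zI'); rewrite lerDr sqr_ge0].
  have E : V * Num.sqrt z * (Cs / z) = Cs * V / Num.sqrt z.
    have sz : Num.sqrt z != 0 by rewrite gt_eqF // sqrtr_gt0.
    rewrite -{2}(sqr_sqrtr (ltW z0)); move: (Num.sqrt z) sz => r sz; by field.
  have ps : `|p z * srcre B (om z) (rh z) e z| <= Cs * V / Num.sqrt z.
    by rewrite -E normrM ler_pM // (le_trans s1).
  have qs : `|q z * srcim B (om z) (rh z) e z| <= Cs * V / Num.sqrt z.
    by rewrite -E normrM ler_pM // (le_trans s2).
  have w : B * wre e z <= (4 * z ^+ 2)^-1.
    apply: le_trans (_ : B * z ^- 2 <= _).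
      apply: ler_wpM2l => //; apply: le_trans (ler_norm _) _.
      by apply: le_trans (wre_le _ e0) _; apply: invsq_le.
    by rewrite [(4 * _)^-1]invfM; apply: ler_wpM2r => //; pos.
  rewrite /ddf /=; apply: addr_ge0; first by pos.
  by move: ps qs; rewrite !ler_norml => /andP[? _] /andP[? _]; lra.
- by rewrite subr_le0.
- by rewrite subr_le0 /f (rs_p1 sol) (rs_q1 sol) sqrtr1; lra.
Qed.

(** For S the supremum of |psi|^2 / z the bootstrap step reads S <= 16 Cs sqrt S, hence sqrt S <= 16
    Cs, a bound free of e. *)
Lemma sol_bound y : 0 <= y <= 1 -> p y ^+ 2 + q y ^+ 2 <= (16 * Cs) ^+ 2 * y.
Proof.
have Cs0 : 0 <= Cs by rewrite /Cs; pos.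
have [L L0 HL] := sol_linear_bound.
pose S := [set (p z ^+ 2 + q z ^+ 2) / z | z in [set z | 0 < z <= 1]].
have S0 : S !=set0 by exists ((p 1 ^+ 2 + q 1 ^+ 2) / 1); exists 1; rewrite //= ltr01 lexx.
have Sub : has_ubound S.
  exists L => _ [z /= /andP[z0 z1] <-]; rewrite ler_pdivrMr //.
  apply: le_trans (HL _ _) _; first by rewrite ltW.
  by apply: ler_wpM2l => //; rewrite expr2 -[leRHS]mul1r; apply: ler_wpM2r; rewrite // ltW.
have s0 : 0 <= sup S.
  apply: le_trans (ub_le_sup Sub (_ : S ((p 1 ^+ 2 + q 1 ^+ 2) / 1))); first by pos.
  by exists 1; rewrite //= ltr01 lexx.
have HV z : 0 < z <= 1 -> p z ^+ 2 + q z ^+ 2 <= Num.sqrt (sup S) ^+ 2 * z.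
  move=> z01; have /andP[z0 z1] := z01; rewrite sqr_sqrtr // -ler_pdivrMr //.
  by apply: ub_le_sup => //; exists z.
have H := sol_bound_improve (sqrtr_ge0 _) HV.
have sS : sup S <= 16 * Cs * Num.sqrt (sup S).
  apply: ge_sup => // _ [z /= z01 <-]; have /andP[z0 z1] := z01.
  by rewrite ler_pdivrMr // H.
have sC : Num.sqrt (sup S) <= 16 * Cs.
  have [h|h] := leP (Num.sqrt (sup S)) 0; first by apply: le_trans h _; pos.
  by rewrite -(ler_pM2r h) -expr2 sqr_sqrtr.
move=> /andP[y0 y1]; move: y0; rewrite le_eqVlt => /predU1P[<-|y0].
  by rewrite (rs_p0 sol) (rs_q0 sol) expr0n addr0 mulr0.
apply: le_trans (HV y _) _; first by rewrite y0.
by apply: ler_wpM2r; [exact: ltW | rewrite ler_pXn2r // nnegrE //; pos].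
Qed.

Let V := 16 * Cs.
Let D := 2 * B * V ^+ 2 + C * V * (1 + 2 * B).

(** With g = q^2 / (2 z), the coupling B wim p q and the source contribute O(e / z^2) to (z g')',
    and D e / z, for which this expression is D e / z^2, absorbs them. A multiple of ln z
    contributes nothing, so [ka] is free to be fixed by the sign at z = e; its size 1 / ln (1/e) is
    the rate obtained. *)
Lemma sol_im_decay y : e < 1 -> 0 <= y <= 1 ->
  q y ^+ 2 <= (V ^+ 2 + 2 * D) * (e - (ln e)^-1).
Proof.
move=> e1' /andP[y0 y1].
have Cs0 : 0 <= Cs by rewrite /Cs; pos.
have V0 : 0 <= V by rewrite /V; pos.
have D0 : 0 <= D by rewrite /D; pos.
have le0 : ln e < 0 by rewrite ln_lt0 // e0.
pose ka := (V ^+ 2 / 2 + D) / - ln e.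
have ka0 : 0 <= ka by rewrite /ka divr_ge0 ?oppr_ge0 ?(ltW le0) //; pos.
have lek : ka * ln e = - (V ^+ 2 / 2 + D) by rewrite /ka; field; rewrite lt_eqF.
have qV2 z : 0 <= z <= 1 -> q z ^+ 2 <= V ^+ 2 * z.
  by move=> z01; apply: le_trans (sol_bound z01); rewrite lerDr sqr_ge0.
(* Up to y = e the bound V^2 y suffices; the comparison function is used on [e, 1] only. *)
have [ye|ey] := leP y e.
  apply: le_trans (qV2 _ _) _; first by rewrite y0.
  have V20 := sqr_ge0 V; have Vy : V ^+ 2 * y <= V ^+ 2 * e by apply: ler_wpM2l.
  have : 0 <= - (ln e)^-1 by rewrite oppr_ge0 invr_le0 ltW.
  move: (- (ln e)^-1) => l l0; rewrite mulrDr.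
  have := mulr_ge0 D0 (ltW e0).
  have : 0 <= (V ^+ 2 + 2 * D) * l by pos.
  lra.
pose f z := q z ^+ 2 / (2 * z) + D * e / z - D * e + ka * ln z.
have yy0 : 0 < y := lt_trans e0 ey.
suff fy : f y <= 0.
  have ly : - (y * ln y) <= 1.
    have : ln (1 + (y^-1 - 1)) <= y^-1 - 1.
      apply: le_ln1Dx; have : 0 < y^-1 by rewrite invr_gt0. lra.
    rewrite (_ : 1 + _ = y^-1); last by ring.
    rewrite lnV ?posrE // => h; rewrite -mulrN.
    apply: le_trans (_ : y * y^-1 <= _); last by rewrite divff // gt_eqF.
    by apply: ler_wpM2l => //; lra.
  have h1 : q y ^+ 2 + 2 * D * e - 2 * y * D * e + 2 * ka * (y * ln y) <= 0.
    rewrite (_ : _ + _ = f y * (2 * y)); last by rewrite /f; field; rewrite gt_eqF.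
    by rewrite mulr_le0_ge0 //; pos.
  have h2 : ka * (- (y * ln y)) <= ka * 1 by apply: ler_wpM2l.
  have h3 : y * (D * e) <= 1 * (D * e) by apply: ler_wpM2r => //; pos.
  have h4 : 2 * ka = (V ^+ 2 + 2 * D) * - (ln e)^-1.
    by rewrite /ka; field; rewrite lt_eqF.
  have h5 : 0 <= V ^+ 2 * e by pos.
  have h6 : 0 <= D * e by pos.
  have h7 : 0 <= D * (y * e) by pos.
  by rewrite mulrDr -h4; lra.
pose df z := q z * dq z / z - q z ^+ 2 / (2 * z ^+ 2) - D * e / z ^+ 2 + ka / z.
pose ddf z := (dq z - q z / (2 * z)) ^+ 2
  + q z ^+ 2 * ((4 * z ^+ 2)^-1 - B * wre e z)
  + m2 * q z ^+ 2 + (B * wim e z * (p z * q z)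
  + q z * srcim B (om z) (rh z) e z + D * e / z ^+ 2).
have HI z : e < z < 1 -> 0 < z < 1 by move=> /andP[h ->]; rewrite (lt_trans e0).
apply: (@log_convex_le0 e 1 f df ddf); rewrite ?(ltW ey) ?y1 //.
- exact: ltW.
- rewrite /f; cont; try by apply: cont_itv_sub (rs_cq sol) => //; exact: ltW.
  + by move=> x /andP[ax _]; rewrite gt_eqF // mulr_gt0 // (lt_le_trans e0).
  + by move=> x /andP[ax _]; rewrite gt_eqF // (lt_le_trans e0).
  + by move=> x /andP[ax _]; rewrite (lt_le_trans e0).
- move=> z /HI zI; have /andP[z0 z1] := zI.
  have hq := rs_dq sol zI.
  rewrite /f; eapply is_derive_eq; first by der; rewrite // ?mulf_neq0 // gt_eqF.
  by rewrite /df /=; field; rewrite gt_eqF.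
- move=> z /HI zI; have /andP[z0 z1] := zI.
  have hq := rs_dq sol zI; have hdq := rs_ddq sol zI.
  rewrite /df; eapply is_derive_eq.
    by der; rewrite // ?mulf_neq0 // ?expf_neq0 // gt_eqF.
  rewrite /ddf /=; by field; rewrite gt_eqF.
- move=> z /HI /andP[z0 z1].
  have zI : 0 <= z <= 1 by rewrite !ltW.
  have zI' : 0 < z <= 1 by rewrite z0 ltW.
  have s2 := srcim_le_eps B0 C0 e0 zI' (omC zI) (rhC zI).
  have qV := normr_le_sqrt V0 (ltW z0) (qV2 _ zI).
  have pV : `|p z| <= V * Num.sqrt z.
    by apply: normr_le_sqrt => //; [exact: ltW|apply: le_trans (sol_bound zI); rewrite lerDl sqr_ge0].
  have sz1 : Num.sqrt z <= 1 by rewrite -(sqrtr1 R) ler_wsqrtr // ltW.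
  have qs : `|q z * srcim B (om z) (rh z) e z| <= C * V * (1 + 2 * B) * (e / z ^+ 2).
    rewrite (_ : C * V * _ * _ = V * (C * (1 + 2 * B) * e / z ^+ 2)); last by ring.
    rewrite normrM ler_pM // (le_trans qV) //.
    by rewrite -[leRHS]mulr1; apply: ler_wpM2l.
  have pq : `|B * wim e z * (p z * q z)| <= 2 * B * V ^+ 2 * (e / z ^+ 2).
    rewrite (_ : 2 * B * _ * _ = B * (2 * e / z ^+ 3) * (V ^+ 2 * z)); last first.
      by field; rewrite gt_eqF.
    have W0 := wim_ge0 e0 (ltW z0).
    rewrite normrM (ger0_norm (_ : 0 <= B * wim e z)); last by pos.
    apply: ler_pM => //; first by pos.
      by apply: ler_wpM2l => //; apply: wim_le_cube.
    rewrite normrM (_ : V ^+ 2 * z = (V * Num.sqrt z) * (V * Num.sqrt z)); first exact: ler_pM.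
    have := sqr_sqrtr (ltW z0); move: (Num.sqrt z) => r <-; ring.
  have w : B * wre e z <= (4 * z ^+ 2)^-1.
    apply: le_trans (_ : B * z ^- 2 <= _).
      apply: ler_wpM2l => //; apply: le_trans (ler_norm _) _.
      by apply: le_trans (wre_le _ e0) _; apply: invsq_le.
    by rewrite [(4 * _)^-1]invfM; apply: ler_wpM2r => //; pos.
  rewrite /ddf /=; apply: addr_ge0; first by pos.
  have : D * e / z ^+ 2 = 2 * B * V ^+ 2 * (e / z ^+ 2) + C * V * (1 + 2 * B) * (e / z ^+ 2).
    by rewrite /D; ring.
  by move: pq qs; rewrite !ler_norml => /andP[? _] /andP[? _]; lra.
- rewrite /f lek.
  have : q e ^+ 2 / (2 * e) <= V ^+ 2 / 2.
    rewrite ler_pdivrMr ?mulr_gt0 //; apply: le_trans (qV2 _ _) _.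
      by rewrite e1 ltW.
    lra.
  have : D * e / e = D by field; rewrite gt_eqF.
  have : 0 <= D * e by pos.
  lra.
- by rewrite /f (rs_q1 sol) ln1 invr1; lra.
Qed.

End Subcritical.

Definition im_vanishes B (m2 : R) om rh := forall eta : R, 0 < eta ->
  exists2 e0, 0 < e0 & forall e p q dp dq, 0 < e < e0 ->
  real_sol B m2 om rh e p q dp dq -> forall y, 0 <= y <= 1 -> `|q y| <= eta.

Lemma im_vanishes_subcritical B (m2 : R) C om rh :
  0 <= B -> B <= 4^-1 -> 0 <= m2 -> 0 <= C ->
  (forall y, 0 <= y <= 1 -> `|om y| <= C * y) ->
  (forall y, 0 <= y <= 1 -> `|rh y| <= C * y) -> im_vanishes B m2 om rh.
Proof.
move=> B0 B14 m20 C0 omC rhC eta eta0.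
pose V := 16 * (2 * C * (1 + B)).
pose D := 2 * B * V ^+ 2 + C * V * (1 + 2 * B).
pose K := V ^+ 2 + 2 * D + 1.
have K0' : 0 <= V ^+ 2 + 2 * D by rewrite /D /V; pos.
have K0 : 0 < K by rewrite ltr_wpDl.
pose L := 2 * K / eta ^+ 2.
have L0 : 0 < L by rewrite /L; pos.
(* The last two thresholds make e and - 1 / ln e at most 1 / L each, and 2 K / L = eta^2. *)
exists (Num.min (2^-1) (Num.min (L^-1) (expR (- L)))).
  by rewrite !lt_min expR_gt0 !invr_gt0 andbT; apply/andP; split.
move=> e p q dp dq /andP[e0]; rewrite !lt_min => /andP[e12 /andP[eL elnL]] sol y y01.
have e1 : e < 1 by lra.
have H := sol_im_decay B0 B14 m20 C0 e0 (ltW e1) omC rhC sol e1 y01.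
have lne : ln e <= - L by rewrite -(expRK (- L)) ler_ln ?posrE ?expR_gt0 // ltW.
have h1 : - (ln e)^-1 <= L^-1.
  by rewrite -invrN lef_pV2 ?posrE //; lra.
have h2 : q y ^+ 2 <= eta ^+ 2.
  apply: le_trans H _; apply: le_trans (_ : K * (L^-1 + L^-1) <= _).
    apply: ler_pM => //; last by lra.
      by rewrite subr_ge0; apply: le_trans (ltW e0); rewrite invr_le0; lra.
    by rewrite /K lerDl.
  by rewrite /L -subr_ge0 (_ : _ - _ = 0) //; field; rewrite !gt_eqF.
by rewrite -(@ler_pXn2r _ 2) ?nnegrE ?(ltW eta0) // real_normK ?num_real.
Qed.

End RealSystem.

(** * The oscillatory case *)

Section Supercritical.
Context {R : realType}.

(* The quantity conserved by u'' + B u / x^2 = 0; it is positive definite for B > 1/4. *)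
Definition euler_energy (B x u du : R) : R := x * du ^+ 2 - u * du + B * u ^+ 2 / x.

Lemma euler_energy_ge (B x u du : R) : 0 < x ->
  (B - 4^-1) * u ^+ 2 <= x * euler_energy B x u du.
Proof.
move=> x0; rewrite -subr_ge0 (_ : _ - _ = (x * du - u / 2) ^+ 2) ?sqr_ge0 //.
by rewrite /euler_energy; field; rewrite gt_eqF.
Qed.

Lemma euler_energy_ge_der (B x u du : R) : 4^-1 < B -> 0 < x ->
  (2 * x * du - u) ^+ 2 <= 4 * x * euler_energy B x u du.
Proof.
move=> B14 x0; rewrite -subr_ge0 (_ : _ - _ = 4 * (B - 4^-1) * u ^+ 2).
  by rewrite mulr_ge0 ?sqr_ge0 // mulr_ge0 // subr_ge0 ltW.
by rewrite /euler_energy; field; rewrite gt_eqF.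
Qed.

Lemma euler_energy_ge0 (B x u du : R) : 4^-1 < B -> 0 < x -> 0 <= euler_energy B x u du.
Proof.
move=> B14 x0; rewrite -(pmulr_rge0 _ x0); apply: le_trans (euler_energy_ge _ _ _ x0).
by rewrite mulr_ge0 ?sqr_ge0 // subr_ge0 ltW.
Qed.

Lemma is_derive_euler_energy (B e z d2 : R) (u du : R -> R) : 0 < z + e ->
  is_derive z 1 u (du z) -> is_derive z 1 du d2 ->
  is_derive z 1 (fun y => euler_energy B (y + e) (u y) (du y))
    ((2 * (z + e) * du z - u z) * (d2 + B * u z / (z + e) ^+ 2)).
Proof.
move=> x0 hu hdu; rewrite /euler_energy; eapply is_derive_eq.
  by der; rewrite // gt_eqF.
by rewrite /=; field; rewrite gt_eqF.
Qed.

Lemma sqrtD_le (a b : R) : 0 <= a -> 0 <= b -> Num.sqrt (a + b) <= Num.sqrt a + Num.sqrt b.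
Proof.
move=> a0 b0; rewrite -(@ler_pXn2r _ 2) // ?nnegrE ?addr_ge0 ?sqrtr_ge0 //.
rewrite sqrrD !sqr_sqrtr ?addr_ge0 //.
have : 0 <= Num.sqrt a * Num.sqrt b by pos.
rewrite mulr2n; lra.
Qed.

Variables (B m2 C : R) (om rh : R -> R).
Hypotheses (B14 : 4^-1 < B) (m20 : 0 <= m2) (C0 : 0 <= C).
Hypothesis omC : forall y, 0 <= y <= 1 -> `|om y| <= C * y.
Hypothesis rhC : forall y, 0 <= y <= 1 -> `|rh y| <= C * y.

(** [n2] is nu^2. [k] bounds bilinear terms by the energy, and the summands of [k0] come from the
    mass term, the error of the weights and the sources. [k1] and [K] are the resulting Gronwall
    constants. None of them involves e. *)
Let n2 := B - 4^-1.
Let k := (4 + n2^-1) / 2.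
Let Cs := 2 * C * (1 + B).
Let k0 := m2 * k + 16 * B * k + 2 * Cs.
Let k1 := 2 * k0 * expR k0.
Let K := expR (6 * k0) * (expR k0 + k1).

Let B0 : 0 <= B. Proof. by apply: le_trans (ltW B14); lra. Qed.
Let n20 : 0 < n2. Proof. by rewrite subr_gt0. Qed.
Let kge0 : 0 <= k. Proof. by rewrite /k; pos. Qed.
Let Cs0 : 0 <= Cs. Proof. by rewrite /Cs; pos. Qed.
Let k00 : 0 <= k0. Proof. by rewrite /k0; pos. Qed.
Let k10 : 0 <= k1. Proof. by rewrite /k1; pos. Qed.
Let K0 : 0 <= K. Proof. by rewrite /K; pos. Qed.

Section OneSolution.
Variables (e : R) (p q dp dq : R -> R).
Hypotheses (e0 : 0 < e) (e1 : e <= 1).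
Hypothesis sol : real_sol B m2 om rh e p q dp dq.

Let en z := euler_energy B (z + e) (p z) (dp z) + euler_energy B (z + e) (q z) (dq z).
(** The value of [en] at 0, where p = q = 0 and x = e: the one quantity that the energy estimate
    leaves open. *)
Let M := e * (dp 0 ^+ 2 + dq 0 ^+ 2).

Let M_ge0 : 0 <= M. Proof. by rewrite /M; pos. Qed.

Lemma energy_ge (z : R) : 0 <= z -> n2 * (p z ^+ 2 + q z ^+ 2) <= (z + e) * en z.
Proof.
by move=> z0; rewrite /en 2!mulrDr; apply: lerD; apply: euler_energy_ge; rewrite ltr_wpDl.
Qed.

Lemma energy_ge0 (z : R) : 0 <= z -> 0 <= en z.
Proof. by move=> z0; apply: addr_ge0; apply: euler_energy_ge0; rewrite // ltr_wpDl. Qed.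

(** The inequality between arithmetic and geometric means. [P] and [Q] stand for the factor 2 x u' -
    u in the derivative of the energy, whose square the energy controls by [euler_energy_ge_der]. *)
Lemma cross_le (P Q u v E x : R) : 0 < x -> P ^+ 2 + Q ^+ 2 <= 4 * x * E ->
  n2 * (u ^+ 2 + v ^+ 2) <= x * E -> `|P * u + Q * v| <= k * (x * E).
Proof.
move=> x0 h1 h2.
have h3 : u ^+ 2 + v ^+ 2 <= n2^-1 * (x * E).
  by rewrite mulrC ler_pdivlMr // mulrC.
have h4 : k * (x * E) = (4 * x * E + n2^-1 * (x * E)) / 2 by rewrite /k; field; rewrite gt_eqF.
have := sqr_ge0 (P - u); have := sqr_ge0 (P + u).
have := sqr_ge0 (Q - v); have := sqr_ge0 (Q + v).
rewrite h4 ler_norml => *; apply/andP; split; nra.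
Qed.

(** Gronwall's argument. With x = z + e the energy grows at a relative rate k0 (x + e / x^2 +
    x^(-1/2)), whose primitive [Phi] is bounded uniformly in e; the term e / x^2 is the error of
    replacing the weights by x^-2 and 0. *)
Lemma energy_bound (y : R) : 0 <= y <= 1 -> en y <= K * (M + Num.sqrt y).
Proof.
move=> /andP[y0 y1].
pose Phi z := k0 * ((z + e) ^+ 2 / 2 - e / (z + e) + 2 * Num.sqrt (z + e)).
(* The first term compensates the part k0 / sqrt x of the sources that is not proportional to the
   energy. [k1] is sized by exp (- Phi) <= exp k0, which holds because e / x <= 1. *)
pose F z := k1 * Num.sqrt (z + e) - en z * expR (- Phi z).
pose s1 z := srcre B (om z) (rh z) e z; pose s2 z := srcim B (om z) (rh z) e z.
pose P z := 2 * (z + e) * dp z - p z; pose Q z := 2 * (z + e) * dq z - q z.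
pose den z := P z * (m2 * p z + B * (((z + e) ^- 2 - wre e z) * p z - wim e z * q z) + s1 z)
  + Q z * (m2 * q z + B * (((z + e) ^- 2 - wre e z) * q z + wim e z * p z) + s2 z).
pose dPhi z := k0 * ((z + e) + e / (z + e) ^+ 2 + (Num.sqrt (z + e))^-1).
pose dF z := (k1 / 2) * (Num.sqrt (z + e))^-1 - (den z - en z * dPhi z) * expR (- Phi z).
have x0 z : 0 <= z -> 0 < z + e by move=> z0; rewrite ltr_wpDl.
have HI z : 0 < z < y -> 0 < z < 1 by move=> /andP[-> h]; rewrite (lt_le_trans h).
have DF z : 0 < z < y -> is_derive z 1 F (dF z).
  move=> /HI zI; have /andP[z0 z1] := zI; have xz := x0 _ (ltW z0).
  have sz : Num.sqrt (z + e) != 0 by rewrite gt_eqF // sqrtr_gt0.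
  have Hp := is_derive_euler_energy B xz (rs_dp sol zI) (rs_ddp sol zI).
  have Hq := is_derive_euler_energy B xz (rs_dq sol zI) (rs_ddq sol zI).
  have Hen : is_derive z 1 en (den z).
    eapply is_derive_eq; first exact: is_derive_add Hp Hq.
    rewrite /den /P /Q -/(s1 z) -/(s2 z).
    move: (s1 _) (s2 _) (wre _ _) (wim _ _) (p z) (q z) (dp z) (dq z) => *.
    by field; rewrite gt_eqF.
  rewrite /F /Phi; eapply is_derive_eq; first by der; rewrite // gt_eqF.
  rewrite /dF /dPhi /Phi /=; move: (expR _) (en z) (den z) => *.
  by field; rewrite sz gt_eqF.
have dF0 z : 0 < z < y -> 0 <= dF z.
  move=> /HI /andP[z0 z1]; have xz := x0 _ (ltW z0).
  have zI : 0 <= z <= 1 by rewrite !ltW.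
  have S1 : `|s1 z| <= _ := srcre_le B0 C0 e0 e1 zI (omC zI) (rhC zI).
  have S2 : `|s2 z| <= _ := srcim_le B0 C0 e0 e1 zI (omC zI) (rhC zI).
  rewrite -/Cs in S1 S2.
  have E0 := energy_ge0 (ltW z0); have E1 := energy_ge (ltW z0).
  have E2 : P z ^+ 2 + Q z ^+ 2 <= 4 * (z + e) * en z.
    by rewrite /en mulrDr; apply: lerD; apply: euler_energy_ge_der.
  have sz : 0 < Num.sqrt (z + e) by rewrite sqrtr_gt0.
  have c1 : `|P z * p z + Q z * q z| <= k * ((z + e) * en z) by apply: cross_le.
  have c2 : `|P z * - q z + Q z * p z| <= k * ((z + e) * en z).
    by apply: cross_le => //; rewrite sqrrN addrC.
  (* Splitting |u| against sqrt x turns sources of size Cs / x into x^(-1/2) times 1 + en, which is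
     integrable. *)
  have amgm u : `|u| <= Num.sqrt (z + e) * (1 + u ^+ 2 / (4 * (z + e))).
    have -> : Num.sqrt (z + e) * (1 + u ^+ 2 / (4 * (z + e))) = `|u| + (`|u| / 2 - Num.sqrt (z + e)) ^+ 2 / Num.sqrt (z + e).
      have := sqr_sqrtr (ltW xz); move: (Num.sqrt (z + e)) sz => r r0 <-.
      by rewrite -(real_normK (num_real u)); field; rewrite gt_eqF.
    by rewrite lerDl; pos.
  have Ps : `|P z * s1 z + Q z * s2 z| <= 2 * Cs / Num.sqrt (z + e) * (1 + en z).
    apply: le_trans (ler_normD _ _) _; rewrite !normrM.
    apply: le_trans (_ : (`|P z| + `|Q z|) * (Cs / (z + e)) <= _).
      by rewrite mulrDl; apply: lerD; apply: ler_wpM2l.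
    have h : `|P z| + `|Q z| <= Num.sqrt (z + e) * (2 + en z).
      apply: le_trans (lerD (amgm _) (amgm _)) _; rewrite -mulrDr.
      apply: ler_wpM2l; first exact: ltW.
      have : (P z ^+ 2 + Q z ^+ 2) / (4 * (z + e)) <= en z.
        by rewrite ler_pdivrMr; [rewrite mulrC|pos].
      rewrite mulrDl; lra.
    apply: le_trans (ler_wpM2r _ h) _; first by pos.
    have -> : Num.sqrt (z + e) * (2 + en z) * (Cs / (z + e)) = (2 + en z) * (Cs / Num.sqrt (z + e)).
      have := sqr_sqrtr (ltW xz); move: (Num.sqrt (z + e)) sz => r r0 <-.
      by field; rewrite gt_eqF.
    rewrite (_ : 2 * Cs / _ * _ = (2 + 2 * en z) * (Cs / Num.sqrt (z + e))); last by ring.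
    by apply: ler_wpM2r; [pos|lra].
  have W1 := invsq_shift_sub_wre e0 (ltW z0).
  have W2 := wim_le_shift e0 (ltW z0).
  have W3 := wim_ge0 e0 (ltW z0).
  have T1 : m2 * (P z * p z + Q z * q z) <= m2 * k * (z + e) * en z.
    rewrite (_ : m2 * k * _ * _ = m2 * (k * ((z + e) * en z))); last by ring.
    by apply: ler_wpM2l => //; apply: le_trans (ler_norm _) c1.
  have T2 : B * (((z + e) ^- 2 - wre e z) * (P z * p z + Q z * q z)) <= 8 * B * k * (e / (z + e) ^+ 2) * en z.
    rewrite (_ : 8 * B * _ * _ * _ = B * (8 * e / (z + e) ^+ 3 * (k * ((z + e) * en z)))); last first.
      by field; rewrite gt_eqF.
    apply: ler_wpM2l => //; apply: le_trans (ler_norm _) _; rewrite normrM.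
    by apply: ler_pM.
  have T3 : B * (wim e z * (P z * - q z + Q z * p z)) <= 8 * B * k * (e / (z + e) ^+ 2) * en z.
    rewrite (_ : 8 * B * _ * _ * _ = B * (8 * e / (z + e) ^+ 3 * (k * ((z + e) * en z)))); last first.
      by field; rewrite gt_eqF.
    apply: ler_wpM2l => //; apply: le_trans (ler_norm _) _; rewrite normrM ger0_norm //.
    by apply: ler_pM.
  have Hden : den z <= en z * dPhi z + k0 * (Num.sqrt (z + e))^-1.
    have -> : den z = m2 * (P z * p z + Q z * q z) +
      B * (((z + e) ^- 2 - wre e z) * (P z * p z + Q z * q z)) +
      B * (wim e z * (P z * - q z + Q z * p z)) + (P z * s1 z + Q z * s2 z).
      by rewrite /den; ring.
    have {}Ps := le_trans (ler_norm _) Ps.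
    have a1 : 0 <= (z + e) * en z by pos.
    have a2 : 0 <= e / (z + e) ^+ 2 * en z by pos.
    have a3 : 0 <= (Num.sqrt (z + e))^-1 * en z by pos.
    have a4 : 0 <= (Num.sqrt (z + e))^-1 by pos.
    have -> : en z * dPhi z + k0 * (Num.sqrt (z + e))^-1 =
      k0 * ((z + e) * en z) + k0 * (e / (z + e) ^+ 2 * en z)
      + k0 * ((Num.sqrt (z + e))^-1 * en z) + k0 * (Num.sqrt (z + e))^-1.
      by rewrite /dPhi; ring.
    have b1 : m2 * k * ((z + e) * en z) <= k0 * ((z + e) * en z).
      apply: ler_wpM2r => //; rewrite /k0 -addrA lerDl; pos.
    have b2 : 16 * B * k * (e / (z + e) ^+ 2 * en z) <= k0 * (e / (z + e) ^+ 2 * en z).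
      apply: ler_wpM2r => //; rewrite /k0 addrAC lerDr; pos.
    have b3 : 2 * Cs * ((Num.sqrt (z + e))^-1 * en z) <= k0 * ((Num.sqrt (z + e))^-1 * en z).
      apply: ler_wpM2r => //; rewrite /k0 lerDr; pos.
    have b4 : 2 * Cs * ((Num.sqrt (z + e))^-1) <= k0 * ((Num.sqrt (z + e))^-1).
      apply: ler_wpM2r => //; rewrite /k0 lerDr; pos.
    lra.
  have Pk : expR (- Phi z) <= expR k0.
    rewrite ler_expR /Phi -mulrN -[leRHS]mulr1; apply: ler_wpM2l => //.
    have : e / (z + e) <= 1 by rewrite ler_pdivrMr // mul1r lerDr ltW.
    have : 0 <= (z + e) ^+ 2 / 2 by pos.
    lra.
  rewrite /dF subr_ge0.
  apply: le_trans (_ : k0 * (Num.sqrt (z + e))^-1 * expR (- Phi z) <= _).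
    by apply: ler_wpM2r; [pos|lra].
  rewrite [leRHS](_ : _ = k0 * (Num.sqrt (z + e))^-1 * expR k0).
    by apply: ler_wpM2l => //; pos.
  by rewrite /k1; field; rewrite gt_eqF.
have CF : cont_itv 0 y F.
  rewrite /F /en /Phi /euler_energy.
  have ? : cont_itv 0 y p by apply: cont_itv_sub (rs_cp sol).
  have ? : cont_itv 0 y q by apply: cont_itv_sub (rs_cq sol).
  have ? : cont_itv 0 y dp by apply: cont_itv_sub (rs_cdp sol).
  have ? : cont_itv 0 y dq by apply: cont_itv_sub (rs_cdq sol).
  by cont; move=> x /andP[h _]; rewrite gt_eqF // x0.
have H := derive_ge0_le y0 DF CF dF0.
have en0 : en 0 = M.
  rewrite /en /euler_energy /M (rs_p0 sol) (rs_q0 sol); ring.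
have Phi0 : expR (- Phi 0) <= expR k0.
  rewrite ler_expR /Phi -mulrN -[leRHS]mulr1; apply: ler_wpM2l => //.
  rewrite add0r divff ?gt_eqF //.
  have : 0 <= e ^+ 2 / 2 by pos.
  have : 0 <= Num.sqrt e by pos.
  lra.
have Phiy : expR (Phi y) <= expR (6 * k0).
  rewrite ler_expR /Phi mulrC; apply: ler_wpM2r => //.
  have xy := x0 _ y0; have x2 : y + e <= 1 + 1 := lerD y1 e1.
  have : 0 <= e / (y + e) by pos.
  have : (y + e) ^+ 2 <= 2 ^+ 2 by rewrite ler_pXn2r ?nnegrE // ltW.
  have : Num.sqrt (y + e) <= 2.
    have -> : (2 : R) = Num.sqrt (2 ^+ 2) by rewrite sqrtr_sqr ger0_norm.
    by apply: ler_wsqrtr; lra.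
  lra.
have sy := sqrtD_le y0 (ltW e0).
have h1 : en y * expR (- Phi y) <= expR k0 * M + k1 * Num.sqrt y.
  have h2 : expR (- Phi 0) * M <= expR k0 * M by apply: ler_wpM2r.
  have h3 : k1 * Num.sqrt (y + e) <= k1 * (Num.sqrt y + Num.sqrt e) by apply: ler_wpM2l.
  move: H; rewrite /F en0 add0r; lra.
have -> : en y = expR (Phi y) * (en y * expR (- Phi y)).
  by rewrite mulrCA expRxMexpNx_1 mulr1.
have sy0 := sqrtr_ge0 y.
have h4 : 0 <= expR k0 * M + k1 * Num.sqrt y by pos.
apply: le_trans (ler_wpM2l (expR_ge0 _) h1) _.
apply: le_trans (ler_wpM2r h4 Phiy) _.
rewrite /K -mulrA; apply: ler_wpM2l; first by pos.
rewrite mulrDl; apply: lerD.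
  by apply: ler_wpM2l; [pos|rewrite lerDl].
by apply: ler_wpM2l => //; rewrite lerDr.
Qed.


Lemma sol_sq_le (z : R) : 0 <= z <= 1 ->
  p z ^+ 2 + q z ^+ 2 <= (z + e) * (n2^-1 * K * (M + Num.sqrt z)).
Proof.
move=> /andP[z0 z1]; have h := energy_ge z0.
have h' : en z <= K * (M + Num.sqrt z) by apply: energy_bound; rewrite z0.
rewrite -(ler_pM2l n20); apply: le_trans h _.
rewrite (_ : n2 * _ = (z + e) * (K * (M + Num.sqrt z))); last by field; rewrite gt_eqF.
by apply: ler_wpM2l => //; rewrite addr_ge0 // ltW.
Qed.

Let G := 2 * Cs * Num.sqrt (n2^-1 * K * (M + 1)).
Let J z := p z * dq z - q z * dp z.
Let dJ z := B * wim e z * (p z ^+ 2 + q z ^+ 2)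
  + (p z * srcim B (om z) (rh z) e z - q z * srcre B (om z) (rh z) e z).

Let G0 : 0 <= G. Proof. by rewrite /G; pos. Qed.

Lemma is_derive_flux (z : R) : 0 < z < 1 -> is_derive z 1 J (dJ z).
Proof.
move=> zI; have := rs_dp sol zI; have := rs_dq sol zI.
have := rs_ddp sol zI; have := rs_ddq sol zI => *.
by rewrite /J; eapply is_derive_eq; [der | rewrite /dJ /=; ring].
Qed.

Lemma cont_flux : cont_itv 0 1 J.
Proof.
have ? := rs_cp sol; have ? := rs_cq sol; have ? := rs_cdp sol; have ? := rs_cdq sol.
by rewrite /J; cont.
Qed.

Lemma flux_source_le (z : R) : 0 < z < 1 ->
  `|p z * srcim B (om z) (rh z) e z - q z * srcre B (om z) (rh z) e z|
  <= G / Num.sqrt (z + e).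
Proof.
move=> /andP[z0 z1]; have zI : 0 <= z <= 1 by rewrite !ltW.
have S1 := srcre_le B0 C0 e0 e1 zI (omC zI) (rhC zI).
have S2 := srcim_le B0 C0 e0 e1 zI (omC zI) (rhC zI).
rewrite -/Cs in S1 S2; have xz : 0 < z + e by apply: addr_gt0.
have sz1 : Num.sqrt z <= 1 by rewrite -(sqrtr1 R) ler_wsqrtr // ltW.
have hs : p z ^+ 2 + q z ^+ 2 <= Num.sqrt (n2^-1 * K * (M + 1)) ^+ 2 * (z + e).
  apply: le_trans (sol_sq_le zI) _; rewrite sqr_sqrtr; last by pos.
  rewrite mulrC; apply: ler_wpM2r; first exact: ltW.
  by apply: ler_wpM2l; [pos | rewrite lerD2l].
pose T : R := Num.sqrt (n2^-1 * K * (M + 1)); rewrite -/T in hs.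
have T0 : 0 <= T by apply: sqrtr_ge0.
have hp : `|p z| <= T * Num.sqrt (z + e).
  by apply: normr_le_sqrt => //; [exact: ltW|apply: le_trans hs; rewrite lerDl sqr_ge0].
have hq : `|q z| <= T * Num.sqrt (z + e).
  by apply: normr_le_sqrt => //; [exact: ltW|apply: le_trans hs; rewrite lerDr sqr_ge0].
apply: le_trans (ler_normB _ _) _; rewrite !normrM.
apply: le_trans (lerD (ler_pM _ _ hp S2) (ler_pM _ _ hq S1)) _ => //.
have sx : 0 < Num.sqrt (z + e) by rewrite sqrtr_gt0.
rewrite -subr_ge0 (_ : _ - _ = 0) // /G -/T.
have := sqr_sqrtr (ltW xz); move: (Num.sqrt (z + e)) sx => r r0 <-.
by field; rewrite gt_eqF.
Qed.

(** The production B wim |psi|^2 is nonnegative, so J can decrease only through the sources, by at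
    most the integral of G / sqrt (z + e). *)
Lemma flux_increase (a b : R) : 0 <= a -> a <= b -> b <= 1 ->
  J a <= J b + 2 * G * Num.sqrt (b - a).
Proof.
move=> a0 ab b1.
pose F z := J z + 2 * G * Num.sqrt (z + e).
have H : F a <= F b.
  apply: (@derive_ge0_le _ _ _ F (fun z => dJ z + G / Num.sqrt (z + e))) => //.
  - move=> z /andP[az zb].
    have zI : 0 < z < 1 by rewrite (le_lt_trans a0 az) (lt_le_trans zb b1).
    have := is_derive_flux zI => ?; have xz : 0 < z + e by rewrite addr_gt0 // (le_lt_trans a0).
    rewrite /F; eapply is_derive_eq; first by der.
    by rewrite /=; field; rewrite gt_eqF // sqrtr_gt0.
  - by rewrite /F; have ? := cont_itv_sub a0 b1 cont_flux; cont.
  - move=> z /andP[az zb].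
    have zI : 0 < z < 1 by rewrite (le_lt_trans a0 az) (lt_le_trans zb b1).
    have /andP[z0 z1] := zI.
    have := flux_source_le zI; rewrite ler_norml => /andP[h _].
    rewrite /dJ -addrA; apply: addr_ge0; last by lra.
    by have := wim_ge0 e0 (ltW z0) => ?; pos.
have s1 : Num.sqrt (b + e) <= Num.sqrt (a + e) + Num.sqrt (b - a).
  rewrite (_ : b + e = (a + e) + (b - a)); last by ring.
  by apply: sqrtD_le; [rewrite addr_ge0 // ltW | rewrite subr_ge0].
have := ler_wpM2l (mulr_ge0 (ler0n R 2) G0) s1.
move: H; rewrite /F; lra.
Qed.

(** Let sg = |psi'(0)|. If sqrt e <= M, the second derivatives in the layer are at most K3 sg / e,
    so on [0, kap e] each of p', q' moves by at most sg / 3 and psi follows its tangent. [c1] M is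
    the amount of J produced on this interval. *)
Let K3 := 2 * (m2 + 2 * B) * Num.sqrt (n2^-1 * K) + Cs.
Let kap := (3 * (K3 + 1))^-1.
Let c1 := B * kap ^+ 4 / 32.

Let K30 : 0 <= K3. Proof. by rewrite /K3; pos. Qed.
Let kap0 : 0 < kap. Proof. by rewrite /kap; have := K30 => ?; rewrite invr_gt0; lra. Qed.
Let kap1 : kap <= 1.
Proof. by rewrite /kap invf_le1; have := K30; lra. Qed.

(** Each component satisfies f(z)^2 >= (f'(0) z)^2 / 2 - (sg z / 3)^2, and for the sum of both 1/2 -
    2/9 > 1/4. The assumption sqrt e <= M gives sg >= 1 and lets M dominate the sqrt z of the energy
    bound inside the layer, so that the sources do not outweigh the solution. *)
Lemma inner_lower (z : R) : Num.sqrt e <= M -> 0 <= z <= kap * e ->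
  M / (4 * e) * z ^+ 2 <= p z ^+ 2 + q z ^+ 2.
Proof.
move=> eM /andP[z0 zk].
have se : 0 < Num.sqrt e by rewrite sqrtr_gt0.
have M0 : 0 < M := lt_le_trans se eM.
have ke : kap * e <= e by rewrite -[leRHS]mul1r; apply: ler_wpM2r => //; exact: ltW.
pose sg : R := Num.sqrt (M / e).
have Me0 : 0 <= M / e by pos.
have sg2 : sg ^+ 2 = M / e by rewrite sqr_sqrtr.
have sg0 : 0 <= sg by apply: sqrtr_ge0.
have sg1 : 1 <= sg.
  rewrite -(sqrtr1 R) ler_wsqrtr // ler_pdivlMr // mul1r; apply: le_trans eM.
  rewrite -{1}(sqr_sqrtr (ltW e0)) expr2 -[leRHS]mul1r; apply: ler_wpM2r => //.
  by rewrite -(sqrtr1 R) ler_wsqrtr.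
pose T : R := Num.sqrt (n2^-1 * K).
have T0 : 0 <= T by apply: sqrtr_ge0.
have T2 : T ^+ 2 = n2^-1 * K by rewrite sqr_sqrtr //; pos.
have hs (y : R) : 0 <= y <= kap * e -> p y ^+ 2 + q y ^+ 2 <= (2 * T * sg * e) ^+ 2.
  move=> /andP[y0 yk].
  have yI : 0 <= y <= 1 by rewrite y0 (le_trans yk) // (le_trans ke).
  apply: le_trans (sol_sq_le yI) _.
  have h1 : Num.sqrt y <= M by apply: le_trans eM; rewrite ler_wsqrtr // (le_trans yk).
  have h2 : y + e <= 2 * e by have := le_trans yk ke; lra.
  apply: le_trans (_ : 2 * e * (n2^-1 * K * (2 * M)) <= _).
    apply: ler_pM => //; [by rewrite addr_ge0 // ltW | by have := sqrtr_ge0 y => ?; pos|].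
    by apply: ler_wpM2l; [pos | lra].
  rewrite -T2 !exprMn sg2 -subr_ge0 (_ : _ - _ = 0) //; by field; rewrite gt_eqF.
have hb (u v : R) : u ^+ 2 + v ^+ 2 <= (2 * T * sg * e) ^+ 2 -> `|u| <= 2 * T * sg * e.
  move=> h; rewrite -(@ler_pXn2r _ 2) // ?nnegrE; [|by pos].
  by rewrite real_normK ?num_real //; apply: le_trans h; rewrite lerDl sqr_ge0.
have second_bound (a b u v S y : R) : 0 < y < kap * e -> `|a| <= e ^- 2 -> `|b| <= e ^- 2 ->
    `|u| <= 2 * T * sg * e -> `|v| <= 2 * T * sg * e -> `|S| <= Cs / (y + e) ->
    `|m2 * u - B * (a * u + b * v) + S| <= K3 * sg / e.
  move=> /andP[y0 _] ha hb' hu hv hS.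
  have hS' : `|S| <= Cs * (sg / e).
    apply: le_trans hS _; apply: ler_wpM2l => //.
    apply: le_trans (_ : e^-1 <= _); last by rewrite -[leLHS]mul1r; apply: ler_wpM2r => //; pos.
    by rewrite lef_pV2 ?posrE ?addr_gt0 // lerDr ltW.
  have hau : `|a * u| <= e ^- 2 * (2 * T * sg * e) by rewrite normrM ler_pM.
  have hbv : `|b * v| <= e ^- 2 * (2 * T * sg * e) by rewrite normrM ler_pM.
  have hmu : `|m2 * u| <= m2 * (2 * T * (sg / e)).
    rewrite normrM (ger0_norm m20); apply: ler_wpM2l => //; apply: le_trans hu _.
    rewrite -mulrA; apply: ler_wpM2l; first by pos.
    apply: ler_wpM2l => //; apply: le_trans e1 _.
    by rewrite invf_ge1.
  have hB : `|B * (a * u + b * v)| <= B * (4 * T * (sg / e)).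
    rewrite normrM (ger0_norm B0); apply: ler_wpM2l => //.
    apply: le_trans (ler_normD _ _) _; apply: le_trans (lerD hau hbv) _.
    by rewrite -subr_ge0 (_ : _ - _ = 0) //; field; rewrite gt_eqF.
  apply: le_trans (ler_normD _ _) _; apply: le_trans (lerD (ler_normB _ _) hS') _.
  rewrite (_ : K3 * sg / e = m2 * (2 * T * (sg / e)) + B * (4 * T * (sg / e)) + Cs * (sg / e)).
    by rewrite lerD2r; apply: lerD.
  by rewrite /K3 -/T; ring.
have dev (f df ddf : R -> R) : cont_itv 0 1 f -> cont_itv 0 1 df -> f 0 = 0 ->
    (forall y : R, 0 < y < 1 -> is_derive y 1 f (df y)) ->
    (forall y : R, 0 < y < 1 -> is_derive y 1 df (ddf y)) ->
    (forall y : R, 0 < y < kap * e -> `|ddf y| <= K3 * sg / e) ->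
    (df 0 * z) ^+ 2 / 2 - (3^-1 * sg * z) ^+ 2 <= f z ^+ 2.
  move=> cf cdf f0 Df Ddf bf.
  have ke1 : kap * e <= 1 := le_trans ke e1.
  have d1 (y : R) : 0 < y < z -> `|df y - df 0| <= 3^-1 * sg.
    move=> /andP[y0 yz]; have y1 : y <= kap * e := le_trans (ltW yz) zk.
    apply: le_trans (_ : K3 * sg / e * (y - 0) <= _).
      apply: (derive_le_dist (ltW y0)) (cont_itv_sub _ _ cdf) _ => //.
      - by move=> x /andP[x0 xy]; apply: Ddf; rewrite x0 (lt_le_trans xy) // (le_trans y1).
      - by apply: le_trans y1 ke1.
      - by move=> x /andP[x0 xy]; apply: bf; rewrite x0 (lt_le_trans xy).
    rewrite subr0; apply: le_trans (_ : K3 * sg / e * (kap * e) <= _).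
      by apply: ler_wpM2l => //; pos.
    rewrite (_ : _ * _ = sg * (K3 * kap)); last by field; rewrite gt_eqF.
    rewrite mulrC; apply: ler_wpM2r => //.
    have K3p : 0 < K3 + 1 by rewrite ltr_wpDl.
    rewrite /kap invfM mulrC -mulrA -[leRHS]mulr1; apply: ler_wpM2l => //.
    by rewrite mulrC ler_pdivrMr //; lra.
  have d2 : `|(f z - df 0 * z) - (f 0 - df 0 * 0)| <= 3^-1 * sg * (z - 0).
    have ? : cont_itv 0 z f by apply: cont_itv_sub cf => //; rewrite (le_trans zk).
    apply: (@derive_le_dist _ 0 z (fun y => f y - df 0 * y) (fun y => df y - df 0)) => //.
    - move=> y /andP[y0 yz].
      have ? : is_derive y 1 f (df y).
        by apply: Df; rewrite y0 (lt_le_trans yz) // (le_trans zk).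
      by eapply is_derive_eq; [der | rewrite /=; ring].
    - by cont.
  rewrite f0 mulr0 !subr0 in d2.
  have : (f z - df 0 * z) ^+ 2 <= (3^-1 * sg * z) ^+ 2.
    by rewrite -[leLHS]real_normK ?num_real // ler_pXn2r // nnegrE; pos.
  have := sqr_ge0 (2 * f z - df 0 * z).
  by nra.
have HI (y : R) : 0 < y < kap * e -> [/\ 0 <= y <= 1, 0 <= y <= kap * e & 0 <= y].
  move=> /andP[y0 y1]; have ey := le_trans (ltW y1) ke.
  by split; rewrite ?(ltW y0) ?(ltW y1) ?(le_trans ey).
have ie (y : R) : (y ^+ 2 + e ^+ 2)^-1 <= e ^- 2.
  by rewrite lef_pV2 ?posrE ?sqnorm_gt0 ?exprn_gt0 // lerDr sqr_ge0.
have Hp := dev _ _ _ (rs_cp sol) (rs_cdp sol) (rs_p0 sol) (rs_dp sol) (rs_ddp sol).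
have Hq := dev _ _ _ (rs_cq sol) (rs_cdq sol) (rs_q0 sol) (rs_dq sol) (rs_ddq sol).
have {}Hp : (dp 0 * z) ^+ 2 / 2 - (3^-1 * sg * z) ^+ 2 <= p z ^+ 2.
  apply: Hp => y yI; have [y01 yk y0] := HI _ yI; have hy := hs _ yk.
  apply: (second_bound _ _ _ _ _ y) => //.
  - exact: le_trans (wre_le _ e0) _.
  - by rewrite ger0_norm ?wim_ge0 //; apply: le_trans (wim_le _ e0) _.
  - exact: hb hy.
  - by apply: (hb _ (p y)); rewrite addrC.
  - by apply: srcre_le => //; [apply: omC | apply: rhC].
have {}Hq : (dq 0 * z) ^+ 2 / 2 - (3^-1 * sg * z) ^+ 2 <= q z ^+ 2.
  apply: Hq => y yI; have [y01 yk y0] := HI _ yI; have hy := hs _ yk.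
  rewrite (_ : wre e y * q y - wim e y * p y = wre e y * q y + - wim e y * p y); last by ring.
  apply: (second_bound _ _ _ _ _ y) => //.
  - exact: le_trans (wre_le _ e0) _.
  - by rewrite normrN ger0_norm ?wim_ge0 //; apply: le_trans (wim_le _ e0) _.
  - by apply: (hb _ (p y)); rewrite addrC.
  - exact: hb hy.
  - by apply: srcim_le => //; [apply: omC | apply: rhC].
apply: le_trans (lerD Hp Hq).
have -> : M / (4 * e) * z ^+ 2 = sg ^+ 2 * z ^+ 2 / 4 by rewrite sg2; field; rewrite gt_eqF.
have : sg ^+ 2 = dp 0 ^+ 2 + dq 0 ^+ 2 by rewrite sg2 /M; field; rewrite gt_eqF.
rewrite !exprMn => h; have := mulr_ge0 (sqr_ge0 sg) (sqr_ge0 z).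
move: h (z ^+ 2) => -> w; lra.
Qed.

(** On [0, kap e] one has wim >= z / (2 e^3), so with [inner_lower] the production is at least B M
    z^3 / (8 e^4), in total B M kap^4 / 32 = c1 M. From kap e to delta only the sources can diminish
    J. *)
Lemma flux_lower (delta : R) : Num.sqrt e <= M -> kap * e <= delta -> delta <= 1 ->
  c1 * M - 2 * G * Num.sqrt delta <= J delta.
Proof.
move=> eM kd d1.
have ke0 : 0 < kap * e by pos.
have ke1 : kap * e <= 1 := le_trans kd d1.
pose F z := J z + 2 * G * Num.sqrt (z + e) - B * M / (32 * e ^+ 4) * z ^+ 4.
have H : F 0 <= F (kap * e).
  apply: (@derive_ge0_le _ _ _ F (fun z => dJ z + G / Num.sqrt (z + e) - B * M / (8 * e ^+ 4) * z ^+ 3)).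
  - exact: ltW.
  - move=> z /andP[z0 zb].
    have zI : 0 < z < 1 by rewrite z0 (lt_le_trans zb ke1).
    have := is_derive_flux zI => ?; have xz : 0 < z + e by apply: addr_gt0.
    rewrite /F; eapply is_derive_eq; first by der.
    have : Num.sqrt (z + e) != 0 by rewrite gt_eqF // sqrtr_gt0.
    by rewrite /=; move: (Num.sqrt _) => r r0; field; rewrite r0 gt_eqF.
  - by rewrite /F; have ? := cont_itv_sub (lexx 0) ke1 cont_flux; cont.
  - move=> z /andP[z0 zb].
    have zI : 0 < z < 1 by rewrite z0 (lt_le_trans zb ke1).
    have ze : z <= e.
      by apply: le_trans (ltW zb) _; rewrite -[leRHS]mul1r; apply: ler_wpM2r => //; exact: ltW.
    have := flux_source_le zI; rewrite ler_norml => /andP[h _].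
    have h2 := inner_lower eM (_ : 0 <= z <= kap * e).
    rewrite (ltW z0) (ltW zb) in h2; have {}h2 := h2 isT.
    have h3 : z / (2 * e ^+ 3) <= wim e z.
      rewrite (_ : z / _ = 2 * e * z / (2 * e ^+ 2) ^+ 2); last by field; rewrite gt_eqF.
      rewrite /wim; apply: ler_wpM2l; first by pos.
      rewrite lef_pV2 ?posrE ?exprn_gt0 ?sqnorm_gt0 //; last by pos.
      rewrite ler_pXn2r // ?nnegrE; [|by pos|by pos].
      have : z ^+ 2 <= e ^+ 2 by rewrite ler_pXn2r // ?nnegrE ltW.
      lra.
    have h4 : B * M / (8 * e ^+ 4) * z ^+ 3 <= B * wim e z * (p z ^+ 2 + q z ^+ 2).
      rewrite (_ : _ * z ^+ 3 = B * (z / (2 * e ^+ 3)) * (M / (4 * e) * z ^+ 2)); last first.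
        by field; rewrite gt_eqF.
      have := M_ge0 => M0.
      by apply: ler_pM => //; [pos|pos|apply: ler_wpM2l].
    by rewrite /dJ; lra.
have J0 : J 0 = 0 by rewrite /J (rs_p0 sol) (rs_q0 sol); ring.
have H2 : F 0 <= J delta + 2 * G * Num.sqrt (delta + e) - c1 * M.
  apply: le_trans H _; rewrite /F.
  have -> : B * M / (32 * e ^+ 4) * (kap * e) ^+ 4 = c1 * M by rewrite /c1; field; rewrite gt_eqF.
  rewrite lerD2r.
  pose F2 z := J z + 2 * G * Num.sqrt (z + e).
  apply: (@derive_ge0_le _ _ _ F2 (fun z => dJ z + G / Num.sqrt (z + e))) => //.
  - move=> z /andP[az zb].
    have zI : 0 < z < 1 by rewrite (lt_trans ke0 az) (lt_le_trans zb d1).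
    have := is_derive_flux zI => ?; have xz : 0 < z + e by rewrite addr_gt0 // (lt_trans ke0).
    rewrite /F2; eapply is_derive_eq; first by der.
    by rewrite /=; field; rewrite gt_eqF // sqrtr_gt0.
  - by rewrite /F2; have ? := cont_itv_sub (ltW ke0) d1 cont_flux; cont.
  - move=> z /andP[az zb].
    have zI : 0 < z < 1 by rewrite (lt_trans ke0 az) (lt_le_trans zb d1).
    have /andP[z0 z1] := zI.
    have := flux_source_le zI; rewrite ler_norml => /andP[h _].
    rewrite /dJ -addrA; apply: addr_ge0; last by lra.
    by have := wim_ge0 e0 (ltW z0) => ?; pos.
have s1 := sqrtD_le (le_trans (ltW ke0) kd) (ltW e0).
have := ler_wpM2l (mulr_ge0 (ler0n R 2) G0) s1.
rewrite /F J0 add0r add0r expr0n /= mulr0 subr0 in H2; lra.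
Qed.

Let M0 := 1 + 32 * Cs ^+ 2 * (n2^-1 * K) / c1 ^+ 2.
Let Vb := Num.sqrt (2 * (n2^-1 * K * (M0 + 1))).
Let Vd := Num.sqrt (K * (M0 + 1)).
Let Gm := 2 * Cs * Num.sqrt (n2^-1 * K * (M0 + 1)).

Let B_gt0 : 0 < B. Proof. by apply: lt_trans B14; rewrite invr_gt0. Qed.
Let c10 : 0 < c1. Proof. by rewrite /c1; pos. Qed.
Let M00 : 0 <= M0. Proof. by rewrite /M0; pos. Qed.
Let Vb0 : 0 <= Vb. Proof. exact: sqrtr_ge0. Qed.
Let Vd0 : 0 <= Vd. Proof. exact: sqrtr_ge0. Qed.

(** At delta = 1 the current vanishes, which leaves c1 M <= 2 G; and G grows only like sqrt (M +
    1). *)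
Lemma M_le : M <= M0.
Proof.
have [M1|M1] := leP M 1.
  by apply: le_trans M1 _; rewrite /M0 lerDl; pos.
have eM : Num.sqrt e <= M.
  by apply: le_trans (ltW M1); rewrite -(sqrtr1 R) ler_wsqrtr.
have ke : kap * e <= 1.
  by rewrite -[leRHS]mulr1; apply: ler_pM => //; exact: ltW.
have := flux_lower eM ke (lexx 1).
rewrite {1}/J (rs_p1 sol) (rs_q1 sol) !mul0r subrr sqrtr1 mulr1 => h.
have h2 : (c1 * M) ^+ 2 <= (2 * G) ^+ 2.
  by rewrite ler_pXn2r // ?nnegrE; [lra|pos|pos].
have G2 : (2 * G) ^+ 2 = 16 * Cs ^+ 2 * (n2^-1 * K) * (M + 1).
  have GG : Num.sqrt (n2^-1 * K * (M + 1)) ^+ 2 = n2^-1 * K * (M + 1).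
    by rewrite sqr_sqrtr //; pos.
  by rewrite /G !exprMn GG; ring.
have h3 : c1 ^+ 2 * M <= 32 * Cs ^+ 2 * (n2^-1 * K).
  have Mp : 0 < M by apply: lt_trans M1.
  rewrite -(ler_pM2r Mp); apply: le_trans (_ : (c1 * M) ^+ 2 <= _).
    by rewrite (_ : (c1 * M) ^+ 2 = c1 ^+ 2 * M * M) //; ring.
  apply: le_trans h2 _; rewrite G2.
  have : 16 * Cs ^+ 2 * (n2^-1 * K) * 1 <= 16 * Cs ^+ 2 * (n2^-1 * K) * M.
    by apply: ler_wpM2l; [pos | exact: ltW].
  lra.
apply: le_trans (_ : 32 * Cs ^+ 2 * (n2^-1 * K) / c1 ^+ 2 <= _); last by rewrite /M0 lerDr.
by rewrite ler_pdivlMr ?exprn_gt0 // mulrC.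
Qed.

Lemma sol_le (z : R) : 0 <= z <= 1 -> `|p z| <= Vb /\ `|q z| <= Vb.
Proof.
move=> zI; have /andP[z0 z1] := zI.
have sz1 : Num.sqrt z <= 1 by rewrite -(sqrtr1 R) ler_wsqrtr.
have h : p z ^+ 2 + q z ^+ 2 <= Vb ^+ 2 * 1.
  apply: le_trans (sol_sq_le zI) _; rewrite mulr1 sqr_sqrtr; last by pos.
  apply: ler_pM; [by rewrite addr_ge0 // ltW| |exact: (lerD z1 e1)|].
    by have := sqrtr_ge0 z => ?; pos.
  by apply: ler_wpM2l; [pos | apply: lerD => //; apply: M_le].
by split; rewrite -[Vb]mulr1 -(sqrtr1 R); apply: normr_le_sqrt => //;
  apply: le_trans h; rewrite ?lerDl ?lerDr sqr_ge0.
Qed.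

Lemma dq1_le : `|dq 1| <= Vd.
Proof.
have := @energy_bound 1; rewrite ler01 lexx => /(_ isT) h.
suff h1 : dq 1 ^+ 2 <= Vd ^+ 2 * 1.
  by have := normr_le_sqrt Vd0 ler01 h1; rewrite sqrtr1 mulr1.
rewrite mulr1 sqr_sqrtr; last by pos.
apply: le_trans (_ : en 1 <= _).
  have -> : en 1 = (1 + e) * (dp 1 ^+ 2 + dq 1 ^+ 2).
    by rewrite /en /euler_energy (rs_p1 sol) (rs_q1 sol); ring.
  have := sqr_ge0 (dp 1); have := sqr_ge0 (dq 1) => h1 h2.
  have := mulr_ge0 (ltW e0) h1; have := mulr_ge0 (ltW e0) h2; lra.
apply: le_trans h _; apply: ler_wpM2l => //; rewrite sqrtr1 lerD2r; exact: M_le.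
Qed.

(** * Estimates at a fixed distance d from the singular point *)

Section Fixed_delta.
Variables (d : R).
Hypotheses (d0 : 0 < d) (d14 : d <= 4^-1).

Let Sd := (10 * B * Vb + C * (1 + 2 * B)) / d ^+ 4.
Let Sd0 : 0 <= Sd. Proof. by rewrite /Sd; pos. Qed.

Lemma invX_le4 (z : R) n : (n <= 4)%N -> d <= z -> z ^- n <= d ^- 4.
Proof.
move=> n4 dz; have z0 : 0 < z := lt_le_trans d0 dz.
rewrite lef_pV2 ?posrE ?exprn_gt0 //.
apply: le_trans (_ : d ^+ n <= _); first (by apply: ler_wiXn2l => //; [exact: ltW|have := d14; lra]).
by apply: lerXn2r; rewrite ?nnegrE // ltW.
Qed.

(** [a] is the unperturbed weight: (z + e)^-2 in [sol_im_le], z^-2 in [sol_im_approx]. On [d, 1) all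
    that couples q to p or forces it is O(e). *)
Lemma perturbation_le (a z : R) : d <= z < 1 -> `|a - wre e z| <= 8 * e / d ^+ 4 ->
  `|B * ((a - wre e z) * q z + wim e z * p z) + srcim B (om z) (rh z) e z| <= Sd * e.
Proof.
move=> /andP[dz z1] ha; have z0 : 0 < z := lt_le_trans d0 dz.
have zI : 0 <= z <= 1 by rewrite !ltW.
have [hp hq] := sol_le zI.
have hw : wim e z <= 2 * e / d ^+ 4.
  apply: le_trans (wim_le_cube e0 z0) _; apply: ler_wpM2l; first by pos.
  exact: invX_le4.
have hs : `|srcim B (om z) (rh z) e z| <= C * (1 + 2 * B) * e / d ^+ 4.
  apply: le_trans (srcim_le_eps B0 C0 e0 _ (omC zI) (rhC zI)) _.
    by rewrite z0 ltW.
  by apply: ler_wpM2l; [pos | exact: invX_le4].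
apply: le_trans (ler_normD _ _) _.
have h1 : `|(a - wre e z) * q z| <= 8 * e / d ^+ 4 * Vb by rewrite normrM; apply: ler_pM.
have W0 := wim_ge0 e0 (ltW z0).
have h2 : `|wim e z * p z| <= 2 * e / d ^+ 4 * Vb.
  by rewrite normrM (ger0_norm W0); apply: ler_pM.
have h3 : `|B * ((a - wre e z) * q z + wim e z * p z)| <= B * (10 * e / d ^+ 4 * Vb).
  rewrite normrM (ger0_norm B0); apply: ler_wpM2l => //.
  by apply: le_trans (ler_normD _ _) _; lra.
by apply: le_trans (lerD h3 hs) _; rewrite /Sd; lra.
Qed.

Let Ga2 := 2 * m2 * k + 5.

(** Below d this is the common energy estimate. Above d the energy of q alone starts from at most
    [en d] and obeys a Gronwall inequality with forcing O(e), so q is small once M, d and e are. In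
    [Ga2], 2 m2 k comes from the mass term and 5 from P S <= (P^2 + S^2) / 2 with P^2 <= 8 E1. *)
Lemma sol_im_le (z : R) : 0 <= z <= 1 ->
  q z ^+ 2 <= 2 * n2^-1 * expR Ga2 * (K * (M + Num.sqrt d) + (Sd * e) ^+ 2).
Proof.
move=> zI; have /andP[z0 z1] := zI.
have Ga20 : 0 <= Ga2 by rewrite /Ga2; pos.
have sd := sqrtr_ge0 d.
have [zd|dz] := leP z d.
  apply: le_trans (_ : (z + e) * (n2^-1 * K * (M + Num.sqrt z)) <= _).
    by apply: le_trans (sol_sq_le zI); rewrite lerDr sqr_ge0.
  have h0 : 0 <= K * (M + Num.sqrt d) by pos.
  apply: le_trans (_ : 2 * n2^-1 * (K * (M + Num.sqrt d)) <= _).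
    rewrite -[n2^-1 * K * _]mulrA -[2 * _ * _]mulrA.
    apply: ler_pM; [by rewrite addr_ge0 // ltW| |exact: (lerD z1 e1)|].
      by have := sqrtr_ge0 z => ?; pos.
    apply: ler_wpM2l; first by pos.
    apply: ler_wpM2l => //; rewrite lerD2l; exact: ler_wsqrtr.
  rewrite -[2 * n2^-1 * expR _ * _]mulrA; apply: ler_wpM2l; first by pos.
  apply: le_trans (_ : 1 * (K * (M + Num.sqrt d) + (Sd * e) ^+ 2) <= _).
    by rewrite mul1r lerDl sqr_ge0.
  by apply: ler_wpM2r; [pos | rewrite -expR0 ler_expR].
pose E1 y := euler_energy B (y + e) (q y) (dq y).
pose P y := 2 * (y + e) * dq y - q y.
pose S y := B * (((y + e) ^- 2 - wre e y) * q y + wim e y * p y) + srcim B (om y) (rh y) e y.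
pose ka := (Sd * e) ^+ 2.
have ka0 : 0 <= ka by apply: sqr_ge0.
pose F y := - ((E1 y + ka) * expR (- (Ga2 * y))).
have H : F d <= F z.
  apply: (@derive_ge0_le _ _ _ F (fun y => (Ga2 * (E1 y + ka) - P y * (m2 * q y + S y)) * expR (- (Ga2 * y)))).
  - exact: ltW.
  - move=> y /andP[dy yz].
    have yI : 0 < y < 1 by rewrite (lt_trans d0) //= (lt_le_trans yz).
    have xy : 0 < y + e by move: yI => /andP[? _]; exact: addr_gt0.
    have HE := is_derive_euler_energy B xy (rs_dq sol yI) (rs_ddq sol yI).
    rewrite -/(E1) in HE.
    have HE1 : is_derive y 1 E1 (P y * (m2 * q y + S y)).
      apply: is_derive_eq HE _; rewrite /P /S.
      move: (srcim _ _ _ _ _) (wre _ _) (wim _ _) (p y) (q y) (dp y) (dq y) => *.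
      by field; rewrite gt_eqF.
    rewrite /F; eapply is_derive_eq; first by der.
    by rewrite /=; ring.
  - rewrite /F /E1 /euler_energy.
    have ? : cont_itv d z q by apply: cont_itv_sub (rs_cq sol) => //; exact: ltW.
    have ? : cont_itv d z dq by apply: cont_itv_sub (rs_cdq sol) => //; exact: ltW.
    by cont; move=> x /andP[h _]; rewrite gt_eqF // addr_gt0 // (lt_le_trans d0).
  - move=> y /andP[dy yz]; have y0 : 0 < y := lt_trans d0 dy.
    have y1 : y < 1 := lt_le_trans yz z1.
    have xy : 0 < y + e by apply: addr_gt0.
    have hS : `|S y| <= Sd * e.
      apply: perturbation_le; first by rewrite y1 ltW.
      apply: le_trans (invsq_shift_sub_wre e0 (ltW y0)) _.
      apply: ler_wpM2l; first by pos.
      apply: le_trans (_ : y ^- 3 <= _); last by apply: invX_le4 => //; exact: ltW.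
      rewrite lef_pV2 ?posrE ?exprn_gt0 // ler_pXn2r // ?nnegrE ?(ltW y0) ?(ltW xy) //.
      by rewrite lerDl ltW.
    have hS2 : S y ^+ 2 <= ka.
      rewrite /ka -(real_normK (num_real (S y))) ler_pXn2r // nnegrE; by pos.
    have E0 : 0 <= E1 y by apply: euler_energy_ge0.
    have x2 : y + e <= 2 by apply: le_trans (lerD (ltW y1) e1) _.
    have xE : (y + e) * E1 y <= 2 * E1 y by apply: ler_wpM2r.
    have hP : P y ^+ 2 <= 4 * (y + e) * E1 y by apply: euler_energy_ge_der.
    have hc : `|P y * q y + 0 * 0| <= k * ((y + e) * E1 y).
      by apply: cross_le; rewrite // expr0n addr0 //; apply: euler_energy_ge.
    rewrite mulr0 addr0 in hc.
    have hk : k * ((y + e) * E1 y) <= k * (2 * E1 y) by apply: ler_wpM2l.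
    have h1 : m2 * (P y * q y) <= m2 * (k * (2 * E1 y)).
      by apply: ler_wpM2l => //; apply: le_trans (ler_norm _) _; apply: le_trans hc _.
    apply: mulr_ge0; last by pos.
    rewrite subr_ge0 /Ga2.
    have := sqr_ge0 (P y - S y); have := mulr_ge0 m20 kge0 => mk.
    have := mulr_ge0 mk ka0.
    nra.
have E1z : q z ^+ 2 <= 2 * n2^-1 * E1 z.
  have := @euler_energy_ge B (z + e) (q z) (dq z) (ltr_wpDl z0 e0).
  rewrite -/n2 -/(E1 z) mulrC => h; rewrite -[2 * _ * _]mulrA [n2^-1 * _]mulrC mulrA ler_pdivlMr //.
  apply: le_trans h _; apply: ler_wpM2r; last exact: (lerD z1 e1).
  by apply: euler_energy_ge0; rewrite // ltr_wpDl.
apply: le_trans E1z _; rewrite -[2 * n2^-1 * expR _ * _]mulrA; apply: ler_wpM2l; first by pos.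
have Ed : E1 d <= K * (M + Num.sqrt d).
  apply: le_trans (@energy_bound d _); last by apply/andP; split; [exact: ltW | have := d14; lra].
  by rewrite /en lerDr; apply: euler_energy_ge0; rewrite // addr_gt0.
have h1 : (E1 z + ka) * expR (- (Ga2 * z)) <= E1 d + ka.
  apply: le_trans (_ : (E1 d + ka) * expR (- (Ga2 * d)) <= _); first by move: H; rewrite /F; lra.
  rewrite -[leRHS]mulr1; apply: ler_wpM2l.
    by apply: addr_ge0 => //; apply: euler_energy_ge0; rewrite // addr_gt0.
  by rewrite -expR0 ler_expR oppr_le0; pos.
have h2 : E1 z + ka <= expR Ga2 * (E1 d + ka).
  have -> : E1 z + ka = expR (Ga2 * z) * ((E1 z + ka) * expR (- (Ga2 * z))).
    by rewrite mulrCA expRxMexpNx_1 mulr1.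
  apply: le_trans (ler_wpM2l (expR_ge0 _) h1) _; apply: ler_wpM2r.
    by apply: addr_ge0 => //; apply: euler_energy_ge0; rewrite // addr_gt0.
  by rewrite ler_expR -[leRHS]mulr1; apply: ler_wpM2l.
apply: le_trans (_ : E1 z + ka <= _); first by rewrite lerDl.
by apply: le_trans h2 _; apply: ler_wpM2l; [pos | rewrite lerD2r].
Qed.

(** [U] spans the solutions of the limit equation that vanish at 1. The orthogonality hypothesis
    enters through [IC] alone: the truncated integral of U against the limit source tends to 0 at
    rate sqrt d. *)
Variables (U dU I : R -> R) (C1 : R).
Hypothesis cU : cont_itv d 1 U.
Hypothesis cdU : cont_itv d 1 dU.
Hypothesis DU : forall z, d < z < 1 -> is_derive z 1 U (dU z).
Hypothesis DdU : forall z, d < z < 1 -> is_derive z 1 dU ((m2 - B / z ^+ 2) * U z).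
Hypotheses (U1 : U 1 = 0) (dU1 : dU 1 = 1).
Hypothesis cI : cont_itv d (1 - d) I.
Hypothesis DI : forall z, d < z < 1 - d ->
  is_derive z 1 I (U z * (om z / z - B * rh z / z ^+ 2)).
Hypothesis IC : `|I (1 - d) - I d| <= C1 * Num.sqrt d.

Let Ga := 2 + m2 + B / d ^+ 2.

(** q and q'(1) U have the same Cauchy data at 1 and solve the same equation up to O(e). Gronwall's
    argument runs backwards from 1 and costs exp Ga, with Ga of order d^-2; this is harmless because
    d is fixed before e. *)
Lemma sol_im_approx (z : R) : d <= z <= 1 -> `|q z - dq 1 * U z| <= Sd * e * expR Ga.
Proof.
move=> /andP[dz z1].
have Ga0 : 0 <= Ga by rewrite /Ga; pos.
pose f y := q y - dq 1 * U y; pose df y := dq y - dq 1 * dU y.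
pose S y := B * ((y ^- 2 - wre e y) * q y + wim e y * p y) + srcim B (om y) (rh y) e y.
pose g y := f y ^+ 2 + df y ^+ 2.
pose ka := (Sd * e) ^+ 2.
have ka0 : 0 <= ka by apply: sqr_ge0.
pose F y := (g y + ka) * expR (Ga * y).
have d1 : d <= 1 := le_trans dz z1.
have H : F z <= F 1.
  apply: (@derive_ge0_le _ _ _ F (fun y => (2 * df y * (f y + ((m2 - B / y ^+ 2) * f y + S y)) + Ga * (g y + ka)) * expR (Ga * y))) => //.
  - move=> y /andP[zy y1].
    have dy : d < y := le_lt_trans dz zy.
    have yI : 0 < y < 1 by rewrite (lt_trans d0).
    have yI' : d < y < 1 by rewrite dy.
    have ? := rs_dq sol yI; have ? := rs_ddq sol yI; have ? := DU yI'; have ? := DdU yI'.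
    rewrite /F /g /f /df; eapply is_derive_eq; first by der.
    rewrite /S /g /f /df /=.
    move: (srcim _ _ _ _ _) (wre _ _) (wim _ _) (p y) (q y) (dp y) (dq y) (U y) (dU y) => *.
    by field; move: yI => /andP[? _]; rewrite gt_eqF.
  - rewrite /F /g /f /df.
    have z0 : 0 <= z := le_trans (ltW d0) dz.
    have ? : cont_itv z 1 q by apply: cont_itv_sub (rs_cq sol).
    have ? : cont_itv z 1 dq by apply: cont_itv_sub (rs_cdq sol).
    have ? : cont_itv z 1 U by apply: cont_itv_sub cU.
    have ? : cont_itv z 1 dU by apply: cont_itv_sub cdU.
    by cont.
  - move=> y /andP[zy y1]; have dy : d < y := le_lt_trans dz zy.
    have y0 : 0 < y := lt_trans d0 dy.
    have hS : `|S y| <= Sd * e.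
      apply: perturbation_le; first by rewrite y1 ltW.
      have /andP[W0 W1] := invsq_sub_wre e0 y0.
      rewrite (ger0_norm W0); apply: le_trans W1 _.
      apply: ler_pM; [by pos|by pos| |by apply: invX_le4 => //; exact: ltW].
      have : e ^+ 2 <= e by rewrite expr2 -[leRHS]mul1r; apply: ler_wpM2r => //; exact: ltW.
      have := e0; lra.
    have hS2 : S y ^+ 2 <= ka.
      rewrite /ka -(real_normK (num_real (S y))) ler_pXn2r // nnegrE; by pos.
    have hA : `|1 + m2 - B / y ^+ 2| <= 1 + m2 + B / d ^+ 2.
      have b1 : 0 <= B / y ^+ 2 by pos.
      have b2 : B / y ^+ 2 <= B / d ^+ 2.
        apply: ler_wpM2l => //; rewrite lef_pV2 ?posrE ?exprn_gt0 //.
        by rewrite ler_pXn2r ?nnegrE // ltW.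
      by rewrite ler_norml; apply/andP; split; have := m20; lra.
    have hfg : `|2 * df y * f y| <= g y.
      have := sqr_ge0 (f y + df y); have := sqr_ge0 (f y - df y).
      by rewrite ler_norml /g => *; apply/andP; split; nra.
    have h1 : `|(1 + m2 - B / y ^+ 2) * (2 * df y * f y)| <= (1 + m2 + B / d ^+ 2) * g y.
      by rewrite normrM; apply: ler_pM.
    have h2 : - (df y ^+ 2 + ka) <= 2 * df y * S y.
      have := sqr_ge0 (df y + S y); nra.
    apply: mulr_ge0; last by pos.
    move: h1; rewrite ler_norml => /andP[h1 _].
    have -> : 2 * df y * (f y + ((m2 - B / y ^+ 2) * f y + S y)) + Ga * (g y + ka) =
      (1 + m2 - B / y ^+ 2) * (2 * df y * f y) + 2 * df y * S y +
      (1 + m2 + B / d ^+ 2) * g y + g y + Ga * ka.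
      by rewrite /Ga; field; rewrite !gt_eqF.
    have gd : df y ^+ 2 <= g y by rewrite /g lerDr sqr_ge0.
    have : ka <= Ga * ka.
      rewrite -[leLHS]mul1r; apply: ler_wpM2r => //; rewrite /Ga.
      have : 0 <= B / d ^+ 2 by pos.
      have := m20; lra.
    lra.
have z0 : 0 <= z := le_trans (ltW d0) dz.
have g1 : g 1 = 0 by rewrite /g /f /df (rs_q1 sol) U1 dU1; ring.
have h1 : g z + ka <= ka * expR Ga.
  apply: le_trans (_ : F z <= _); last by move: H; rewrite {2}/F g1 add0r mulr1.
  rewrite /F -[leLHS]mulr1; apply: ler_wpM2l; first by rewrite /g; pos.
  by rewrite -expR0 ler_expR; pos.
have eG : 1 <= expR Ga by rewrite -expR0 ler_expR.
rewrite -(@ler_pXn2r _ 2) // ?nnegrE; [|by pos].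
rewrite real_normK ?num_real // exprMn -/ka.
apply: le_trans (_ : ka * expR Ga <= _).
  apply: le_trans h1; rewrite /g -/(f z); have := sqr_ge0 (df z); lra.
by apply: ler_wpM2l => //; rewrite expr2 -[leLHS]mul1r; apply: ler_wpM2r => //; pos.
Qed.

Let N := Sd * expR Ga * (C * (1 + B) / d) + Vb * (C * (1 + 4 * B) / d ^+ 4)
  + Vb * (C * (1 + 2 * B) / d ^+ 4).

(** J + q'(1) I + N e z is nondecreasing: q'(1) I' cancels the term - q srcre of J' up to O(e), by
    [sol_im_approx] and the convergence of the sources, the term p srcim is O(e), and the production
    is nonnegative. *)
Lemma flux_upper : J d <= J (1 - d) + Vd * C1 * Num.sqrt d + N * e.
Proof.
have dd : d <= 1 - d by have := d14; lra.
pose T0 z := om z / z - B * rh z / z ^+ 2.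
pose F z := J z + dq 1 * I z + N * e * z.
have H : F d <= F (1 - d).
  apply: (@derive_ge0_le _ _ _ F (fun z => dJ z + dq 1 * (U z * T0 z) + N * e)) => //.
  - move=> z zI; have /andP[dz zd] := zI.
    have z01 : 0 < z < 1 by rewrite (lt_trans d0) //= (lt_trans zd) // ltrBlDr ltrDl.
    have ? := is_derive_flux z01; have ? := DI zI.
    by rewrite /F; eapply is_derive_eq; [der | rewrite /T0 /=; ring].
  - rewrite /F; have ? : cont_itv d (1 - d) J.
      by apply: cont_itv_sub cont_flux; [exact: ltW | rewrite lerBlDr lerDl ltW].
    by cont.
  - move=> z zI; have /andP[dz zd] := zI.
    have z0 : 0 < z := lt_trans d0 dz.
    have z1 : z < 1 by rewrite (lt_trans zd) // ltrBlDr ltrDl.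
    have z01 : 0 <= z <= 1 by rewrite !ltW.
    have z01' : 0 < z <= 1 by rewrite z0 ltW.
    have [hp hq] := sol_le z01.
    have hs2 : `|srcim B (om z) (rh z) e z| <= C * (1 + 2 * B) / d ^+ 4 * e.
      apply: le_trans (srcim_le_eps B0 C0 e0 z01' (omC z01) (rhC z01)) _.
      rewrite mulrAC; apply: ler_wpM2r; first exact: ltW.
      by apply: ler_wpM2l; [pos | apply: invX_le4 => //; exact: ltW].
    have hs1 : `|srcre B (om z) (rh z) e z - T0 z| <= C * (1 + 4 * B) / d ^+ 4 * e.
      apply: le_trans (srcre_lim B0 C0 e0 z01' (omC z01) (rhC z01)) _.
      rewrite mulrAC; apply: ler_pM; [by pos|by pos| |].
        by apply: ler_wpM2l; [pos | apply: invX_le4 => //; exact: ltW].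
      by rewrite expr2 -[leRHS]mul1r; apply: ler_wpM2r => //; exact: ltW.
    have hT : `|T0 z| <= C * (1 + B) / d.
      apply: le_trans (_ : C + B * (C / z) <= _).
        apply: le_trans (ler_normB _ _) _; apply: lerD.
          by rewrite normrM normfV (gtr0_norm z0) ler_pdivrMr // omC.
        rewrite -mulrA normrM (ger0_norm B0); apply: ler_wpM2l => //.
        rewrite normrM (ger0_norm (_ : 0 <= z ^- 2)); last by pos.
        rewrite ler_pdivrMr ?exprn_gt0 // (_ : C / z * z ^+ 2 = C * z); first exact: rhC.
        by field; rewrite gt_eqF.
      rewrite -mulrA [(1 + B) / d]mulrDl mulrDr mul1r; apply: lerD.
        by rewrite -[leLHS]mulr1; apply: ler_wpM2l => //; rewrite invf_ge1 //; lra.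
      rewrite mulrCA; apply: ler_wpM2l => //; apply: ler_wpM2l => //.
      by rewrite lef_pV2 ?posrE // ltW.
    have hf := @sol_im_approx z; rewrite (ltW dz) (ltW z1) in hf; have {}hf := hf isT.
    have a1 : `|(q z - dq 1 * U z) * T0 z| <= Sd * e * expR Ga * (C * (1 + B) / d).
      by rewrite normrM; apply: ler_pM.
    have a2 : `|q z * (srcre B (om z) (rh z) e z - T0 z)| <= Vb * (C * (1 + 4 * B) / d ^+ 4 * e).
      by rewrite normrM; apply: ler_pM.
    have a3 : `|p z * srcim B (om z) (rh z) e z| <= Vb * (C * (1 + 2 * B) / d ^+ 4 * e).
      by rewrite normrM; apply: ler_pM.
    have W0 := wim_ge0 e0 (ltW z0).
    have b0 : 0 <= B * wim e z * (p z ^+ 2 + q z ^+ 2) by pos.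
    have -> : dJ z + dq 1 * (U z * T0 z) + N * e = B * wim e z * (p z ^+ 2 + q z ^+ 2)
      + (p z * srcim B (om z) (rh z) e z) - (q z - dq 1 * U z) * T0 z
      - q z * (srcre B (om z) (rh z) e z - T0 z) + N * e by rewrite /dJ; ring.
    have -> : N * e = Sd * e * expR Ga * (C * (1 + B) / d) + Vb * (C * (1 + 4 * B) / d ^+ 4 * e) + Vb * (C * (1 + 2 * B) / d ^+ 4 * e) by rewrite /N; ring.
    move: a1 a2 a3; rewrite !ler_norml => /andP[_ ?] /andP[_ ?] /andP[? _]; lra.
have h1 : dq 1 * (I (1 - d) - I d) <= Vd * (C1 * Num.sqrt d).
  apply: le_trans (ler_norm _) _; rewrite normrM; apply: ler_pM => //; exact: dq1_le.
have Ne : 0 <= N * e * d.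
  have : 0 <= N by rewrite /N; pos.
  by move=> ?; pos.
have Ne2 : N * e * (1 - d) = N * e - N * e * d by ring.
move: H; rewrite /F Ne2; lra.
Qed.

(** J(d) controls c1 M up to O(sqrt d), [flux_upper] compares J(d) with J(1 - d), and the way from 1
    - d to J(1) = 0 loses O(sqrt d) once more. The summand sqrt e covers the case M <= sqrt e,
    excluded in [flux_lower]. *)
Lemma M_small : kap * e <= d ->
  M <= c1^-1 * ((4 * Gm + Vd * C1) * Num.sqrt d + N * e) + Num.sqrt e.
Proof.
move=> kd.
have sd := sqrtr_ge0 d; have se := sqrtr_ge0 e.
have C1d : 0 <= C1 * Num.sqrt d by apply: le_trans IC.
have N0 : 0 <= N by rewrite /N; pos.
have Gm0 : 0 <= Gm by rewrite /Gm; pos.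
have R0 : 0 <= (4 * Gm + Vd * C1) * Num.sqrt d + N * e.
  by rewrite mulrDl -[Vd * C1 * _]mulrA; pos.
have [Me|eM] := leP M (Num.sqrt e).
  by apply: le_trans Me _; rewrite lerDr; pos.
apply: le_trans (_ : c1^-1 * ((4 * Gm + Vd * C1) * Num.sqrt d + N * e) <= _); last by rewrite lerDl.
rewrite mulrC ler_pdivlMr // mulrC.
have d1 : d <= 1 by have := d14; lra.
have h1 := flux_lower (ltW eM) kd d1.
have h2 := flux_upper.
have h3 : J (1 - d) <= J 1 + 2 * G * Num.sqrt (1 - (1 - d)).
  by apply: flux_increase => //; have := d14; have := d0; lra.
have J1 : J 1 = 0 by rewrite /J (rs_p1 sol) (rs_q1 sol); ring.
rewrite J1 add0r (_ : 1 - (1 - d) = d) in h3; last by ring.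
have GG : G * Num.sqrt d <= Gm * Num.sqrt d.
  apply: ler_wpM2r => //; apply: ler_wpM2l; first by pos.
  by apply: ler_wsqrtr; apply: ler_wpM2l; [pos | rewrite lerD2r; exact: M_le].
lra.
Qed.

(** What matters is the form: the factor of sqrt d does not involve d, while that of sqrt e may blow
    up as d -> 0. *)
Lemma sol_im_final (z : R) : e <= d -> 0 <= z <= 1 ->
  q z ^+ 2 <= 2 * n2^-1 * expR Ga2 * (K * (c1^-1 * (4 * Gm + Vd * C1) + 1)) * Num.sqrt d
    + 2 * n2^-1 * expR Ga2 * (K * (c1^-1 * N + 1) + Sd ^+ 2) * Num.sqrt e.
Proof.
move=> ed zI; apply: le_trans (sol_im_le zI) _.
have kd : kap * e <= d.
  by apply: le_trans ed; rewrite -[leRHS]mul1r; apply: ler_wpM2r => //; exact: ltW.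
rewrite -![2 * n2^-1 * expR Ga2 * _ * _]mulrA -mulrDr; apply: ler_wpM2l; first by pos.
have h := ler_wpM2l K0 (M_small kd).
have se1 : Num.sqrt e <= 1 by rewrite -(sqrtr1 R) ler_wsqrtr.
have ee : e <= Num.sqrt e.
  rewrite -{1}(sqr_sqrtr (ltW e0)) expr2 -[leRHS]mul1r; apply: ler_wpM2r => //.
have N0 : 0 <= N by rewrite /N; pos.
have h1 : K * (c1^-1 * N) * e <= K * (c1^-1 * N) * Num.sqrt e by apply: ler_wpM2l => //; pos.
have h2 : (Sd * e) ^+ 2 <= Sd ^+ 2 * Num.sqrt e.
  rewrite exprMn; apply: ler_wpM2l; first by pos.
  by apply: le_trans ee; rewrite expr2 -[leRHS]mul1r; apply: ler_wpM2r => //; exact: ltW.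
lra.
Qed.

End Fixed_delta.
End OneSolution.

Lemma im_vanishes_supercritical (U dU : R -> R) (C1 : R) :
  (forall d, 0 < d -> cont_itv d 1 U) -> (forall d, 0 < d -> cont_itv d 1 dU) ->
  (forall z : R, 0 < z < 1 -> is_derive z 1 U (dU z)) ->
  (forall z : R, 0 < z < 1 -> is_derive z 1 dU ((m2 - B / z ^+ 2) * U z)) ->
  U 1 = 0 -> dU 1 = 1 ->
  (forall d, 0 < d -> d <= 4^-1 -> exists I, [/\ cont_itv d (1 - d) I,
    forall z : R, d < z < 1 - d ->
      is_derive z 1 I (U z * (om z / z - B * rh z / z ^+ 2))
    & `|I (1 - d) - I d| <= C1 * Num.sqrt d]) ->
  im_vanishes B m2 om rh.
Proof.
move=> cU cdU DU DdU U1 dU1 HI eta eta0.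
(* The order of quantifiers is the point: d is chosen from [A1] and eta, and only then e from [A2],
   which depends on d. Both constants are read off from [sol_im_final]. *)
have [A1 HA1] : exists A1, forall d, 0 < d -> d <= 4^-1 -> exists A2, forall e p q dp dq,
    0 < e -> e <= 1 -> e <= d -> real_sol B m2 om rh e p q dp dq ->
    forall z, 0 <= z <= 1 -> q z ^+ 2 <= A1 * Num.sqrt d + A2 * Num.sqrt e.
  eexists => d d0 d14; eexists => e p q dp dq e0 e1 ed sol z zI.
  have [I [cI DI IC]] := HI d d0 d14.
  have Dd (u du : R -> R) : (forall z : R, 0 < z < 1 -> is_derive z 1 u (du z)) ->
    forall z : R, d < z < 1 -> is_derive z 1 u (du z).
    by move=> h y /andP[dy y1]; apply: h; rewrite y1 (lt_trans d0).
  exact: (sol_im_final e0 e1 sol d0 d14 (cU _ d0) (cdU _ d0) (Dd _ _ DU) (Dd _ _ DdU) U1 dU1 cI DI IC ed zI).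
pose a1 := eta ^+ 2 / (2 * (`|A1| + 1)).
have A1p : 0 < `|A1| + 1 by rewrite ltr_wpDl.
have a10 : 0 < a1 by rewrite /a1; pos.
pose d := Num.min 4^-1 (a1 ^+ 2).
have d0 : 0 < d by rewrite lt_min exprn_gt0 // andbT invr_gt0.
have d14 : d <= 4^-1 by rewrite ge_min lexx.
have [A2 HA2] := HA1 d d0 d14.
pose a2 := eta ^+ 2 / (2 * (`|A2| + 1)).
have A2p : 0 < `|A2| + 1 by rewrite ltr_wpDl.
have a20 : 0 < a2 by rewrite /a2; pos.
exists (Num.min d (a2 ^+ 2)); first by rewrite lt_min d0 exprn_gt0.
move=> e p q dp dq /andP[e0]; rewrite lt_min => /andP[ed ea2] sol z zI.
have e1 : e <= 1 by lra.
have H := HA2 e p q dp dq e0 e1 (ltW ed) sol z zI.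
have aux A a x : 0 <= a -> a = eta ^+ 2 / (2 * (`|A| + 1)) -> x <= a ^+ 2 ->
    A * Num.sqrt x <= eta ^+ 2 / 2.
  move=> a0 ea xa; have Ap : 0 < `|A| + 1 by rewrite ltr_wpDl.
  have xa' : Num.sqrt x <= a by rewrite -(ger0_norm a0) -sqrtr_sqr ler_wsqrtr.
  apply: le_trans (_ : `|A| * a <= _).
    apply: le_trans (ler_wpM2r (sqrtr_ge0 _) (ler_norm A)) _; exact: ler_wpM2l.
  apply: le_trans (_ : (`|A| + 1) * a <= _); first by apply: ler_wpM2r => //; lra.
  by rewrite ea -subr_ge0 (_ : _ - _ = 0) //; field; rewrite gt_eqF.
have h1 : A1 * Num.sqrt d <= eta ^+ 2 / 2.
  by apply: (aux _ a1) => //; [exact: ltW | rewrite ge_min lexx orbT].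
have h2 : A2 * Num.sqrt e <= eta ^+ 2 / 2 by apply: (aux _ a2) => //; exact: ltW.
rewrite -(@ler_pXn2r _ 2) ?nnegrE ?(ltW eta0) // real_normK ?num_real //; lra.
Qed.

End Supercritical.

(** * Whittaker functions *)

Section PowerSeries.
Context {R : realType}.
Implicit Types (f : nat -> R) (x : R).

(** Domination by a multiple of the exponential coefficients: the power series is entire, and the
    class is stable under termwise differentiation. *)
Definition exp_bounded f := exists A, forall s, `|f s| <= A / s`!%:R.

Lemma exp_bounded_diffs f : exp_bounded f -> exp_bounded (pseries_diffs f).
Proof.
move=> [A hA]; exists A => s; rewrite /pseries_diffs normrM.
apply: le_trans (ler_wpM2l (normr_ge0 _) (hA _)) _.
rewrite factS natrM ger0_norm // -subr_ge0 (_ : _ - _ = 0) //.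
by field; rewrite nat1r !pnatr_eq0 -lt0n fact_gt0.
Qed.

Lemma exp_bounded_cvg f x : exp_bounded f -> cvgn (pseries f x).
Proof.
move=> [A hA]; apply: normed_cvg; rewrite /normed_series_of /=.
apply: (@series_le_cvg _ _ (fun n => A * exp_coeff `|x| n)).
- by move=> n; apply: normr_ge0.
- move=> n; rewrite /exp_coeff /=; apply: le_trans (normr_ge0 (f n * x ^+ n)) _.
  by rewrite normrM normrX mulrCA mulrC; apply: ler_wpM2l; rewrite ?exprn_ge0.
- move=> n; rewrite /exp_coeff /= normrM normrX mulrCA mulrC.
  by apply: ler_wpM2l; rewrite ?exprn_ge0.
- rewrite (_ : series _ = A *: series (exp_coeff `|x|)).
    by apply: is_cvgZr; apply: is_cvg_series_exp_coeff.
  apply/funext => n; transitivity (A * series (exp_coeff `|x|) n) => //.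
  by rewrite /series /= mulr_sumr.
Qed.

Definition psum f x : R := limn (pseries f x).

Lemma is_derive_psum f x : exp_bounded f ->
  is_derive x 1 (psum f) (psum (pseries_diffs f) x).
Proof.
move=> ef; have ef1 := exp_bounded_diffs ef; have ef2 := exp_bounded_diffs ef1.
apply: (@pseries_snd_diffs _ _ (`|x| + 1)); try exact: exp_bounded_cvg.
by rewrite [ltRHS]ger0_norm ?addr_ge0 // ltrDl.
Qed.

Lemma cvg_pseries_shift f x : exp_bounded f ->
  pseries (fun s => s%:R * f s) x @ \oo --> x * psum (pseries_diffs f) x.
Proof.
move=> ef; have ef1 := exp_bounded_diffs ef.
have H := @pseries_diffs_equiv _ f x (exp_bounded_cvg ef1).
rewrite (_ : pseries _ x = x *: series (fun i => i%:R * f i * x ^+ i.-1)).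
  exact: cvgZr H.
apply/funext => n; transitivity (x * series (fun i => i%:R * f i * x ^+ i.-1) n) => //.
rewrite /pseries /series /= mulr_sumr; apply: eq_bigr => i _; case: i => [|i]; first by rewrite !mul0r mulr0.
by rewrite exprS; ring.
Qed.

Lemma psum0 f : psum f 0 = f 0%N.
Proof.
apply: cvg_lim => //; rewrite -cvg_shiftS /=.
apply: (@cvg_trans _ ((fun=> f 0%N) @ \oo)); last exact: cvg_cst.
rewrite (_ : (fun n : nat => _) = fun=> f 0%N) //.
apply/funext => n; elim: n => [|n IH].
  by rewrite /pseries /series /= big_nat1 expr0 mulr1.
rewrite /pseries /series /= big_nat_recr //=.
by rewrite expr0n /= mulr0 addr0; exact: IH.
Qed.

End PowerSeries.

(** * Kummer's and Whittaker's equations in real form *)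

Section KummerReal.
Context {R : realType}.
Variables (nu0 : R) (al be : nat -> R).
Hypotheses (eal : exp_bounded al) (ebe : exp_bounded be).
Hypothesis rec_re : forall s, s.+1%:R * ((s.+1%:R) * al s.+1 - 2 * nu0 * be s.+1)
  = (2^-1 + s%:R) * al s - nu0 * be s.
Hypothesis rec_im : forall s, s.+1%:R * ((s.+1%:R) * be s.+1 + 2 * nu0 * al s.+1)
  = (2^-1 + s%:R) * be s + nu0 * al s.

Local Notation k1 := (psum al).
Local Notation k2 := (psum be).
Local Notation dk1 := (psum (pseries_diffs al)).
Local Notation dk2 := (psum (pseries_diffs be)).
Local Notation ddk1 := (psum (pseries_diffs (pseries_diffs al))).
Local Notation ddk2 := (psum (pseries_diffs (pseries_diffs be))).

(** The real part of Kummer's equation x w'' + (b - x) w' - a w = 0 for w = k1 + i k2, a = 1/2 + i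
    nu0, b = 1 + 2 i nu0. By the recurrence every partial sum of the combination is already 0. *)
Lemma kummer_re (x : R) :
  x * ddk1 x + (1 - x) * dk1 x - 2 * nu0 * dk2 x - k1 x / 2 + nu0 * k2 x = 0.
Proof.
have ea1 := exp_bounded_diffs eal; have eb1 := exp_bounded_diffs ebe.
pose u n := pseries (fun s => s%:R * pseries_diffs al s) x n + pseries (pseries_diffs al) x n
  - pseries (fun s => s%:R * al s) x n - 2 * nu0 * pseries (pseries_diffs be) x n
  - 2^-1 * pseries al x n + nu0 * pseries be x n.
have u0 n : u n = 0.
  elim: n => [|n IH]; first by rewrite /u /pseries /series /= !big_geq //; ring.
  rewrite -IH /u /pseries /series /= !big_nat_recr //= /pseries_diffs.
  have : n.+1%:R * ((n.+1%:R) * al n.+1 - 2 * nu0 * be n.+1) * x ^+ n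
     = ((2^-1 + n%:R) * al n - nu0 * be n) * x ^+ n by rewrite rec_re.
  rewrite -natr1; move: (\sum_(0 <= i < n) _) => ?; lra.
have cu : u n @[n --> \oo] --> x * ddk1 x + dk1 x - x * dk1 x - 2 * nu0 * dk2 x
    - 2^-1 * k1 x + nu0 * k2 x.
  apply: cvgD; last by apply: cvgMr; exact: exp_bounded_cvg.
  apply: cvgB; last by apply: cvgMr; exact: exp_bounded_cvg.
  apply: cvgB; last by apply: cvgMr; exact: exp_bounded_cvg.
  apply: cvgB; last exact: cvg_pseries_shift.
  by apply: cvgD; [exact: cvg_pseries_shift | exact: exp_bounded_cvg].
have -> : x * ddk1 x + (1 - x) * dk1 x - 2 * nu0 * dk2 x - k1 x / 2 + nu0 * k2 x =
  x * ddk1 x + dk1 x - x * dk1 x - 2 * nu0 * dk2 x - 2^-1 * k1 x + nu0 * k2 x by ring.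
rewrite -(cvg_lim _ cu) // (_ : u = fun=> 0); first exact: lim_cst.
exact/funext.
Qed.

End KummerReal.

Section WhittakerReal.
Context {R : realType}.
Variables (nu0 : R) (al be : nat -> R).
Hypotheses (eal : exp_bounded al) (ebe : exp_bounded be).
Hypothesis rec_re : forall s, s.+1%:R * ((s.+1%:R) * al s.+1 - 2 * nu0 * be s.+1)
  = (2^-1 + s%:R) * al s - nu0 * be s.
Hypothesis rec_im : forall s, s.+1%:R * ((s.+1%:R) * be s.+1 + 2 * nu0 * al s.+1)
  = (2^-1 + s%:R) * be s + nu0 * al s.

Local Notation k1 := (psum al).
Local Notation k2 := (psum be).
Local Notation dk1 := (psum (pseries_diffs al)).
Local Notation dk2 := (psum (pseries_diffs be)).
Local Notation ddk1 := (psum (pseries_diffs (pseries_diffs al))).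
Local Notation ddk2 := (psum (pseries_diffs (pseries_diffs be))).

Let kre := kummer_re eal ebe rec_re.

(** i times the conjugate of w, that is k2 + i k1, solves Kummer's equation for - nu0; hence the
    real case applies with the two sequences exchanged. *)
Lemma kummer_im (x : R) :
  x * ddk2 x + (1 - x) * dk2 x + 2 * nu0 * dk1 x - k2 x / 2 - nu0 * k1 x = 0.
Proof.
have := @kummer_re _ (- nu0) be al ebe eal _ x.
rewrite !(mulNr, mulrN, opprK) => -> // s.
by rewrite !(mulNr, mulrN, opprK).
Qed.

Definition whit_re (x : R) := expR (- x / 2) * Num.sqrt x
  * (cos (nu0 * ln x) * k1 x - sin (nu0 * ln x) * k2 x).
Definition whit_im (x : R) := expR (- x / 2) * Num.sqrt x
  * (sin (nu0 * ln x) * k1 x + cos (nu0 * ln x) * k2 x).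
Definition dwhit_re (x : R) := whit_re x * (- 2^-1 + (2 * x)^-1) - whit_im x * nu0 / x + expR (- x / 2) * Num.sqrt x
  * (cos (nu0 * ln x) * dk1 x - sin (nu0 * ln x) * dk2 x).
Definition dwhit_im (x : R) := whit_im x * (- 2^-1 + (2 * x)^-1) + whit_re x * nu0 / x + expR (- x / 2) * Num.sqrt x
  * (sin (nu0 * ln x) * dk1 x + cos (nu0 * ln x) * dk2 x).

Lemma is_derive_whittaker_re (x : R) : 0 < x -> is_derive x 1 whit_re (dwhit_re x).
Proof.
move=> x0; have hk1 := is_derive_psum x eal; have hk2 := is_derive_psum x ebe.
rewrite /whit_re; eapply is_derive_eq; first by der.
have sx : 0 < Num.sqrt x by rewrite sqrtr_gt0.
have x2 := sqr_sqrtr (ltW x0).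
rewrite /dwhit_re /whit_re /whit_im /=; move: (expR _) (cos _) (sin _) (k1 x) (k2 x) (dk1 x) (dk2 x).
move: (Num.sqrt x) sx x2 => r r0 <- *; by field; rewrite gt_eqF.
Qed.

Lemma is_derive_whittaker_im (x : R) : 0 < x -> is_derive x 1 whit_im (dwhit_im x).
Proof.
move=> x0; have hk1 := is_derive_psum x eal; have hk2 := is_derive_psum x ebe.
rewrite /whit_im; eapply is_derive_eq; first by der.
have sx : 0 < Num.sqrt x by rewrite sqrtr_gt0.
have x2 := sqr_sqrtr (ltW x0).
rewrite /dwhit_im /whit_re /whit_im /=; move: (expR _) (cos _) (sin _) (k1 x) (k2 x) (dk1 x) (dk2 x).
move: (Num.sqrt x) sx x2 => r r0 <- *; by field; rewrite gt_eqF.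
Qed.

Let ddk1E (x : R) : 0 < x ->
  ddk1 x = (- (1 - x) * dk1 x + 2 * nu0 * dk2 x + k1 x / 2 - nu0 * k2 x) / x.
Proof.
move=> x0; apply: (mulfI (lt0r_neq0 x0)); rewrite mulrCA mulfV ?gt_eqF // mulr1.
by have := kre x; lra.
Qed.

Let ddk2E (x : R) : 0 < x ->
  ddk2 x = (- (1 - x) * dk2 x - 2 * nu0 * dk1 x + k2 x / 2 + nu0 * k1 x) / x.
Proof.
move=> x0; apply: (mulfI (lt0r_neq0 x0)); rewrite mulrCA mulfV ?gt_eqF // mulr1.
by have := kummer_im x; lra.
Qed.

(** Whittaker's equation with first index 0 and second index i nu0, as 1/4 - (i nu0)^2 = nu0^2 +
    1/4. Kummer's equation eliminates the second derivatives, and writing x = r^2 leaves a rational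
    identity. *)
Lemma is_derive2_whittaker_re (x : R) : 0 < x ->
  is_derive x 1 dwhit_re ((4^-1 - (nu0 ^+ 2 + 4^-1) / x ^+ 2) * whit_re x).
Proof.
move=> x0; have hk1 := is_derive_psum x eal; have hk2 := is_derive_psum x ebe.
have hdk1 := is_derive_psum x (exp_bounded_diffs eal).
have hdk2 := is_derive_psum x (exp_bounded_diffs ebe).
have hX := is_derive_whittaker_re x0; have hY := is_derive_whittaker_im x0.
have x2n : 2 * x != 0 by rewrite mulf_neq0 // gt_eqF.
rewrite /dwhit_re; eapply is_derive_eq; first by der; rewrite // gt_eqF.
rewrite ddk1E // ddk2E //.
have sx : 0 < Num.sqrt x by rewrite sqrtr_gt0.
have x2 := sqr_sqrtr (ltW x0).
rewrite /dwhit_re /dwhit_im /whit_re /whit_im /=; move: (expR _) (cos _) (sin _) (k1 x) (k2 x) (dk1 x) (dk2 x).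
move: (Num.sqrt x) sx x2 => r r0 <- *; by field; rewrite gt_eqF.
Qed.

Lemma is_derive2_whittaker_im (x : R) : 0 < x ->
  is_derive x 1 dwhit_im ((4^-1 - (nu0 ^+ 2 + 4^-1) / x ^+ 2) * whit_im x).
Proof.
move=> x0; have hk1 := is_derive_psum x eal; have hk2 := is_derive_psum x ebe.
have hdk1 := is_derive_psum x (exp_bounded_diffs eal).
have hdk2 := is_derive_psum x (exp_bounded_diffs ebe).
have hX := is_derive_whittaker_re x0; have hY := is_derive_whittaker_im x0.
have x2n : 2 * x != 0 by rewrite mulf_neq0 // gt_eqF.
rewrite /dwhit_im; eapply is_derive_eq; first by der; rewrite // gt_eqF.
rewrite ddk1E // ddk2E //.
have sx : 0 < Num.sqrt x by rewrite sqrtr_gt0.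
have x2 := sqr_sqrtr (ltW x0).
rewrite /dwhit_re /dwhit_im /whit_re /whit_im /=; move: (expR _) (cos _) (sin _) (k1 x) (k2 x) (dk1 x) (dk2 x).
move: (Num.sqrt x) sx x2 => r r0 <- *; by field; rewrite gt_eqF.
Qed.

(* The Wronskian is constant, and its value is read off at 0. *)
Lemma whittaker_wronskian (x : R) : 0 < x -> al 0%N = 1 -> be 0%N = 0 ->
  whit_re x * dwhit_im x - whit_im x * dwhit_re x = nu0.
Proof.
move=> x0 al0 be0.
(* The Wronskian with x^(i nu0) eliminated through cos^2 + sin^2 = 1. Unlike its factors it is
   differentiable at 0, where only nu0 (k1^2 + k2^2) remains. *)
pose W (y : R) := expR (- y) * (nu0 * (k1 y ^+ 2 + k2 y ^+ 2) + y * (k1 y * dk2 y - k2 y * dk1 y)).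
have WE : whit_re x * dwhit_im x - whit_im x * dwhit_re x = W x.
  have cs := cos2Dsin2 (nu0 * ln x).
  have sx : 0 < Num.sqrt x by rewrite sqrtr_gt0.
  have x2 := sqr_sqrtr (ltW x0).
  have ex : expR (- x) = expR (- x / 2) ^+ 2.
    by rewrite expr2 -expRD; congr expR; field.
  rewrite /dwhit_re /dwhit_im /whit_re /whit_im /W ex.
  have -> : nu0 * (k1 x ^+ 2 + k2 x ^+ 2) + x * (k1 x * dk2 x - k2 x * dk1 x) =
    (cos (nu0 * ln x) ^+ 2 + sin (nu0 * ln x) ^+ 2) *
    (nu0 * (k1 x ^+ 2 + k2 x ^+ 2)) + (cos (nu0 * ln x) ^+ 2 + sin (nu0 * ln x) ^+ 2) * (x * (k1 x * dk2 x - k2 x * dk1 x)).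
    by rewrite cs !mul1r.
  move: (expR _) (cos _) (sin _) (k1 x) (k2 x) (dk1 x) (dk2 x).
  move: (Num.sqrt x) sx x2 => r r0 <- *; by field; rewrite gt_eqF.
pose dW (y : R) := expR (- y) * (nu0 * 2 * (k1 y * dk1 y + k2 y * dk2 y) + (k1 y * dk2 y - k2 y * dk1 y)
  + y * (k1 y * ddk2 y - k2 y * ddk1 y)) - W y.
have DW (y : R) : is_derive y 1 W (dW y).
  have hk1 := is_derive_psum y eal; have hk2 := is_derive_psum y ebe.
  have hdk1 := is_derive_psum y (exp_bounded_diffs eal).
  have hdk2 := is_derive_psum y (exp_bounded_diffs ebe).
  by rewrite /W; eapply is_derive_eq; [der | rewrite /dW /W /=; ring].
have dW0 (y : R) : 0 < y -> dW y = 0.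
  by move=> y0; rewrite /dW /W ddk1E // ddk2E //; field; rewrite gt_eqF.
have CW : cont_itv 0 x W by apply: cont_itv_derive => y _; exact: DW.
have [c [/andP[c0 _] e]] := MVT_oo x0 (fun y _ => DW y) CW.
rewrite WE; move: e; rewrite dW0 // mul0r => /eqP; rewrite subr_eq0 => /eqP ->.
by rewrite /W oppr0 expR0 !psum0 al0 be0; ring.
Qed.

End WhittakerReal.

Section WhittakerComplex.
Context {R : realType}.
Implicit Types (s : nat).

Lemma natr_complex n : (n%:R : R[i]) = (n%:R : R) +i* 0.
Proof. by rewrite -(rmorph_nat (real_complex R)). Qed.

Lemma half_complex : (2^-1 : R[i]) = (2^-1 : R) +i* 0.
Proof. by rewrite -[in LHS](rmorph_nat (real_complex R)) -fmorphV. Qed.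

Lemma whittaker_param (nu0 : R) s :
  (2^-1 + (0 +i* nu0) + s%:R : R[i]) = (2^-1 + s%:R : R) +i* nu0.
Proof.
by rewrite half_complex natr_complex; simpc; congr (_ +i* _); rewrite /= ?addr0 ?add0r.
Qed.

Lemma whittaker_param2 (nu0 : R) s :
  (1 + 2 * (0 +i* nu0) + s%:R : R[i]) = (1 + s%:R : R) +i* (2 * nu0).
Proof.
rewrite !natr_complex; simpc; congr (_ +i* _); rewrite /=; ring.
Qed.

Definition whittaker_coef (nu0 : R) s : R[i] := pochhammer (2^-1 + (0 +i* nu0)) s
  / (pochhammer (1 + 2 * (0 +i* nu0)) s * (s`!)%:R).

Lemma pochhammerS (a : R[i]) s : pochhammer a s.+1 = pochhammer a s * (a + s%:R).
Proof. by rewrite /pochhammer big_ord_recr. Qed.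

Lemma whittaker_param2_neq0 (nu0 : R) s : (1 + 2 * (0 +i* nu0) + s%:R : R[i]) != 0.
Proof.
rewrite whittaker_param2 eq_complex /= negb_and; apply/orP; left.
by rewrite gt_eqF // ltr_wpDr.
Qed.

Lemma pochhammer_neq0 (nu0 : R) s : pochhammer (1 + 2 * (0 +i* nu0) : R[i]) s != 0.
Proof. by apply/prodf_neq0 => i _; apply: whittaker_param2_neq0. Qed.

Lemma whittaker_coefS (nu0 : R) s :
  whittaker_coef nu0 s.+1 * (((1 + s%:R : R) +i* (2 * nu0)) * s.+1%:R)
  = whittaker_coef nu0 s * ((2^-1 + s%:R : R) +i* nu0).
Proof.
rewrite -whittaker_param -whittaker_param2 /whittaker_coef !pochhammerS factS natrM.
have h1 := whittaker_param2_neq0 nu0 s; have h2 := pochhammer_neq0 nu0 s.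
have h3 : (s`!%:R : R[i]) != 0 by rewrite pnatr_eq0 -lt0n fact_gt0.
have h4 : (s.+1%:R : R[i]) != 0 by rewrite pnatr_eq0.
move: (pochhammer _ _) (pochhammer _ _) h2 => u v v0.
move: (_ + s%:R) (_ + s%:R) h1 (s.+1%:R) (s`!%:R) h3 h4 => p q q0 f g f0 g0.
by field; rewrite v0 q0 f0 g0.
Qed.

Lemma whittaker_coef0 (nu0 : R) : whittaker_coef nu0 0 = 1.
Proof. by rewrite /whittaker_coef /pochhammer !big_ord0 fact0 mulr1 divr1. Qed.

Definition whit_cre (nu0 : R) s : R := complex.Re (whittaker_coef nu0 s).
Definition whit_cim (nu0 : R) s : R := complex.Im (whittaker_coef nu0 s).

Lemma whittaker_coef_re (nu0 : R) s :
  s.+1%:R * (s.+1%:R * whit_cre nu0 s.+1 - 2 * nu0 * whit_cim nu0 s.+1)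
  = (2^-1 + s%:R) * whit_cre nu0 s - nu0 * whit_cim nu0 s.
Proof.
have := whittaker_coefS nu0 s; rewrite /whit_cre /whit_cim natr_complex.
case: (whittaker_coef _ _) => a b; case: (whittaker_coef _ _) => c d.
by simpc => -[h _]; move: h; rewrite /= -[s.+1%:R]natr1 => h; lra.
Qed.

Lemma whittaker_coef_im (nu0 : R) s :
  s.+1%:R * (s.+1%:R * whit_cim nu0 s.+1 + 2 * nu0 * whit_cre nu0 s.+1)
  = (2^-1 + s%:R) * whit_cim nu0 s + nu0 * whit_cre nu0 s.
Proof.
have := whittaker_coefS nu0 s; rewrite /whit_cre /whit_cim natr_complex.
case: (whittaker_coef _ _) => a b; case: (whittaker_coef _ _) => c d.
by simpc => -[_ h]; move: h; rewrite /= -[s.+1%:R]natr1 => h; lra.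
Qed.

(** Passing from s to s + 1 multiplies the modulus by at most 1 / (s + 1), because |1/2 + s + i nu0|
    <= |1 + s + 2 i nu0|. *)
Lemma whittaker_coef_sqnorm (nu0 : R) s :
  whit_cre nu0 s ^+ 2 + whit_cim nu0 s ^+ 2 <= (s`!%:R)^-1 ^+ 2.
Proof.
elim: s => [|s IH].
  by rewrite /whit_cre /whit_cim whittaker_coef0 /= expr0n addr0 fact0 invr1.
have hre := whittaker_coef_re nu0 s; have him := whittaker_coef_im nu0 s.
set a' := whit_cre nu0 s.+1 in hre him *; set b' := whit_cim nu0 s.+1 in hre him *.
set a := whit_cre nu0 s in hre him IH *; set b := whit_cim nu0 s in hre him IH *.
have e : (s.+1%:R ^+ 2 + (2 * nu0) ^+ 2) * (s.+1%:R ^+ 2 * (a' ^+ 2 + b' ^+ 2))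
   = ((2^-1 + s%:R) ^+ 2 + nu0 ^+ 2) * (a ^+ 2 + b ^+ 2).
  have -> : ((2^-1 + s%:R) ^+ 2 + nu0 ^+ 2) * (a ^+ 2 + b ^+ 2) =
    ((2^-1 + s%:R) * a - nu0 * b) ^+ 2 + ((2^-1 + s%:R) * b + nu0 * a) ^+ 2 by ring.
  by rewrite -hre -him; ring.
have p0 : 0 < s.+1%:R ^+ 2 + (2 * nu0) ^+ 2 by rewrite ltr_wpDr ?sqr_ge0 ?exprn_gt0.
have le1 : (2^-1 + s%:R) ^+ 2 + nu0 ^+ 2 <= s.+1%:R ^+ 2 + (2 * nu0) ^+ 2.
  rewrite -[s.+1%:R]natr1; have : 0 <= s%:R :> R by [].
  have := sqr_ge0 nu0; nra.
have ab0 : 0 <= a ^+ 2 + b ^+ 2 by pos.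
have h : s.+1%:R ^+ 2 * (a' ^+ 2 + b' ^+ 2) <= a ^+ 2 + b ^+ 2.
  by rewrite -(ler_pM2l p0) e; apply: ler_wpM2r.
rewrite factS natrM invfM exprMn exprVn ler_pdivlMl ?exprn_gt0 //.
exact: le_trans h IH.
Qed.

Lemma exp_bounded_whittaker_re (nu0 : R) : exp_bounded (whit_cre nu0).
Proof.
exists 1 => s; rewrite mul1r -(@ler_pXn2r _ 2) ?nnegrE //.
rewrite real_normK ?num_real //.
by apply: le_trans (whittaker_coef_sqnorm nu0 s); rewrite lerDl sqr_ge0.
Qed.

Lemma exp_bounded_whittaker_im (nu0 : R) : exp_bounded (whit_cim nu0).
Proof.
exists 1 => s; rewrite mul1r -(@ler_pXn2r _ 2) ?nnegrE //.
rewrite real_normK ?num_real //.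
by apply: le_trans (whittaker_coef_sqnorm nu0 s); rewrite lerDr sqr_ge0.
Qed.

Lemma cseries_whittaker (nu0 : R) (x : R) :
  cseries (fun s => whittaker_coef nu0 s * (x ^+ s)%:C) = psum (whit_cre nu0) x +i* psum (whit_cim nu0) x.
Proof.
rewrite /cseries /psum /pseries; congr (limn (series _) +i* limn (series _));
  apply/funext => s; rewrite /whit_cre /whit_cim /=; case: (whittaker_coef nu0 s) => a b; by simpc.
Qed.

Lemma whittakerM0E (nu0 : R) (x : R) : 0 < x -> whittakerM0 (0 +i* nu0) x =
  (expR (- x / 2) * Num.sqrt x)%:C * ((cos (nu0 * ln x) +i* sin (nu0 * ln x))
   * (psum (whit_cre nu0) x +i* psum (whit_cim nu0) x)).
Proof.
move=> x0; rewrite /whittakerM0 -/(whittaker_coef nu0) cseries_whittaker.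
have := whittaker_param nu0 0; rewrite mulr0n !addr0 => ->.
by rewrite /cpow /= powR12_sqrt ?(ltW x0) // rmorphM !mulrA.
Qed.

(** For real x every operation in the definition commutes with conjugation. Convergence is called
    upon only for the imaginary part of the series, to take the sign through the limit. *)
Lemma whittakerM0_conj (nu0 : R) (x : R) : whittakerM0 (0 -i* nu0) x = (whittakerM0 (0 +i* nu0) x)^*.
Proof.
have pocJ (a : R[i]) s : pochhammer (a^*) s = (pochhammer a s)^*.
  rewrite /pochhammer rmorph_prod; apply: eq_bigr => i _.
  by rewrite rmorphD rmorph_nat.
have e1 : (2^-1 + (0 -i* nu0) : R[i]) = (2^-1 + (0 +i* nu0))^*.
  by rewrite half_complex; simpc; congr (_ +i* _); rewrite /= ?opprD ?oppr0.
have e2 : (1 + 2 * (0 -i* nu0) : R[i]) = (1 + 2 * (0 +i* nu0))^*.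
  by rewrite natr_complex; simpc; congr (_ +i* _); rewrite /=; ring.
have cM (u v : R[i]) : (u * v)^* = u^* * v^* by exact: rmorphM.
have cV (u : R[i]) : (u^-1)^* = (u^*)^-1 by exact: (fmorphV (@conjc R)).
have cN n : (n%:R : R[i])^* = n%:R by exact: (rmorph_nat (@conjc R)).
have cR (u : R) : (u%:C)^* = u%:C by exact: conjc_real.
have uJ s : pochhammer (2^-1 + (0 -i* nu0)) s
    / (pochhammer (1 + 2 * (0 -i* nu0)) s * (s`!)%:R) * (x ^+ s)%:C
    = (whittaker_coef nu0 s * (x ^+ s)%:C)^*.
  rewrite e1 e2 !pocJ /whittaker_coef.
  by rewrite cM cR cM cV cM cN.
rewrite /whittakerM0 !cM cR; congr (_ * _ * _).
  rewrite e1 /cpow cR; case: (2^-1 + _) => a b /=.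
  by rewrite mulNr cosN sinN.
rewrite (_ : (fun s => _) = fun s => (whittaker_coef nu0 s * (x ^+ s)%:C)^*); last exact/funext.
rewrite -/(whittaker_coef nu0) cseries_whittaker /cseries /psum /=.
congr (_ +i* _).
  by congr (limn (series _)); apply/funext => s; rewrite /whit_cre /=; case: (whittaker_coef nu0 s) => a b; simpc.
rewrite -limN; last by apply: exp_bounded_cvg; exact: exp_bounded_whittaker_im.
congr (limn _); apply/funext => n; transitivity (- pseries (whit_cim nu0) x n) => //.
rewrite /series /pseries /= -sumrN; apply: eq_bigr => s _.
by rewrite /whit_cim; case: (whittaker_coef nu0 s) => a b; simpc.
Qed.

End WhittakerComplex.

(** M_- is the conjugate of M_+ on the positive axis, so phi_u is 2 i times the imaginary part of
    M_+(1) conj (M_+(y)): a purely imaginary multiple of a real solution. Its slope V'(1) is a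
    Wronskian up to a factor, equal to - 4 m nu. *)
Lemma phi_u_real (R : realType) (beta : R) (m : nat) :
  4^-1 < beta ^+ 2 -> (1 <= m)%N -> exists V dV : R -> R,
  [/\ forall y, 0 < y -> phi_u beta m y = 0 +i* V y,
      forall y : R, 0 < y -> is_derive y 1 V (dV y),
      forall y : R, 0 < y -> is_derive y 1 dV ((m%:R ^+ 2 - beta ^+ 2 / y ^+ 2) * V y),
      V 1 = 0 & dV 1 != 0].
Proof.
move=> b14 m1; pose n0 := nu beta.
have n2 : n0 ^+ 2 = beta ^+ 2 - 4^-1 by rewrite sqr_sqrtr // subr_ge0 ltW.
have n00 : n0 != 0 by rewrite -sqrf_eq0 n2 gt_eqF // subr_gt0.
pose al := whit_cre n0; pose be := whit_cim n0.
have ea : exp_bounded al := exp_bounded_whittaker_re n0.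
have eb : exp_bounded be := exp_bounded_whittaker_im n0.
have rr := whittaker_coef_re n0; have ri := whittaker_coef_im n0.
pose X := whit_re n0 al be; pose Y := whit_im n0 al be.
pose dX := dwhit_re n0 al be; pose dY := dwhit_im n0 al be.
have m0 : (0 : R) < m%:R by rewrite ltr0n.
have [M Mm] : exists M : R, M = 2 * m%:R by exists (2 * m%:R).
have M0 : 0 < M by rewrite Mm mulr_gt0.
have DM (y : R) : is_derive y 1 (fun z => M * z) M.
  by eapply is_derive_eq; [der | rewrite /=; ring].
have HX (y : R) : 0 < y -> is_derive y 1 (fun z => X (M * z)) (dX (M * y) * M).
  move=> y0; apply: (is_derive_chain (f := X) (g := fun z => M * z)); first exact: is_derive_whittaker_re (mulr_gt0 M0 y0).
have HY (y : R) : 0 < y -> is_derive y 1 (fun z => Y (M * z)) (dY (M * y) * M).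
  move=> y0; apply: (is_derive_chain (f := Y) (g := fun z => M * z)); first exact: is_derive_whittaker_im (mulr_gt0 M0 y0).
have HdX (y : R) : 0 < y -> is_derive y 1 (fun z => dX (M * z))
    ((4^-1 - (n0 ^+ 2 + 4^-1) / (M * y) ^+ 2) * X (M * y) * M).
  move=> y0; apply: (is_derive_chain (f := dX) (g := fun z => M * z)).
    exact: (is_derive2_whittaker_re ea eb rr ri (mulr_gt0 M0 y0)).
have HdY (y : R) : 0 < y -> is_derive y 1 (fun z => dY (M * z))
    ((4^-1 - (n0 ^+ 2 + 4^-1) / (M * y) ^+ 2) * Y (M * y) * M).
  move=> y0; apply: (is_derive_chain (f := dY) (g := fun z => M * z)).
    exact: (is_derive2_whittaker_im ea eb rr ri (mulr_gt0 M0 y0)).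
exists (fun y => 2 * (Y M * X (M * y) - X M * Y (M * y))).
exists (fun y => 2 * M * (Y M * dX (M * y) - X M * dY (M * y))).
have ME (y : R) : 0 < y -> whittakerM0 (0 +i* n0) (M * y) = X (M * y) +i* Y (M * y).
  move=> y0; rewrite whittakerM0E ?mulr_gt0 // /X /Y /whit_re /whit_im -/al -/be.
  move: (cos _) (sin _) (psum _ _) (psum _ _) (_ * Num.sqrt _) => a b c d r.
  by simpc; congr (_ +i* _); rewrite /=; ring.
split.
- move=> y y0; rewrite /phi_u /Mplus /Mminus whittakerM0_conj whittakerM0_conj.
  rewrite -/n0 -Mm (ME _ ltr01) (ME _ y0) mulr1.
  simpc; congr (_ +i* _); rewrite /=; ring.
- move=> y y0; have hx := HX y y0; have hy := HY y y0.
  eapply is_derive_eq; first by der.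
  by rewrite /=; ring.
- move=> y y0; have hx := HdX y y0; have hy := HdY y y0.
  eapply is_derive_eq; first by der.
  have -> : m%:R = M / 2 by rewrite Mm; field.
  rewrite /= n2; move: (X _) (Y _) => *; by field; rewrite !gt_eqF.
- by rewrite mulr1; ring.
- have := whittaker_wronskian ea eb rr ri M0.
  rewrite {1}/al /whit_cre {1}/be /whit_cim whittaker_coef0 /= => /(_ erefl erefl).
  rewrite -/al -/be -/X -/Y -/dX -/dY mulr1 => w.
  rewrite (_ : _ - _ = - n0); last by rewrite -w; ring.
  by rewrite mulrN oppr_eq0 !mulf_neq0 // gt_eqF.
Qed.

(** * Integration and weak derivatives on (0,1) *)

Section Int01.
Context {R : realType}.
Implicit Types (f g h : R -> R) (c K : R).

Definition integ01 f := lebesgue_measure.-integrable (`]0, 1[ : set R) (EFin \o f).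
Definition int01 f : R := (\int[lebesgue_measure]_(x in `]0, 1[) f x)%R.

Lemma eq_int01 f g : (forall x, 0 < x < 1 -> f x = g x) -> int01 f = int01 g.
Proof. by move=> e; apply: eq_Rintegral => x; rewrite inE /= in_itv /= => /e. Qed.

Lemma eq_integ01 f g : (forall x, 0 < x < 1 -> f x = g x) -> integ01 f -> integ01 g.
Proof.
move=> e; apply: eq_integrable => // x; rewrite inE /= in_itv /= => /e.
by move=> ->.
Qed.

Lemma integ01_add f g : integ01 f -> integ01 g -> integ01 (fun x => f x + g x).
Proof.
move=> If Ig; rewrite /integ01.
rewrite (_ : _ \o _ = ((EFin \o f) \+ (EFin \o g))%E); first exact: integrableD.
by apply/funext => x /=; rewrite EFinD.
Qed.

Lemma integ01_scale c f : integ01 f -> integ01 (fun x => c * f x).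
Proof.
move=> If; rewrite /integ01.
rewrite (_ : _ \o _ = (fun x => (c%:E * (EFin \o f) x)%E)); first exact: integrableZl.
by apply/funext => x /=; rewrite EFinM.
Qed.

Lemma integ01_sub f g : integ01 f -> integ01 g -> integ01 (fun x => f x - g x).
Proof.
move=> If Ig; apply: (@eq_integ01 (fun x => f x + (-1) * g x)).
  by move=> x _; rewrite mulN1r.
by apply: integ01_add => //; apply: integ01_scale.
Qed.

Lemma int01_add f g : integ01 f -> integ01 g ->
  int01 (fun x => f x + g x) = int01 f + int01 g.
Proof. by move=> If Ig; apply: RintegralD. Qed.

Lemma int01_scale c f : integ01 f -> int01 (fun x => c * f x) = c * int01 f.
Proof. by move=> If; apply: RintegralZl. Qed.

Lemma int01_sub f g : integ01 f -> integ01 g ->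
  int01 (fun x => f x - g x) = int01 f - int01 g.
Proof.
move=> If Ig; rewrite -mulN1r -int01_scale // -int01_add //.
  by apply: eq_int01 => x _; rewrite mulN1r.
exact: integ01_scale.
Qed.

Lemma integ01_norm f : integ01 f -> integ01 (fun x => `|f x|).
Proof. by move=> /integrable_norm. Qed.

Lemma int01_le_norm f g : integ01 f -> integ01 g ->
  (forall x, 0 < x < 1 -> `|f x| <= g x) -> `|int01 f| <= int01 g.
Proof.
move=> If Ig h; apply: le_trans (le_normr_Rintegral _ If) _ => //.
apply: le_Rintegral => //; first exact: integ01_norm.
Qed.

Lemma integ01_mul h f K : measurable_fun (`]0, 1[ : set R) h ->
  (forall x, 0 < x < 1 -> `|h x| <= K) -> integ01 f -> integ01 (fun x => h x * f x).
Proof.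
move=> mh bh If; rewrite /integ01.
rewrite (_ : _ \o _ = ((EFin \o h) \* (EFin \o f))%E); last by apply/funext.
apply: integrableMr => //.
exists K; split; first exact: num_real.
by move=> y Ky x /=; rewrite in_itv /= => /bh hK; apply: le_trans hK (ltW Ky).
Qed.

Lemma int01_mul_le h f K : measurable_fun (`]0, 1[ : set R) h ->
  (forall x, 0 < x < 1 -> `|h x| <= K) -> integ01 f ->
  `|int01 (fun x => h x * f x)| <= K * int01 (fun x => `|f x|).
Proof.
move=> mh bh If; rewrite -int01_scale; last exact: integ01_norm.
apply: int01_le_norm => [||x xI].
- exact: integ01_mul bh If.
- by apply: integ01_scale; exact: integ01_norm.
- by rewrite normrM; apply: ler_wpM2r => //; apply: bh.
Qed.

Lemma lebesgue_measure01 : lebesgue_measure (`]0, 1[ : set R) = 1%E.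
Proof. by rewrite lebesgue_measure_itv /= lte_fin ltr01 oppr0 adde0. Qed.

Lemma integ01_cst c : integ01 (fun=> c).
Proof.
apply: measurable_bounded_integrable => //.
- by rewrite [ltLHS]lebesgue_measure01 ltry.
- exists `|c|; split; first exact: num_real.
  by move=> y cy x _; apply: ltW.
Qed.

Lemma int01_cst c : int01 (fun=> c) = c.
Proof. by rewrite /int01 Rintegral_cst // [X in fine X]lebesgue_measure01 /= mulr1. Qed.

Lemma integ01_bounded h K : measurable_fun (`]0, 1[ : set R) h ->
  (forall x, 0 < x < 1 -> `|h x| <= K) -> integ01 h.
Proof.
move=> mh bh; apply: (@eq_integ01 (fun x => h x * 1)); first by move=> x _; rewrite mulr1.
exact: integ01_mul bh (integ01_cst 1).
Qed.

Lemma measurable01_cont f : continuous f -> measurable_fun (`]0, 1[ : set R) f.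
Proof. by move=> cf; apply: measurable_funTS; apply: continuous_measurable_fun. Qed.

Lemma measurable01_cont_itv f : cont_itv 0 1 f -> measurable_fun (`]0, 1[ : set R) f.
Proof.
move=> cf; apply: open_continuous_measurable_fun; first exact: interval_open.
by move=> x; rewrite inE /= => xI; apply: (within_continuous_continuous ltr01 cf).
Qed.


End Int01.

(** * Square-integrable functions on (0,1) *)

Section L2.
Context {R : realType}.
Implicit Types (f g : R -> R[i]).

Definition sqn f (x : R) : R := rePart f x ^+ 2 + imPart f x ^+ 2.

Lemma normc_sq (z : R[i]) : Normc.normc z ^+ 2 = complex.Re z ^+ 2 + complex.Im z ^+ 2.
Proof. by case: z => a b; rewrite /= sqr_sqrtr // addr_ge0 ?sqr_ge0. Qed.

Lemma L2norm_sqE f : (L2norm f `^ 2 = \int[lebesgue_measure]_(x in `]0%R, 1%R[) (sqn f x)%:E)%E.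
Proof.
rewrite /L2norm powR_Lnorm // [RHS]integral_mkcond; apply: eq_integral => x _.
rewrite /= !patchE; case: ifPn => _.
  by rewrite powR_mulrn // real_normK ?num_real // /sqn -normc_sq.
(* Outside (0,1) the restriction takes the default value [point], which is 0 in R. *)
rewrite (_ : (point : R) = 0) // normr0 powR_mulrn // expr0n //.
Qed.

Lemma measurable_sqn f : measurable_fun (`]0, 1[ : set R) (rePart f) ->
  measurable_fun (`]0, 1[ : set R) (imPart f) ->
  measurable_fun (`]0, 1[ : set R) (sqn f).
Proof. by move=> mr mi; apply: measurable_funD; apply: measurable_funX. Qed.

Lemma sqn_ge0 f x : 0 <= sqn f x.
Proof. by rewrite addr_ge0 ?sqr_ge0. Qed.

Lemma inL2P f : inL2 f <-> [/\ measurable_fun (`]0, 1[ : set R) (rePart f),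
  measurable_fun (`]0, 1[ : set R) (imPart f) & integ01 (sqn f)].
Proof.
have E : measurable_fun (`]0, 1[ : set R) (rePart f) -> measurable_fun (`]0, 1[ : set R) (imPart f) ->
    (L2norm f < +oo)%E <-> integ01 (sqn f).
  move=> mr mi; have ms := measurable_sqn mr mi.
  have absE : (\int[lebesgue_measure]_(x in `]0%R, 1%R[) `|(EFin \o sqn f) x|)%E
      = (L2norm f `^ 2)%E.
    rewrite L2norm_sqE; apply: eq_integral => x _ /=.
    by rewrite ger0_norm // sqn_ge0.
  split=> [h|/integrableP[_]].
    apply/integrableP; split; first exact/measurable_EFinP.
    by rewrite absE; apply: poweR_lty.
  by rewrite absE; apply: lty_poweRy.
by split=> [[mr mi h]|[mr mi h]]; split => //; apply/E.
Qed.

Lemma L2norm_le f (K : R) : 0 <= K -> measurable_fun (`]0, 1[ : set R) (rePart f) ->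
  measurable_fun (`]0, 1[ : set R) (imPart f) ->
  (forall x, 0 < x < 1 -> sqn f x <= K ^+ 2) -> (L2norm f <= K%:E)%E.
Proof.
move=> K0 mr mi h; have ms := measurable_sqn mr mi.
have h2 : (L2norm f `^ 2 <= (K ^+ 2)%:E)%E.
  rewrite L2norm_sqE.
  have I1 : integ01 (sqn f).
    by apply: (integ01_bounded (K := K ^+ 2)) => // x xI; rewrite ger0_norm ?sqn_ge0 ?h.
  have -> : (\int[lebesgue_measure]_(x in `]0%R, 1%R[) (sqn f x)%:E)%E = (int01 (sqn f))%:E.
    rewrite /int01 /Rintegral fineK //; exact: integrable_fin_num.
  rewrite lee_fin -(int01_cst (K ^+ 2)); apply: le_trans (ler_norm _) _.
  apply: int01_le_norm => //; first exact: integ01_cst.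
  by move=> x xI; rewrite ger0_norm ?sqn_ge0 ?h.
move: (L2norm f) (Lnorm_ge0 lebesgue_measure 2%:E _ : 0 <= L2norm f)%E h2 => [r| |] //=.
- rewrite lee_fin => r0; rewrite lee_fin powR_mulrn // => h2.
  by rewrite lee_fin -(@ler_pXn2r _ 2) // nnegrE.
- by move=> _; rewrite pnatr_eq0.
Qed.

Lemma inL2_integ01 f : inL2 f -> integ01 (rePart f) /\ integ01 (imPart f).
Proof.
move=> /inL2P[mr mi h].
have I1 : integ01 (fun x => 1 + sqn f x) by apply: integ01_add => //; exact: integ01_cst.
split; apply: (le_integrable _ _ _ I1) => //; try exact/measurable_EFinP; move=> x _ /=;
  rewrite lee_fin (ger0_norm (addr_ge0 ler01 (sqn_ge0 f x))) /sqn.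
  have := sqr_ge0 (imPart f x); have := sqr_ge0 (rePart f x - 1); have := sqr_ge0 (rePart f x + 1).
  by rewrite ler_norml => *; apply/andP; split; nra.
have := sqr_ge0 (rePart f x); have := sqr_ge0 (imPart f x - 1); have := sqr_ge0 (imPart f x + 1).
  by rewrite ler_norml => *; apply/andP; split; nra.
Qed.

Lemma inL2_add f g : inL2 f -> inL2 g -> inL2 (fun x => f x + g x).
Proof.
move=> /inL2P[fr fi If] /inL2P[gr gi Ig].
have reE : rePart (fun x => f x + g x) = (fun x => rePart f x + rePart g x).
  by apply/funext => x; rewrite /rePart; case: (f x) => a b; case: (g x).
have imE : imPart (fun x => f x + g x) = (fun x => imPart f x + imPart g x).
  by apply/funext => x; rewrite /imPart; case: (f x) => a b; case: (g x).
have mr : measurable_fun (`]0, 1[ : set R) (rePart (fun x => f x + g x)).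
  by rewrite reE; apply: measurable_funD.
have mi : measurable_fun (`]0, 1[ : set R) (imPart (fun x => f x + g x)).
  by rewrite imE; apply: measurable_funD.
apply/inL2P; split => //.
have I1 : integ01 (fun x => 2 * sqn f x + 2 * sqn g x).
  by apply: integ01_add; apply: integ01_scale.
apply: (le_integrable _ _ _ I1) => //; first by apply/measurable_EFinP; apply: measurable_sqn.
move=> x _ /=; rewrite lee_fin ger0_norm ?sqn_ge0 //; apply: le_trans (ler_norm _).
rewrite /sqn reE imE.
have := sqr_ge0 (rePart f x - rePart g x); have := sqr_ge0 (imPart f x - imPart g x).
nra.
Qed.

Lemma inL2_mul f (h : R -> R) (K : R) : measurable_fun (`]0, 1[ : set R) h ->
  (forall x, 0 < x < 1 -> `|h x| <= K) -> inL2 f -> inL2 (fun x => (h x)%:C * f x).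
Proof.
move=> mh bh /inL2P[fr fi If].
have reE : rePart (fun x => (h x)%:C * f x) = (fun x => h x * rePart f x).
  by apply/funext => x; rewrite /rePart; case: (f x) => a b; simpc.
have imE : imPart (fun x => (h x)%:C * f x) = (fun x => h x * imPart f x).
  by apply/funext => x; rewrite /imPart; case: (f x) => a b; simpc.
have mr : measurable_fun (`]0, 1[ : set R) (rePart (fun x => (h x)%:C * f x)).
  by rewrite reE; apply: measurable_funM.
have mi : measurable_fun (`]0, 1[ : set R) (imPart (fun x => (h x)%:C * f x)).
  by rewrite imE; apply: measurable_funM.
apply/inL2P; split => //.
apply: (@eq_integ01 _ (fun x => h x ^+ 2 * sqn f x)).
  by move=> x _; rewrite /sqn reE imE; ring.
apply: (@integ01_mul _ _ _ (K ^+ 2)) => //; first exact: measurable_funX.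
move=> x xI; rewrite normrX ler_pXn2r ?nnegrE ?bh //.
exact: le_trans (normr_ge0 _) (bh _ xI).
Qed.

End L2.

(** * Weak derivatives tested on C^1 functions *)

Section WeakDerivative.
Context {R : realType}.
Implicit Types (f g h phi : R -> R).

Lemma test_functionP phi dphi (a b : R) : (forall x : R, is_derive x 1 phi (dphi x)) ->
  continuous dphi -> 0 < a -> b < 1 -> (forall x, ~~ (a <= x <= b) -> phi x = 0) ->
  test_function phi /\ derive1 phi = dphi.
Proof.
move=> D c a0 b1 z; have e : derive1 phi = dphi.
  by apply/funext => x; rewrite derive1E; have /@derive_val := D x.
split=> //; split=> [x||].
- by have [] := D x.
- by rewrite e.
- by exists a, b; split => // x; rewrite in_itv /= => /z.
Qed.

Lemma test_is_derive phi : test_function phi -> forall x : R, is_derive x 1 phi (derive1 phi x).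
Proof. by move=> [D _ _] x; rewrite derive1E; apply: DeriveDef. Qed.

Lemma test_continuous phi : test_function phi -> continuous phi.
Proof.
move=> [D _ _] x; apply: differentiable_continuous.
by apply/derivable1_diffP.
Qed.

Lemma continuous_bounded01 f : continuous f -> exists2 K, 0 <= K & forall x, 0 <= x <= 1 -> `|f x| <= K.
Proof. by move=> cf; apply: cont_itv_bounded ler01 _; apply: continuous_subspaceT. Qed.

Lemma integ01_continuous_mul h f : continuous h -> integ01 f -> integ01 (fun x => h x * f x).
Proof.
move=> ch If; have [K K0 bK] := continuous_bounded01 ch.
apply: (integ01_mul (K := K)) => //; first exact: measurable01_cont.
by move=> x /andP[x0 x1]; apply: bK; rewrite !ltW.
Qed.

Lemma int01_continuous_mul_le h f K : continuous h -> integ01 f ->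
  (forall x, 0 < x < 1 -> `|h x| <= K) ->
  `|int01 (fun x => h x * f x)| <= K * int01 (fun x => `|f x|).
Proof. by move=> ch If bh; apply: int01_mul_le => //; exact: measurable01_cont. Qed.

(** Heine's theorem, with translates x + s that may leave [0, 1], as they do in difference
    quotients. *)
Lemma continuous_uniform (g : R -> R) (eta : R) : continuous g -> 0 < eta ->
  exists2 d, 0 < d & forall x s, 0 <= x <= 1 -> 0 <= s < d -> `|g (x + s) - g x| <= eta.
Proof.
move=> cg eta0.
have H : \forall d \near (0 : R)^'+, `[0, 1]%classic `<=` [set x : R | forall s, 0 <= s < d -> `|g (x + s) - g x| <= eta].
  have /compact_near_coveringP := @segment_compact R 0 1.
  apply => x _.
  have /cvgrPdist_lt /(_ (eta / 2)) := cg x.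
  rewrite divr_gt0 // => /(_ isT) /nbhs_ballP[r /= r0 br].
  exists (ball x (r / 2), [set d | d < r / 2]).
    split; first by apply: nbhsx_ballx; rewrite divr_gt0.
    by apply: nbhs_right_lt; rewrite divr_gt0.
  move=> [y d] /= [xy dr] s /andP[s0 sd].
  have h1 : ball x r y by apply: le_ball xy; lra.
  have h2 : ball x r (y + s).
    rewrite /ball /= in xy *; rewrite (_ : x - (y + s) = (x - y) - s); last by ring.
    by apply: le_lt_trans (ler_normB _ _) _; rewrite (ger0_norm s0); lra.
  have := br _ h1; have := br _ h2 => /= g1 g2.
  rewrite (_ : g (y + s) - g y = (g x - g y) - (g x - g (y + s))); last by ring.
  by apply: le_trans (ler_normB _ _) _; lra.
move: H => [d /= d0 H].
exists (d / 2) => [|x s xI sd]; first by rewrite divr_gt0.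
apply: (H (d / 2)) => //.
- by rewrite /ball /= sub0r normrN ger0_norm; [lra|rewrite divr_ge0 // ltW].
- by rewrite divr_gt0.
Qed.

(* Difference quotients of a test function are test functions and converge uniformly to its derivative. *)
Lemma int01_derive_eq0 (u : R -> R) : integ01 u ->
  (forall phi, test_function phi -> int01 (fun x => phi x * u x) = 0) ->
  forall phi, test_function phi -> int01 (fun x => derive1 phi x * u x) = 0.
Proof.
move=> Iu H phi tphi; have [D c [a [b [a0 b1 z]]]] := tphi.
have D' := test_is_derive tphi.
have Iu' := integ01_norm Iu.
apply/eqP; rewrite -normr_le0; apply/ler_addgt0Pr => eta eta0; rewrite add0r.
pose U := int01 (fun x => `|u x|).
have U0 : 0 <= U by apply: le_trans (normr_ge0 _) (int01_le_norm Iu Iu' _).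
pose et := eta / (U + 1).
have et0 : 0 < et by rewrite divr_gt0 // ltr_wpDl.
have [d d0 Hd] := continuous_uniform c et0.
(* [h] lies below the modulus of continuity of phi' and keeps the support of the quotient, which
   begins at a - h >= a / 2, inside (0,1). *)
pose h := Num.min (d / 2) (a / 2).
have h0 : 0 < h by rewrite lt_min !divr_gt0.
have hd : h < d by rewrite gt_min; apply/orP; left; lra.
have ha : h <= a / 2 by rewrite ge_min lexx orbT.
pose q x := (phi (x + h) - phi x) / h.
have Dq (x : R) : is_derive x 1 q ((derive1 phi (x + h) - derive1 phi x) / h).
  have h1 := D' x.
  have h2 : is_derive x 1 (fun y => phi (y + h)) (derive1 phi (x + h)).
    have h3 : is_derive x 1 (fun y => y + h) 1 by eapply is_derive_eq; [der | rewrite addr0].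
    by rewrite -[derive1 phi (x + h)]mulr1; exact: (is_derive_chain (f := phi) (g := fun y => y + h) (D' (x + h)) h3).
  by rewrite /q; eapply is_derive_eq; [der | rewrite /=; ring].
have cphi := test_continuous tphi.
have shiftc (g : R -> R) : continuous g -> continuous (fun x => g (x + h)).
  move=> cg x; apply: (continuous_comp (f := fun x => x + h) (g := g)) => //; last exact: cg.
  by apply: cvgD; [exact: cvg_id | exact: cvg_cst].
have cq : continuous q.
  by move=> x; apply: cvgM; [apply: cvgB; [apply: shiftc | apply: cphi] | exact: cvg_cst].
have cdq : continuous (fun x => (derive1 phi (x + h) - derive1 phi x) / h).
  by move=> x; apply: cvgM; [apply: cvgB; [apply: shiftc | apply: c] | exact: cvg_cst].
have [tq _] : test_function q /\ derive1 q = (fun x => (derive1 phi (x + h) - derive1 phi x) / h).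
  apply: (test_functionP (a := a / 2) (b := b)) => //; first by rewrite divr_gt0.
  move=> x nx; rewrite /q !z ?subrr ?mul0r //; rewrite in_itv /=; apply: contra nx => /andP[? ?];
    apply/andP; split; lra.
have -> : int01 (fun x => derive1 phi x * u x) = int01 (fun x => (derive1 phi x - q x) * u x).
  have e : int01 (fun x => derive1 phi x * u x - q x * u x) = int01 (fun x => derive1 phi x * u x).
    have i1 := integ01_continuous_mul c Iu; have i2 := integ01_continuous_mul cq Iu.
    by rewrite (int01_sub i1 i2) (H _ tq) subr0.
  by rewrite -e; apply: eq_int01 => x _; ring.
apply: le_trans (int01_continuous_mul_le (K := et) _ Iu _) _.
- by move=> x; apply: cvgB; [apply: c | apply: cq].
- move=> x /andP[x0 x1].
  have xh : x < x + h by rewrite ltrDl.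
  have [y [/andP[xy yx] e]] : exists y, x < y < x + h /\ phi (x + h) - phi x = derive1 phi y * (x + h - x).
    apply: MVT_oo => //; apply: continuous_subspaceT => t; exact: cphi.
  have -> : q x = derive1 phi y.
    by rewrite /q e (_ : x + h - x = h) ?mulfK ?gt_eqF //; ring.
  rewrite -normrN opprB (_ : y = x + (y - x)); last by ring.
  by apply: Hd; [rewrite !ltW | apply/andP; split; lra].
- rewrite -/U /et mulrAC ler_pdivrMr ?ltr_wpDl //; apply: ler_wpM2l; first exact: ltW.
  lra.
Qed.

Definition wd f g := forall phi, test_function phi ->
  int01 (fun x => derive1 phi x * f x) = - int01 (fun x => phi x * g x).

Lemma weak_derivativeP (f g : R -> R[i]) : weak_derivative f g <->
  [/\ inL2 g, wd (rePart f) (rePart g) & wd (imPart f) (imPart g)].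
Proof.
have re (a : R) (z : R[i]) : complex.Re (a%:C * z) = a * complex.Re z.
  by case: z => x y; simpc.
have im (a : R) (z : R[i]) : complex.Im (a%:C * z) = a * complex.Im z.
  by case: z => x y; simpc.
have E phi (u : R -> R[i]) : cintegral `]0, 1[ (fun x => (phi x)%:C * u x) =
   int01 (fun x => phi x * rePart u x) +i* int01 (fun x => phi x * imPart u x).
  by rewrite /cintegral; congr (_ +i* _); apply: eq_int01 => x _; rewrite /rePart /imPart ?re ?im.
split=> [[Lg H]|[Lg H1 H2]].
  split=> // phi tphi; have := H phi tphi; rewrite !E; simpc; by move=> -[].
split=> // phi tphi; rewrite !E (H1 _ tphi) (H2 _ tphi); by simpc.
Qed.

(** Two weak derivatives of f agree against test functions, hence by [int01_derive_eq0] also against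
    derivatives of test functions. This takes the place of their equality almost everywhere. *)
Lemma wd_indep f g g' k : integ01 g -> integ01 g' -> wd f g -> wd f g' -> wd g k -> wd g' k.
Proof.
move=> Ig Ig' fg fg' gk phi tphi.
have [_ cdphi _] := tphi.
have H : int01 (fun x => derive1 phi x * (g x - g' x)) = 0.
  apply: (int01_derive_eq0 _ _ tphi); first exact: integ01_sub.
  move=> chi tchi; have cchi := test_continuous tchi.
  rewrite (@eq_int01 _ _ (fun x => chi x * g x - chi x * g' x)); last by move=> x _; ring.
  rewrite int01_sub; [|exact: integ01_continuous_mul|exact: integ01_continuous_mul].
  by rewrite -[X in X - _]opprK -fg // -[X in _ - X]opprK -fg' // subrr.
rewrite -gk // -[LHS]add0r -H -int01_add; last 2 first.
- by apply: integ01_continuous_mul => //; apply: integ01_sub.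
- exact: integ01_continuous_mul.
- by apply: eq_int01 => x _; ring.
Qed.

Lemma wderiveP (f : R -> R[i]) : (exists g : R -> R[i], weak_derivative f g) -> weak_derivative f (wderive f).
Proof. by move=> [g hg]; rewrite /wderive; case: xgetP => [h _ //|/(_ g)]. Qed.

(** [wderive] selects some weak derivative of f, perhaps not the one that [inH2] equips with a
    derivative of its own; [wd_indep] carries the second derivative over. *)
Lemma inH2_wderive (f : R -> R[i]) : inH2 f ->
  weak_derivative f (wderive f) /\ weak_derivative (wderive f) (wderive (wderive f)).
Proof.
move=> [Lf [g [fg [Lg [k gk]]]]].
have fd : weak_derivative f (wderive f) by apply: wderiveP; exists g.
split; first exact: fd.
apply: (@wderiveP (wderive f)); exists k.
have /weak_derivativeP[Ld d1 d2] := fd; have /weak_derivativeP[_ g1 g2] := fg.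
have /weak_derivativeP[Lk k1 k2] := gk.
have [Ig1 Ig2] := inL2_integ01 Lg; have [Id1 Id2] := inL2_integ01 Ld.
by apply/weak_derivativeP; split => //; [apply: (wd_indep Ig1 Id1 g1) | apply: (wd_indep Ig2 Id2 g2)].
Qed.

Lemma weak_derivative_add (f1 f2 g1 g2 : R -> R[i]) : inL2 f1 -> inL2 f2 ->
  weak_derivative f1 g1 -> weak_derivative f2 g2 ->
  weak_derivative (fun x => f1 x + f2 x) (fun x => g1 x + g2 x).
Proof.
move=> L1 L2 /weak_derivativeP[M1 a1 b1] /weak_derivativeP[M2 a2 b2].
apply/weak_derivativeP.
have re (u v : R -> R[i]) : rePart (fun x => u x + v x) = (fun x => rePart u x + rePart v x).
  by apply/funext => x; rewrite /rePart; case: (u x) => a b; case: (v x).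
have im (u v : R -> R[i]) : imPart (fun x => u x + v x) = (fun x => imPart u x + imPart v x).
  by apply/funext => x; rewrite /imPart; case: (u x) => a b; case: (v x).
rewrite !re !im.
have aux (u1 u2 v1 v2 : R -> R) : integ01 u1 -> integ01 u2 -> integ01 v1 -> integ01 v2 ->
    wd u1 v1 -> wd u2 v2 -> wd (fun x => u1 x + u2 x) (fun x => v1 x + v2 x).
  move=> U1 U2 V1 V2 h1 h2 phi tphi; have [_ c _] := tphi; have c' := test_continuous tphi.
  rewrite (@eq_int01 _ _ (fun x => derive1 phi x * u1 x + derive1 phi x * u2 x)); last by move=> x _; ring.
  rewrite (@eq_int01 _ (fun x => phi x * (v1 x + v2 x)) (fun x => phi x * v1 x + phi x * v2 x)); last by move=> x _; ring.
  rewrite !int01_add; try exact: integ01_continuous_mul.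
  by rewrite h1 // h2 // opprD.
have [? ?] := inL2_integ01 L1; have [? ?] := inL2_integ01 L2.
have [? ?] := inL2_integ01 M1; have [? ?] := inL2_integ01 M2.
by split; [exact: inL2_add | exact: aux | exact: aux].
Qed.

Lemma inL2_mulX (f : R -> R[i]) (y0 : R) : inL2 f -> inL2 (fun x => (x - y0)%:C * f x).
Proof.
move=> Lf; apply: (inL2_mul (K := 1 + `|y0|) _ _ Lf).
  by apply: measurable01_cont => x; apply: cvgB; [exact: cvg_id | exact: cvg_cst].
move=> x /andP[x0 x1]; apply: le_trans (ler_normB _ _) _; rewrite lerD2r ger0_norm; exact: ltW.
Qed.

(** The product rule, from testing f against (x - y0) phi. *)
Lemma weak_derivative_mulX (f g : R -> R[i]) (y0 : R) : inL2 f -> weak_derivative f g ->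
  weak_derivative (fun x => (x - y0)%:C * f x) (fun x => f x + (x - y0)%:C * g x).
Proof.
move=> Lf /weak_derivativeP[Lg a b]; apply/weak_derivativeP.
have re (u : R -> R[i]) : rePart (fun x => (x - y0)%:C * u x) = (fun x => (x - y0) * rePart u x).
  by apply/funext => x; rewrite /rePart; case: (u x) => ? ?; simpc.
have im (u : R -> R[i]) : imPart (fun x => (x - y0)%:C * u x) = (fun x => (x - y0) * imPart u x).
  by apply/funext => x; rewrite /imPart; case: (u x) => ? ?; simpc.
have reD (u v : R -> R[i]) : rePart (fun x => u x + v x) = (fun x => rePart u x + rePart v x).
  by apply/funext => x; rewrite /rePart; case: (u x) => ? ?; case: (v x).
have imD (u v : R -> R[i]) : imPart (fun x => u x + v x) = (fun x => imPart u x + imPart v x).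
  by apply/funext => x; rewrite /imPart; case: (u x) => ? ?; case: (v x).
have aux (u v : R -> R) : integ01 u -> integ01 v -> wd u v ->
    wd (fun x => (x - y0) * u x) (fun x => u x + (x - y0) * v x).
  move=> Iu Iv h phi tphi; have [_ c [p [q [p0 q1 z]]]] := tphi; have c' := test_continuous tphi.
  have D := test_is_derive tphi.
  have cx : continuous (fun x : R => x - y0).
    by move=> x; apply: cvgB; [exact: cvg_id | exact: cvg_cst].
  have cM (k1 k2 : R -> R) : continuous k1 -> continuous k2 -> continuous (fun x => k1 x * k2 x).
    by move=> h1 h2 x; apply: cvgM; [exact: h1 | exact: h2].
  have [tpsi dpsi] : test_function (fun x => (x - y0) * phi x) /\
      derive1 (fun x => (x - y0) * phi x) = (fun x => phi x + (x - y0) * derive1 phi x).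
    apply: (test_functionP (a := p) (b := q)) => //.
    - by move=> x; have hx := D x; eapply is_derive_eq; [der | rewrite /=; ring].
    - by move=> x; apply: cvgD; [exact: c' | exact: (cM _ _ cx c)].
    - by move=> x nx; rewrite z ?mulr0 // in_itv.
  have := h _ tpsi; rewrite dpsi.
  rewrite (@eq_int01 _ _ (fun x => phi x * u x + ((x - y0) * derive1 phi x) * u x)); last by move=> x _; ring.
  rewrite int01_add; [|exact: integ01_continuous_mul|by apply: integ01_continuous_mul => //; exact: cM].
  rewrite (@eq_int01 _ (fun x => derive1 phi x * ((x - y0) * u x)) (fun x => ((x - y0) * derive1 phi x) * u x)); last by move=> x _; ring.
  rewrite (@eq_int01 _ (fun x => phi x * (u x + (x - y0) * v x)) (fun x => phi x * u x + (x - y0) * phi x * v x)); last by move=> x _; ring.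
  rewrite int01_add; [|exact: integ01_continuous_mul|by apply: integ01_continuous_mul => //; exact: cM].
  by move=> e; rewrite opprD -e; ring.
have [? ?] := inL2_integ01 Lf; have [? ?] := inL2_integ01 Lg.
rewrite !reD !imD !re !im; split; [|exact: aux|exact: aux].
by apply: inL2_add => //; apply: inL2_mulX.
Qed.

Lemma inH2_mulX (f : R -> R[i]) (y0 : R) : inH2 f -> inH2 (fun x => (x - y0)%:C * f x).
Proof.
move=> [Lf [g [fg [Lg [k gk]]]]]; have [Lk _] := gk.
split; first exact: inL2_mulX.
exists (fun x => f x + (x - y0)%:C * g x); split; first exact: weak_derivative_mulX.
split; first by apply: inL2_add => //; apply: inL2_mulX.
exists (fun x => g x + (g x + (x - y0)%:C * k x)).
apply: weak_derivative_add => //; first exact: inL2_mulX.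
exact: weak_derivative_mulX.
Qed.

(** The second weak derivative in one step. Test functions being C^1 only, phi has to be one whose
    derivative is again a test function. *)
Definition wd2 f k := integ01 k /\ forall phi, test_function phi -> test_function (derive1 phi) ->
  int01 (fun x => derive1 (derive1 phi) x * f x) = int01 (fun x => phi x * k x).

Lemma inH2_wd2 (f : R -> R[i]) : inH2 f ->
  wd2 (rePart f) (rePart (wderive (wderive f))) /\ wd2 (imPart f) (imPart (wderive (wderive f))).
Proof.
move=> /inH2_wderive[/weak_derivativeP[L1 a1 b1] /weak_derivativeP[L2 a2 b2]].
have [? ?] := inL2_integ01 L2.
split; split => // phi t1 t2.
  by rewrite (a1 _ t2) (a2 _ t1) opprK.
by rewrite (b1 _ t2) (b2 _ t1) opprK.
Qed.

Lemma wd2_comb f1 f2 k1 k2 (c : R) : integ01 f1 -> integ01 f2 -> wd2 f1 k1 -> wd2 f2 k2 ->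
  wd2 (fun x => f1 x - c * f2 x) (fun x => k1 x - c * k2 x).
Proof.
move=> F1 F2 [I1 h1] [I2 h2]; split; first by apply: integ01_sub => //; exact: integ01_scale.
move=> phi t1 t2; have [_ cc _] := t2; have c' := test_continuous t1.
rewrite (@eq_int01 _ _ (fun x => derive1 (derive1 phi) x * f1 x - c * (derive1 (derive1 phi) x * f2 x))); last by move=> x _; ring.
rewrite (@eq_int01 _ (fun x => phi x * _) (fun x => phi x * k1 x - c * (phi x * k2 x))); last by move=> x _; ring.
rewrite !int01_sub ?int01_scale ?h1 ?h2 //; try exact: integ01_continuous_mul;
  by apply: integ01_scale; exact: integ01_continuous_mul.
Qed.

End WeakDerivative.

(** * Spline test functions; H^2 functions are Lipschitz *)

Section Splines.
Context {R : realType}.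
Implicit Types (x e a b : R).

Lemma is_derive_quadratic (f : R -> R) x a :
  (forall h, `|f (x + h) - f x - a * h| <= h ^+ 2) -> is_derive x 1 f a.
Proof.
move=> H.
have C : h^-1 *: ((f \o shift x) (h *: (1 : R)) - f x) @[h --> 0^'] --> a.
  apply/cvgrPdist_le => eps eps0; near=> h.
  have h0 : h != 0 by near: h; exact: nbhs_dnbhs_neq.
  have -> : a - h^-1 *: ((f \o shift x) (h *: (1 : R)) - f x) = - (f (x + h) - f x - a * h) / h.
    rewrite /= /GRing.scale /= mulr1 addrC [h + x]addrC; by field.
  rewrite normrM normrN normfV ler_pdivrMr ?normr_gt0 //.
  apply: le_trans (H h) _; rewrite -(real_normK (num_real h)) expr2.
  apply: ler_wpM2r => //.
  near: h; apply: dnbhs0_le => //.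
by apply: DeriveDef; [apply/cvg_ex; exists a | apply: cvg_lim].
Unshelve. all: by end_near. Qed.

(** Truncated powers. Their finite differences give C^2 functions that are constant or linear
    outside an interval and have explicit bounds; degree 3 suffices, since at most two derivatives
    are taken. *)
Definition posp (n : nat) x : R := (Num.max 0 x) ^+ n.

Lemma posp_le0 n x : x <= 0 -> posp n.+1 x = 0.
Proof. by move=> x0; rewrite /posp max_l // expr0n. Qed.

Lemma posp_ge0E n x : 0 <= x -> posp n x = x ^+ n.
Proof. by move=> x0; rewrite /posp max_r. Qed.

Lemma posp1_ge0 x : 0 <= posp 1 x /\ x <= posp 1 x.
Proof. by rewrite /posp expr1 !le_max !lexx orbT. Qed.

Lemma continuous_posp1 : continuous (posp 1 : R -> R).
Proof.
move=> x; rewrite /posp /continuous_at expr1.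
rewrite (_ : (fun _ => _) = fun y : R => Num.max 0 y); last by apply/funext => y; rewrite expr1.
by apply: continuous_max; [exact: cvg_cst | exact: cvg_id].
Qed.

Lemma is_derive_posp2 x : is_derive x 1 (posp 2) (2 * posp 1 x).
Proof.
apply: is_derive_quadratic => h.
have [x0|x0] := leP 0 x; have [xh|xh] := leP 0 (x + h).
- rewrite !posp_ge0E // expr1 (_ : _ - _ - _ = h ^+ 2) ?ger0_norm ?sqr_ge0 //; ring.
- rewrite (posp_le0 _ (ltW xh)) !posp_ge0E // expr1 ler_norml; apply/andP; split; nra.
- rewrite (posp_ge0E _ xh) !(posp_le0 _ (ltW x0)) ler_norml; apply/andP; split; nra.
- rewrite !(posp_le0 _ (ltW _)) // !(mulr0, mul0r, subr0) normr0; exact: sqr_ge0.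
Qed.

Lemma posp3E x : posp 3 x = posp 2 x * x.
Proof.
have [x0|x0] := leP 0 x; first by rewrite !posp_ge0E // -exprSr.
by rewrite !posp_le0 ?(ltW x0) // mul0r.
Qed.

Lemma is_derive_posp3 x : is_derive x 1 (posp 3) (3 * posp 2 x).
Proof.
have -> : posp 3 = (fun y => posp 2 y * y) by apply/funext => y; exact: posp3E.
have h2 := is_derive_posp2 x; eapply is_derive_eq; first by der.
rewrite /=; have [x0|x0] := leP 0 x; first by rewrite !posp_ge0E //; ring.
by rewrite !posp_le0 ?(ltW x0) //; ring.
Qed.

Lemma is_derive_shift (f : R -> R) x a d : is_derive (x + a) 1 f d ->
  is_derive x 1 (fun y => f (y + a)) d.
Proof.
move=> D; have h3 : is_derive x 1 (fun y => y + a) 1 by eapply is_derive_eq; [der | rewrite addr0].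
by rewrite -[d]mulr1; exact: (is_derive_chain (f := f) (g := fun y => y + a) D h3).
Qed.

(* Convex C^2 smoothing of the positive part. *)
Definition ramp e x : R := (posp 3 (x + e) - 2 * posp 3 x + posp 3 (x - e)) / (6 * e ^+ 2).
Definition dramp e x : R := (posp 2 (x + e) - 2 * posp 2 x + posp 2 (x - e)) / (2 * e ^+ 2).
(** The hat function of integral 1 on [- e, e], an approximate identity. *)
Definition ddramp e x : R := (posp 1 (x + e) - 2 * posp 1 x + posp 1 (x - e)) / e ^+ 2.

Lemma is_derive_ramp e x : 0 < e -> is_derive x 1 (ramp e) (dramp e x).
Proof.
move=> e0; have h1 := is_derive_shift (is_derive_posp3 (x + e)).
have h2 := is_derive_shift (is_derive_posp3 (x - e)); have h3 := is_derive_posp3 x.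
rewrite /ramp; eapply is_derive_eq; first by der.
by rewrite /dramp /=; field; rewrite gt_eqF.
Qed.

Lemma is_derive_dramp e x : 0 < e -> is_derive x 1 (dramp e) (ddramp e x).
Proof.
move=> e0; have h1 := is_derive_shift (is_derive_posp2 (x + e)).
have h2 := is_derive_shift (is_derive_posp2 (x - e)); have h3 := is_derive_posp2 x.
rewrite /dramp; eapply is_derive_eq; first by der.
by rewrite /ddramp /=; field; rewrite gt_eqF.
Qed.

Lemma continuous_shift (f : R -> R) a : continuous f -> continuous (fun x => f (x + a)).
Proof.
move=> cf x; apply: (continuous_comp (f := fun x => x + a) (g := f)) => //; last exact: cf.
by apply: cvgD; [exact: cvg_id | exact: cvg_cst].
Qed.

Lemma continuous_ddramp e : continuous (ddramp e).
Proof.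
move=> x; apply: cvgM; last exact: cvg_cst.
have c := continuous_posp1.
apply: cvgD; last exact: (continuous_shift c).
apply: cvgB; first exact: (continuous_shift c).
by apply: cvgM; [exact: cvg_cst | exact: c].
Qed.

Lemma ddramp_ge0 e x : 0 < e -> 0 <= ddramp e x.
Proof.
move=> e0; rewrite /ddramp divr_ge0 ?sqr_ge0 //.
have [a1 a2] := posp1_ge0 (x + e); have [b1 b2] := posp1_ge0 (x - e).
have [x0|x0] := leP 0 x; first by rewrite (posp_ge0E 1 x0) expr1; lra.
by rewrite (posp_le0 0 (ltW x0)); lra.
Qed.

Lemma ddramp_out e x : 0 < e -> e <= `|x| -> ddramp e x = 0.
Proof.
move=> e0; have [x0|x0] := leP 0 x => ex.
  rewrite ger0_norm // in ex; rewrite /ddramp !posp_ge0E ?expr1; [|lra|lra|lra].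
  by rewrite (_ : _ - _ + _ = 0) ?mul0r //; ring.
rewrite ltr0_norm // in ex; rewrite /ddramp !posp_le0; [|lra|lra|lra].
by rewrite mulr0 subrr add0r mul0r.
Qed.

Lemma dramp_left e x : 0 < e -> x <= - e -> dramp e x = 0.
Proof. by move=> e0 xe; rewrite /dramp !posp_le0 ?mulr0 ?subrr ?add0r ?mul0r //; lra. Qed.

Lemma dramp_right e x : 0 < e -> e <= x -> dramp e x = 1.
Proof.
by move=> e0 xe; rewrite /dramp !posp_ge0E; [field; rewrite gt_eqF|lra|lra|lra].
Qed.

Lemma ramp_left e x : 0 < e -> x <= - e -> ramp e x = 0.
Proof. by move=> e0 xe; rewrite /ramp !posp_le0 ?mulr0 ?subrr ?add0r ?mul0r //; lra. Qed.

Lemma ramp_right e x : 0 < e -> e <= x -> ramp e x = x.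
Proof.
by move=> e0 xe; rewrite /ramp !posp_ge0E; [field; rewrite gt_eqF|lra|lra|lra].
Qed.

Lemma dramp_bound e x : 0 < e -> 0 <= dramp e x <= 1.
Proof.
move=> e0.
have mono a b : a <= b -> dramp e a <= dramp e b.
  move=> ab; apply: (derive_ge0_le ab (f := dramp e) (df := ddramp e)).
  - by move=> z _; apply: is_derive_dramp.
  - by apply: cont_itv_derive => z _; apply: is_derive_dramp.
  - by move=> z _; apply: ddramp_ge0.
have [xe|xe] := leP x (- e); first by rewrite dramp_left // lexx ler01.
have [ex|ex] := leP e x; first by rewrite dramp_right // lexx ler01.
have h1 := mono _ _ (ltW xe); have h2 := mono _ _ (ltW ex).
by rewrite (dramp_left e0 (lexx _)) in h1; rewrite (dramp_right e0 (lexx _)) in h2; rewrite h1 h2.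
Qed.

Lemma ramp_incr e a b : 0 < e -> a <= b -> 0 <= ramp e b - ramp e a <= b - a.
Proof.
move=> e0 ab; apply/andP; split.
  rewrite subr_ge0; apply: (derive_ge0_le ab (f := ramp e) (df := dramp e)).
  - by move=> z _; apply: is_derive_ramp.
  - by apply: cont_itv_derive => z _; apply: is_derive_ramp.
  - by move=> z _; have /andP[] := dramp_bound z e0.
have := derive_le_dist (K := 1) ab (f := ramp e) (df := dramp e).
rewrite mul1r => h; apply: le_trans (ler_norm _) (h _ _ _).
- by move=> z _; apply: is_derive_ramp.
- by apply: cont_itv_derive => z _; apply: is_derive_ramp.
- by move=> z _; have /andP[h1 h2] := dramp_bound z e0; rewrite ger0_norm.
Qed.

(** The margin down to -1 provides two-sided derivatives at 0, for functions that are not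
    differentiable on the whole line. *)
Lemma int01_derive (F dF : R -> R) :
  (forall x, - 1 < x -> is_derive x 1 F (dF x)) -> continuous dF ->
  int01 dF = F 1 - F 0.
Proof.
move=> D c.
have cF x : - 1 < x -> {for x, continuous F}.
  by move=> x1; apply: differentiable_continuous; apply/derivable1_diffP; have [] := D x x1.
have I1 : integ01 dF.
  apply: (eq_integ01 (f := fun x => dF x * 1)); first by move=> x _; rewrite mulr1.
  by apply: integ01_continuous_mul => //; exact: integ01_cst.
have cdF : {within `[0, 1], continuous dF} by apply: continuous_subspaceT.
have dl : derivable_oo_LRcontinuous F 0 1.
  split=> [x||].
  - by rewrite in_itv /= => /andP[x0 _]; have [] := D x (lt_trans (ltrN10 R) x0).
  - by apply: cvg_at_right_filter; apply: cF.
  - by apply: cvg_at_left_filter; apply: cF; lra.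
have d1 : {in `]0, 1[, derive1 F =1 dF}.
  move=> x; rewrite in_itv /= => /andP[x0 _]; rewrite derive1E.
  by have /@derive_val := D x (lt_trans (ltrN10 R) x0).
have H := continuous_FTC2 ltr01 cdF dl d1.
have I2 : lebesgue_measure.-integrable (`[0, 1] : set R) (EFin \o dF).
  by apply: continuous_compact_integrable => //; exact: segment_compact.
have I3 : lebesgue_measure.-integrable (`[0, 1[ : set R) (EFin \o dF).
  apply: integrableS I2 => // x /=; rewrite !in_itv /= => /andP[-> /ltW ->] //.
rewrite /int01 Rintegral_itv_obnd_cbnd // Rintegral_itv_bndo_bndc //.
by rewrite /Rintegral H.
Qed.

Lemma int01_ddramp e a : 0 < e -> e <= a -> e <= 1 - a ->
  int01 (fun x => ddramp e (x - a)) = 1.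
Proof.
move=> e0 ea e1.
have D x : is_derive x 1 (fun x => dramp e (x - a)) (ddramp e (x - a)).
  by apply: is_derive_shift; exact: is_derive_dramp.
rewrite (int01_derive (fun x _ => D x) (continuous_shift (continuous_ddramp (e := e)))).
by rewrite dramp_right // dramp_left ?subr0 //; lra.
Qed.

Lemma int01_ddramp_approx (f : R -> R) a eta : cont_itv 0 1 f -> 0 < a < 1 -> 0 < eta ->
  exists2 e0, 0 < e0 & forall e, 0 < e < e0 ->
    `|int01 (fun x => ddramp e (x - a) * f x) - f a| <= eta.
Proof.
move=> cf /andP[a0 a1] eta0.
have cfa : {for a, continuous f}.
  by apply: (within_continuous_continuous ltr01 cf); rewrite in_itv /= a0.
have /cvgrPdist_lt /(_ _ eta0) /nbhs_ballP[r /= r0 br] := cfa.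
exists (Num.min r (Num.min a (1 - a))).
  by rewrite !lt_min r0 a0 subr_gt0.
move=> e /andP[e0]; rewrite !lt_min => /andP[er /andP[ea e1]].
have [K _ bK] := cont_itv_bounded (@ler01 R) cf.
have cd : continuous (fun x => ddramp e (x - a)).
  by apply: continuous_shift; exact: continuous_ddramp.
have If : integ01 f.
  apply: (integ01_bounded (K := K)); first exact: measurable01_cont_itv.
  by move=> x /andP[x0 x1]; apply: bK; rewrite !ltW.
have I1 : integ01 (fun x => ddramp e (x - a)).
  apply: (eq_integ01 (f := fun x => ddramp e (x - a) * 1)); first by move=> x _; rewrite mulr1.
  by apply: integ01_continuous_mul => //; exact: integ01_cst.
have E : int01 (fun x => ddramp e (x - a)) = 1 by apply: int01_ddramp => //; exact: ltW.
have I2 : integ01 (fun x => ddramp e (x - a) * f x) by exact: integ01_continuous_mul.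
have I3 : integ01 (fun x => f a * ddramp e (x - a)) by exact: integ01_scale.
have E1 : int01 (fun x => ddramp e (x - a) * f x) - f a =
    int01 (fun x => ddramp e (x - a) * f x - f a * ddramp e (x - a)).
  by rewrite int01_sub // int01_scale // E mulr1.
have E2 : eta = int01 (fun x => eta * ddramp e (x - a)) by rewrite int01_scale // E mulr1.
rewrite E1 [leRHS]E2; apply: int01_le_norm; [exact: integ01_sub | exact: integ01_scale |].
move=> x xI; rewrite (_ : _ - _ = (f x - f a) * ddramp e (x - a)); last by ring.
have d0 := ddramp_ge0 (x - a) e0.
rewrite normrM (ger0_norm d0).
have [xa|xa] := ltP `|x - a| e; last by rewrite ddramp_out // !mulr0.
apply: ler_wpM2r => //; rewrite distrC; apply: ltW; apply: br.
by rewrite /ball /= distrC; apply: lt_trans xa er.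
Qed.

(* The test functions compare the difference quotients of [f] over two intervals. *)
Lemma wd2_lipschitz (f k : R -> R) : cont_itv 0 1 f -> wd2 f k ->
  exists2 L, 0 <= L & forall a b, 0 < a -> a < b -> b < 1 -> `|f b - f a| <= L * (b - a).
Proof.
move=> cf [Ik H].
pose U := int01 (fun x => `|k x|).
have U0 : 0 <= U by apply: le_trans (normr_ge0 _) (int01_le_norm Ik (integ01_norm Ik) _).
pose Q (a b : R) : R := (f b - f a) / (b - a).
(* The mean slopes over any two intervals differ by at most the L^1 norm of k; fixing one interval
   then bounds all slopes. *)
have main a b c d : 0 < a -> a < b -> b < 1 -> 0 < c -> c < d -> d < 1 ->
    `|Q a b - Q c d| <= U.
  move=> a0 ab b1 c0 cd d1.
  have b0 := lt_trans a0 ab; have d0 := lt_trans c0 cd.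
  have a1 := lt_trans ab b1; have c1 := lt_trans cd d1.
  have ba : 0 < b - a by rewrite subr_gt0.
  have dc : 0 < d - c by rewrite subr_gt0.
  apply/ler_addgt0Pr => eta eta0.
  pose et := eta / (2 * ((b - a)^-1 + (d - c)^-1)).
  have et0 : 0 < et by rewrite /et; pos.
  have aI : 0 < a < 1 by rewrite a0. have bI : 0 < b < 1 by rewrite b0.
  have cI : 0 < c < 1 by rewrite c0. have dI : 0 < d < 1 by rewrite d0.
  have [ea ea0 Ha] := int01_ddramp_approx cf aI et0.
  have [eb eb0 Hb] := int01_ddramp_approx cf bI et0.
  have [ec ec0 Hc] := int01_ddramp_approx cf cI et0.
  have [ed ed0 Hd] := int01_ddramp_approx cf dI et0.
  pose lo := Num.min a c; pose hi := Num.max b d.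
  have lo0 : 0 < lo by rewrite lt_min a0.
  have hi1 : hi < 1 by rewrite gt_max b1.
  have [la lc] : lo <= a /\ lo <= c by rewrite !ge_min !lexx orbT.
  have [hb hd] : b <= hi /\ d <= hi by rewrite !le_max !lexx orbT.
  pose m0 := Num.min (Num.min ea eb) (Num.min ec ed).
  pose m1 := Num.min (lo / 2) ((1 - hi) / 2).
  have m00 : 0 < m0 by rewrite !lt_min ea0 eb0 ec0.
  have m10 : 0 < m1 by rewrite lt_min !divr_gt0 // subr_gt0.
  pose e := Num.min m0 m1 / 2.
  have e0 : 0 < e by rewrite divr_gt0 // lt_min m00.
  have em0 : e < m0.
    by have : Num.min m0 m1 <= m0 by [rewrite ge_min lexx]; move: m00; rewrite /e; clear; lra.
  have em1 : e < m1.
    by have : Num.min m0 m1 <= m1 by [rewrite ge_min lexx orbT]; move: m10; rewrite /e; clear; lra.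
  have /andP[/andP[eea eeb] /andP[eec eed]] : ((e < ea) && (e < eb)) && ((e < ec) && (e < ed)).
    by move: em0; rewrite !lt_min.
  have /andP[elo ehi] : (e < lo / 2) && (e < (1 - hi) / 2) by move: em1; rewrite lt_min.
  (* Each of the two quotients rises from 0 to 1, so phi vanishes on both sides and |phi| <= 1. Its
     second derivative approximates Dirac masses at a, b, c, d which pair with f to Q c d - Q a
     b. *)
  pose phi (s : R) : R := (ramp e (s - a) - ramp e (s - b)) / (b - a) - (ramp e (s - c) - ramp e (s - d)) / (d - c).
  pose dphi (s : R) : R := (dramp e (s - a) - dramp e (s - b)) / (b - a) - (dramp e (s - c) - dramp e (s - d)) / (d - c).
  pose ddphi (s : R) : R := (ddramp e (s - a) - ddramp e (s - b)) / (b - a) - (ddramp e (s - c) - ddramp e (s - d)) / (d - c).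
  have Dphi (s : R) : is_derive s 1 phi (dphi s).
    have h1 := is_derive_shift (is_derive_ramp (s - a) e0).
    have h2 := is_derive_shift (is_derive_ramp (s - b) e0).
    have h3 := is_derive_shift (is_derive_ramp (s - c) e0).
    have h4 := is_derive_shift (is_derive_ramp (s - d) e0).
    by rewrite /phi; eapply is_derive_eq; [der | rewrite /dphi /=; ring].
  have Ddphi (s : R) : is_derive s 1 dphi (ddphi s).
    have h1 := is_derive_shift (is_derive_dramp (s - a) e0).
    have h2 := is_derive_shift (is_derive_dramp (s - b) e0).
    have h3 := is_derive_shift (is_derive_dramp (s - c) e0).
    have h4 := is_derive_shift (is_derive_dramp (s - d) e0).
    by rewrite /dphi; eapply is_derive_eq; [der | rewrite /ddphi /=; ring].
  have cdd (t : R) : continuous (fun s => ddramp e (s - t)).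
    by apply: continuous_shift; exact: continuous_ddramp.
  have cB (u v : R -> R) : continuous u -> continuous v -> continuous (fun x => u x - v x).
    by move=> cu cv x; apply: cvgB; [exact: cu | exact: cv].
  have cC (u : R -> R) t : continuous u -> continuous (fun x => u x / t).
    by move=> cu x; apply: cvgM; [exact: cu | exact: cvg_cst].
  have cddphi : continuous ddphi by apply: (cB); apply: cC; apply: cB; apply: cdd.
  have cdphi : continuous dphi.
    by move=> x; apply: differentiable_continuous; apply/derivable1_diffP; have [] := Ddphi x.
  have outP (x : R) : ~~ (lo - e <= x <= hi + e) -> phi x = 0 /\ dphi x = 0.
    rewrite negb_and -!ltNge => /orP[h|h].
      have [xa xb xc xd] : [/\ x - a <= - e, x - b <= - e, x - c <= - e & x - d <= - e].
        by move: h la lc ab cd; clear; split; lra.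
      by rewrite /phi /dphi !ramp_left ?dramp_left ?subrr ?mul0r ?subrr.
    have [xa xb xc xd] : [/\ e <= x - a, e <= x - b, e <= x - c & e <= x - d].
      by move: h hb hd ab cd; clear; split; lra.
    rewrite /phi /dphi !ramp_right ?dramp_right ?subrr ?mul0r ?subrr //.
    split=> //; by field; rewrite !gt_eqF.
  have [t1 e1] : test_function phi /\ derive1 phi = dphi.
    apply: (test_functionP (a := lo - e) (b := hi + e)) => //; [by move: elo lo0; clear; lra|by move: ehi hi1; clear; lra|].
    by move=> x /outP[].
  have [t2 e2] : test_function dphi /\ derive1 dphi = ddphi.
    apply: (test_functionP (a := lo - e) (b := hi + e)) => //; [by move: elo lo0; clear; lra|by move: ehi hi1; clear; lra|].
    by move=> x /outP[].
  have phi1 (x : R) : `|phi x| <= 1.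
    have /andP[r1 r2] := @ramp_incr e (x - b) (x - a) e0 (lerB (lexx x) (ltW ab)).
    have /andP[r3 r4] := @ramp_incr e (x - d) (x - c) e0 (lerB (lexx x) (ltW cd)).
    have q1 : 0 <= (ramp e (x - a) - ramp e (x - b)) / (b - a) <= 1.
      apply/andP; split; first exact: (divr_ge0 r1 (ltW ba)).
      by rewrite ler_pdivrMr // mul1r; apply: le_trans r2 _; rewrite le_eqVlt; apply/orP; left; apply/eqP; ring.
    have q2 : 0 <= (ramp e (x - c) - ramp e (x - d)) / (d - c) <= 1.
      apply/andP; split; first exact: (divr_ge0 r3 (ltW dc)).
      by rewrite ler_pdivrMr // mul1r; apply: le_trans r4 _; rewrite le_eqVlt; apply/orP; left; apply/eqP; ring.
    by move: q1 q2; rewrite /phi ler_norml; clear => /andP[? ?] /andP[? ?]; apply/andP; split; lra.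
  have H1 := H phi t1 _; rewrite e1 in H1; have {}H1 := H1 t2; rewrite e2 in H1.
  have bnd : `|int01 (fun x => ddphi x * f x)| <= U.
    rewrite H1; have := @int01_continuous_mul_le _ phi k 1 _ Ik (fun x _ => phi1 x).
    rewrite mul1r; apply; exact: test_continuous.
  have [K _ bK] := cont_itv_bounded (@ler01 R) cf.
  have If : integ01 f.
    apply: (integ01_bounded (K := K)); first exact: measurable01_cont_itv.
    by move=> x /andP[x0 x1]; apply: bK; rewrite !ltW.
  pose A (t : R) : R := int01 (fun x => ddramp e (x - t) * f x).
  have IA (t : R) : integ01 (fun x => ddramp e (x - t) * f x) by exact: integ01_continuous_mul.
  have AE : int01 (fun x => ddphi x * f x) = (A a - A b) / (b - a) - (A c - A d) / (d - c).
    have S1 (t t' w : R) : int01 (fun x => w * (ddramp e (x - t) * f x - ddramp e (x - t') * f x)) = w * (A t - A t').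
      by rewrite int01_scale ?int01_sub //; exact: integ01_sub.
    rewrite [_ / (b - a)]mulrC [_ / (d - c)]mulrC -!S1 -int01_sub; last 2 first.
    - by apply: integ01_scale; exact: integ01_sub.
    - by apply: integ01_scale; exact: integ01_sub.
    - by apply: eq_int01 => x _; rewrite /ddphi; ring.
  have hA : `|A a - f a| <= et by apply: Ha; rewrite e0.
  have hB : `|A b - f b| <= et by apply: Hb; rewrite e0.
  have hC : `|A c - f c| <= et by apply: Hc; rewrite e0.
  have hD : `|A d - f d| <= et by apply: Hd; rewrite e0.
  have -> : Q a b - Q c d = - int01 (fun x => ddphi x * f x) +
      (((A a - f a) - (A b - f b)) / (b - a) - ((A c - f c) - (A d - f d)) / (d - c)).
    by rewrite AE /Q; field; rewrite !gt_eqF.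
  apply: le_trans (ler_normD _ _) _; rewrite normrN; apply: lerD => //.
  apply: le_trans (ler_normB _ _) _; rewrite !normrM !normfV (gtr0_norm ba) (gtr0_norm dc).
  apply: le_trans (_ : (et + et) / (b - a) + (et + et) / (d - c) <= _).
    apply: lerD; apply: ler_wpM2r; rewrite ?invr_ge0 ?(ltW ba) ?(ltW dc) //;
      by apply: le_trans (ler_normB _ _) _; apply: lerD.
  rewrite -subr_ge0 (_ : _ - _ = 0) // /et; field.
  by move: ba dc; clear => ? ?; rewrite !gt_eqF //; lra.
pose L := U + `|Q 3^-1 (2 / 3)|.
exists L => [|a b a0 ab b1]; first by rewrite /L; pos.
have ba : 0 < b - a by rewrite subr_gt0.
have := main a b 3^-1 (2 / 3) a0 ab b1 _ _ _.
move=> /(_ ltac:(lra) ltac:(lra) ltac:(lra)) h.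
have -> : f b - f a = Q a b * (b - a) by rewrite /Q divfK // gt_eqF.
rewrite normrM (gtr0_norm ba); apply: ler_wpM2r; first exact: ltW.
rewrite (_ : Q a b = (Q a b - Q 3^-1 (2 / 3)) + Q 3^-1 (2 / 3)); last by ring.
by apply: le_trans (ler_normD _ _) _; rewrite /L lerD2r.
Qed.

(** The Lipschitz bound holds in the open interval; by continuity one of the points may tend to 0 or
    to 1, where f vanishes. *)
Lemma wd2_linear_bound (f k : R -> R) : cont_itv 0 1 f -> wd2 f k -> f 0 = 0 -> f 1 = 0 ->
  exists2 L, 0 <= L & forall x, 0 <= x <= 1 -> `|f x| <= L * x /\ `|f x| <= L * (1 - x).
Proof.
move=> cf hf f0 f1; have [L L0 HL] := wd2_lipschitz cf hf.
exists L => // x /andP[x0 x1].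
have [->|xn0] := eqVneq x 0; first by rewrite f0 normr0 mulr0 subr0 mulr1.
have [->|xn1] := eqVneq x 1; first by rewrite f1 normr0 subrr mulr0 mulr1.
have xp : 0 < x by rewrite lt_neqAle eq_sym xn0.
have xq : x < 1 by rewrite lt_neqAle xn1.
have [_ c0 c1] := (continuous_within_itvP f ltr01).1 cf.
split; apply/ler_addgt0Pr => eta eta0.
  have /cvgrPdist_le /(_ _ eta0) H := c0.
  have [a [a0 ax ha]] : exists a, [/\ 0 < a, a < x & `|f 0 - f a| <= eta].
    near (0 : R)^'+ => a; exists a; split; [near: a; exact: nbhs_right_gt|near: a; exact: nbhs_right_lt|near: a; exact: H].
  rewrite (_ : f x = (f x - f a) + (f a - f 0)); last by rewrite f0; ring.
  apply: le_trans (ler_normD _ _) _; apply: lerD; last by rewrite distrC.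
  by apply: le_trans (HL _ _ a0 ax xq) _; apply: ler_wpM2l => //; lra.
have /cvgrPdist_le /(_ _ eta0) H := c1.
have [b [b0 bx hb]] : exists b, [/\ x < b, b < 1 & `|f 1 - f b| <= eta].
  near (1 : R)^'- => b; exists b; split; [near: b; exact: nbhs_left_gt|near: b; exact: nbhs_left_lt|near: b; exact: H].
rewrite -normrN (_ : - f x = (f b - f x) + (f 1 - f b)); last by rewrite f1; ring.
apply: le_trans (ler_normD _ _) _; apply: lerD => //.
by apply: le_trans (HL _ _ xp b0 bx) _; apply: ler_wpM2l => //; lra.
Unshelve. all: by end_near. Qed.


End Splines.

(** * Orthogonality to a singular solution *)

Section Step.
Context {R : realType}.
Implicit Types (x : R).

(* The third difference of x_+^n / n!: a C^2 step from 0 to 1 on [0,3] when n = 3. *)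
Definition step x : R :=
  (posp 3 x - 3 * posp 3 (x - 1) + 3 * posp 3 (x - 2) - posp 3 (x - 3)) / 6.
Definition dstep x : R :=
  (posp 2 x - 3 * posp 2 (x - 1) + 3 * posp 2 (x - 2) - posp 2 (x - 3)) / 2.
Definition ddstep x : R :=
  posp 1 x - 3 * posp 1 (x - 1) + 3 * posp 1 (x - 2) - posp 1 (x - 3).

Lemma is_derive_step x : is_derive x 1 step (dstep x).
Proof.
have h0 := is_derive_posp3 x.
have h1 := is_derive_shift (is_derive_posp3 (x - 1)).
have h2 := is_derive_shift (is_derive_posp3 (x - 2)).
have h3 := is_derive_shift (is_derive_posp3 (x - 3)).
by rewrite /step; eapply is_derive_eq; [der | rewrite /dstep /=; field].
Qed.

Lemma is_derive_dstep x : is_derive x 1 dstep (ddstep x).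
Proof.
have h0 := is_derive_posp2 x.
have h1 := is_derive_shift (is_derive_posp2 (x - 1)).
have h2 := is_derive_shift (is_derive_posp2 (x - 2)).
have h3 := is_derive_shift (is_derive_posp2 (x - 3)).
by rewrite /dstep; eapply is_derive_eq; [der | rewrite /ddstep /=; field].
Qed.

Lemma continuous_ddstep : continuous ddstep.
Proof.
have c := @continuous_posp1 R; have s := fun a => @continuous_shift R (posp 1) a c.
move=> x; apply: cvgB; last exact: s.
apply: cvgD; last by apply: cvgM; [exact: cvg_cst | exact: s].
by apply: cvgB; [exact: c | apply: cvgM; [exact: cvg_cst | exact: s]].
Qed.

Lemma step_left x : x <= 0 -> [/\ step x = 0, dstep x = 0 & ddstep x = 0].
Proof.
move=> x0; have x1 : x - 1 <= 0 by lra.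
have x2 : x - 2 <= 0 by lra. have x3 : x - 3 <= 0 by lra.
rewrite /step /dstep /ddstep !(posp_le0 _ x0) !(posp_le0 _ x1) !(posp_le0 _ x2) !(posp_le0 _ x3).
by split; ring.
Qed.

Lemma step_right x : 3 <= x -> [/\ step x = 1, dstep x = 0 & ddstep x = 0].
Proof.
move=> x3; have x0 : 0 <= x by lra. have x1 : 0 <= x - 1 by lra.
have x2 : 0 <= x - 2 by lra. have x3' : 0 <= x - 3 by lra.
rewrite /step /dstep /ddstep !(posp_ge0E _ x0) !(posp_ge0E _ x1) !(posp_ge0E _ x2) !(posp_ge0E _ x3').
by split; field.
Qed.

(** Crude: where the step varies the truncated powers are at most 3^n, and the coefficients 1, 3, 3,
    1 sum to 8; thus 27 * 8 / 6 = 9 * 8 / 2 = 36. *)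
Lemma step_bound x : [/\ `|step x| <= 36, `|dstep x| <= 36 & `|ddstep x| <= 36].
Proof.
have [x0|x0] := leP x 0.
  by have [-> -> ->] := step_left x0; rewrite normr0.
have [x3|x3] := leP 3 x.
  by have [-> -> ->] := step_right x3; rewrite normr0 normr1; split=> //; rewrite ler1n.
have b n t : t <= x -> 0 <= posp n t <= 3 ^+ n.
  move=> tx; rewrite /posp exprn_ge0 ?le_max ?lexx //=; apply: lerXn2r; rewrite ?nnegrE ?le_max ?lexx //.
  by rewrite ge_max; apply/andP; split=> //; lra.
have ? := b 1%N x (lexx x); have ? := b 1%N (x - 1) (ltac:(lra)).
have ? := b 1%N (x - 2) (ltac:(lra)); have ? := b 1%N (x - 3) (ltac:(lra)).
have ? := b 2%N x (lexx x); have ? := b 2%N (x - 1) (ltac:(lra)).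
have ? := b 2%N (x - 2) (ltac:(lra)); have ? := b 2%N (x - 3) (ltac:(lra)).
have ? := b 3%N x (lexx x); have ? := b 3%N (x - 1) (ltac:(lra)).
have ? := b 3%N (x - 2) (ltac:(lra)); have ? := b 3%N (x - 3) (ltac:(lra)).
by rewrite /step /dstep /ddstep; split; rewrite ler_norml; apply/andP; split; lra.
Qed.

End Step.

Section Extension.
Context {R : realType}.

(** The singular solution is controlled on (0,1) only. After a cutoff, extension by 0 yields
    functions that are C^2 on the whole line, as test functions must be defined there. *)
Definition ext01 (h : R -> R) (x : R) : R := if 0 < x < 1 then h x else 0.

Lemma ext01_near (h : R -> R) (x : R) : 0 < x < 1 -> \forall y \near x, ext01 h y = h y.
Proof.
move=> xI; have /open_nbhs_nbhs : open_nbhs x `]0 : R, 1[%classic.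
  by split; [exact: interval_open | rewrite /= in_itv].
by apply: filterS => y; rewrite /= in_itv /= /ext01 => ->.
Qed.

Lemma ext01_near0 (h : R -> R) (a b x : R) : 0 < a -> b < 1 ->
  (forall y, 0 < y < 1 -> ~~ (a <= y <= b) -> h y = 0) -> ~~ (0 < x < 1) ->
  \forall y \near x, ext01 h y = 0.
Proof.
move=> a0 b1 z xn.
have : open_nbhs x (~` `[a, b]%classic).
  split; first by apply: closed_openC; exact: interval_closed.
  rewrite /= in_itv /= => /andP[ax xb]; move: xn; rewrite (lt_le_trans a0 ax) (le_lt_trans xb b1) //.
move=> /open_nbhs_nbhs; apply: filterS => y /=; rewrite in_itv /= => /negP yn.
by rewrite /ext01; case: ifPn => // yI; apply: z.
Qed.

(** The support stays in [a, b], so a point outside (0,1) has a neighbourhood on which the extension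
    vanishes. *)
Lemma is_derive_ext01 (h dh : R -> R) (a b : R) : 0 < a -> b < 1 ->
  (forall x : R, 0 < x < 1 -> is_derive x 1 h (dh x)) ->
  (forall y, 0 < y < 1 -> ~~ (a <= y <= b) -> h y = 0) ->
  forall x : R, is_derive x 1 (ext01 h) (ext01 dh x).
Proof.
move=> a0 b1 D z x; rewrite {2}/ext01; case: ifPn => xI.
  have n : \forall y \near x, h y = ext01 h y.
    by have := ext01_near h xI; apply: filterS => y ->.
  exact: near_eq_is_derive n (D _ xI).
have n : \forall y \near x, (cst 0 : R -> R) y = ext01 h y.
  by have := ext01_near0 a0 b1 z xI; apply: filterS => y ->.
apply: near_eq_is_derive n _; exact: is_derive_cst.
Qed.

Lemma continuous_ext01 (h : R -> R) (a b : R) : 0 < a -> b < 1 ->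
  (forall x : R, 0 < x < 1 -> {for x, continuous h}) ->
  (forall y, 0 < y < 1 -> ~~ (a <= y <= b) -> h y = 0) -> continuous (ext01 h).
Proof.
move=> a0 b1 c z x; rewrite /continuous_at {2}/ext01; case: ifPn => xI.
  apply: cvg_trans (c _ xI); apply: near_eq_cvg.
  by have := ext01_near h xI; apply: filterS => y ->.
apply: cvg_trans (@cvg_cst _ (0 : R) _ (nbhs x) _); apply: near_eq_cvg.
by have := ext01_near0 a0 b1 z xI; apply: filterS => y ->.
Qed.

End Extension.

(** * A cutoff near both end points *)

Section Cutoff.
Context {R : realType}.
Variables (d : R).
Hypotheses (d0 : 0 < d) (d14 : d <= 4^-1).

(** With this slope [A] rises from 0 at d / 4 to 1 at d, so the transition keeps a distance
    comparable to d from the end point; [B] is its mirror image under x -> 1 - x. *)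
Let c := 4 / d.
Let A (x : R) := step (c * x + - 1).
Let dA (x : R) := c * dstep (c * x + - 1).
Let ddA (x : R) := c ^+ 2 * ddstep (c * x + - 1).
Let B (x : R) := step ((c - 1) - c * x).
Let dB (x : R) := - c * dstep ((c - 1) - c * x).
Let ddB (x : R) := c ^+ 2 * ddstep ((c - 1) - c * x).

Definition cutoff (x : R) : R := A x * B x.
Definition dcutoff (x : R) : R := dA x * B x + A x * dB x.
Definition ddcutoff (x : R) : R := ddA x * B x + 2 * (dA x * dB x) + A x * ddB x.

Let c0 : 0 < c. Proof. by rewrite /c divr_gt0. Qed.

Let DA (x : R) : is_derive x 1 A (dA x) /\ is_derive x 1 dA (ddA x).
Proof.
have h : is_derive x 1 (fun y => c * y + - 1) c.
  by eapply is_derive_eq; [der | rewrite /=; ring].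
have h1 := is_derive_chain (f := step) (g := fun y => c * y + - 1) (is_derive_step _) h.
have h2 := is_derive_chain (f := dstep) (g := fun y => c * y + - 1) (is_derive_dstep _) h.
split; first by apply: is_derive_eq h1 _; rewrite /dA mulrC.
by rewrite /dA; eapply is_derive_eq; [der | rewrite /ddA /=; ring].
Qed.

Let DB (x : R) : is_derive x 1 B (dB x) /\ is_derive x 1 dB (ddB x).
Proof.
have h : is_derive x 1 (fun y => (c - 1) - c * y) (- c).
  by eapply is_derive_eq; [der | rewrite /=; ring].
have h1 := is_derive_chain (f := step) (g := fun y => (c - 1) - c * y) (is_derive_step _) h.
have h2 := is_derive_chain (f := dstep) (g := fun y => (c - 1) - c * y) (is_derive_dstep _) h.
split; first by apply: is_derive_eq h1 _; rewrite /dB mulrC.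
by rewrite /dB; eapply is_derive_eq; [der | rewrite /ddB /=; ring].
Qed.

Lemma is_derive_cutoff (x : R) : is_derive x 1 cutoff (dcutoff x).
Proof.
have [h1 h2] := DA x; have [h3 h4] := DB x.
by rewrite /cutoff; eapply is_derive_eq; [der | rewrite /dcutoff /=; ring].
Qed.

Lemma is_derive_dcutoff (x : R) : is_derive x 1 dcutoff (ddcutoff x).
Proof.
have [h1 h2] := DA x; have [h3 h4] := DB x.
by rewrite /dcutoff; eapply is_derive_eq; [der | rewrite /ddcutoff /=; ring].
Qed.

Lemma continuous_ddcutoff : continuous ddcutoff.
Proof.
have cd (f df : R -> R) : (forall x : R, is_derive x 1 f (df x)) -> continuous f.
  by move=> D x; apply: differentiable_continuous; apply/derivable1_diffP; have [] := D x.
have cA := cd _ _ (fun x => (DA x).1); have cdA := cd _ _ (fun x => (DA x).2).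
have cB := cd _ _ (fun x => (DB x).1); have cdB := cd _ _ (fun x => (DB x).2).
have cc (u v : R) : continuous (fun x : R => ddstep (u * x + v)).
  move=> x; apply: (continuous_comp (f := fun x => u * x + v) (g := ddstep)); last exact: continuous_ddstep.
  by apply: cvgD; [apply: cvgM; [exact: cvg_cst | exact: cvg_id] | exact: cvg_cst].
have cddA : continuous ddA by move=> x; apply: cvgM; [exact: cvg_cst | exact: cc].
have cddB : continuous ddB.
  rewrite /ddB (_ : (fun x => _) = fun x => c ^+ 2 * ddstep (- c * x + (c - 1))).
    by move=> x; apply: cvgM; [exact: cvg_cst | exact: cc].
  by apply/funext => x; congr (_ * ddstep _); ring.
move=> x; apply: cvgD; last by apply: cvgM; [exact: cA | exact: cddB].
apply: cvgD; first by apply: cvgM; [exact: cddA | exact: cB].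
by apply: cvgM; [exact: cvg_cst | apply: cvgM; [exact: cdA | exact: cdB]].
Qed.

Let cd : c * d = 4. Proof. by rewrite /c divfK // gt_eqF. Qed.
Let c16 : 16 <= c. Proof. by rewrite /c ler_pdivlMr //; have := d14; lra. Qed.

Lemma cutoff_out (x : R) : ~~ (d / 4 <= x <= 1 - d / 4) ->
  [/\ cutoff x = 0, dcutoff x = 0 & ddcutoff x = 0].
Proof.
rewrite negb_and -!ltNge /cutoff /dcutoff /ddcutoff => /orP[h|h].
  have [a1 a2 a3] : [/\ A x = 0, dA x = 0 & ddA x = 0].
    have /step_left[h1 h2 h3] : c * x + - 1 <= 0.
      by have := ler_wpM2l (ltW c0) (ltW h); have := cd; lra.
    by rewrite /A /dA /ddA h1 h2 h3 !mulr0.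
  by rewrite a1 a2 a3; split; ring.
have [a1 a2 a3] : [/\ B x = 0, dB x = 0 & ddB x = 0].
  have /step_left[h1 h2 h3] : (c - 1) - c * x <= 0.
    by have := ler_wpM2l (ltW c0) (ltW h); have := cd; lra.
  by rewrite /B /dB /ddB h1 h2 h3 !mulr0.
by rewrite a1 a2 a3; split; ring.
Qed.

Lemma cutoff_in (x : R) : d <= x <= 1 - d ->
  [/\ cutoff x = 1, dcutoff x = 0 & ddcutoff x = 0].
Proof.
move=> /andP[dx xd]; rewrite /cutoff /dcutoff /ddcutoff.
have [a1 a2 a3] : [/\ A x = 1, dA x = 0 & ddA x = 0].
  have /step_right[h1 h2 h3] : 3 <= c * x + - 1.
    by have := ler_wpM2l (ltW c0) dx; have := cd; lra.
  by rewrite /A /dA /ddA h1 h2 h3 !mulr0.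
have [b1 b2 b3] : [/\ B x = 1, dB x = 0 & ddB x = 0].
  have /step_right[h1 h2 h3] : 3 <= (c - 1) - c * x.
    by have := ler_wpM2l (ltW c0) xd; have := cd; lra.
  by rewrite /B /dB /ddB h1 h2 h3 !mulr0.
by rewrite a1 a2 a3 b1 b2 b3; split; ring.
Qed.

Lemma cutoff_bound (x : R) : [/\ `|cutoff x| <= 64 * (36 * 36),
  `|dcutoff x| <= 64 * (36 * 36) / d & `|ddcutoff x| <= 64 * (36 * 36) / d ^+ 2].
Proof.
have [a1 a2 a3] := step_bound (c * x + - 1).
have [b1 b2 b3] := step_bound ((c - 1) - c * x).
rewrite /cutoff /dcutoff /ddcutoff /A /dA /ddA /B /dB /ddB.
set a := step _ in a1 *; set a' := dstep _ in a2 *; set a'' := ddstep _ in a3 *.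
set b := step _ in b1 *; set b' := dstep _ in b2 *; set b'' := ddstep _ in b3 *.
have N0 : 0 <= 36 * 36 :> R by pos.
have m (u v : R) : `|u| <= 36 -> `|v| <= 36 -> `|u * v| <= 36 * 36.
  by move=> hu hv; rewrite normrM; exact: ler_pM.
move: (36 * 36) N0 m => N N0 m.
have m1 := m _ _ a1 b1; have m2 := m _ _ a1 b2; have m3 := m _ _ a1 b3.
have m4 := m _ _ a2 b1; have m5 := m _ _ a2 b2; have m6 := m _ _ a3 b1.
split.
- by apply: le_trans m1 _; lra.
- rewrite (_ : _ + _ = c * (a' * b - a * b')); last by ring.
  rewrite normrM (gtr0_norm c0) (_ : 64 * N / d = c * (16 * N)); last by rewrite /c; field; rewrite gt_eqF.
  by apply: ler_wpM2l; [exact: ltW | apply: le_trans (ler_normB _ _) _; lra].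
- rewrite (_ : _ + _ + _ = c ^+ 2 * (a'' * b - 2 * (a' * b') + a * b'')); last by ring.
  rewrite normrM (ger0_norm (sqr_ge0 _)) (_ : 64 * N / d ^+ 2 = c ^+ 2 * (4 * N)); last by rewrite /c; field; rewrite gt_eqF.
  apply: ler_wpM2l; first by pos.
  apply: le_trans (ler_normD _ _) _; apply: le_trans (lerD (ler_normB _ _) (lexx _)) _.
  by rewrite [`|2 * _|]normrM ger0_norm //; lra.
Qed.

End Cutoff.

Lemma cutoff_bound_ex (R : realType) : exists2 N : R, 0 <= N & forall d x, 0 < d ->
  [/\ `|cutoff d x| <= N, `|dcutoff d x| <= N / d & `|ddcutoff d x| <= N / d ^+ 2].
Proof. by exists (64 * (36 * 36)) => [|d x d0]; [pos | exact: cutoff_bound]. Qed.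

(** * Integration by parts against a singular solution *)

Section Orthogonality.
Context {R : realType}.
Variables (N : R).
Hypothesis N0 : 0 <= N.
Hypothesis cutoffN : forall (d x : R), 0 < d ->
  [/\ `|cutoff d x| <= N, `|dcutoff d x| <= N / d & `|ddcutoff d x| <= N / d ^+ 2].
Variables (V dV ddV f k : R -> R) (m2 Cv L Cg : R).
Hypotheses (Cv0 : 0 <= Cv) (L0 : 0 <= L) (Cg0 : 0 <= Cg).
Hypothesis DV : forall x : R, 0 < x < 1 -> is_derive x 1 V (dV x).
Hypothesis DdV : forall x : R, 0 < x < 1 -> is_derive x 1 dV (ddV x).
Hypothesis cddV : forall x : R, 0 < x < 1 -> {for x, continuous ddV}.
Hypothesis bV : forall x : R, 0 < x < 1 -> `|V x| <= Cv * Num.sqrt x /\ `|V x| <= Cv * Num.sqrt (1 - x).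
Hypothesis bdV : forall x : R, 0 < x < 1 ->
  (x <= 2^-1 -> `|dV x| * Num.sqrt x <= Cv) /\ (2^-1 <= x -> `|dV x| * Num.sqrt (1 - x) <= Cv).
Hypothesis cf : cont_itv 0 1 f.
Hypothesis bf : forall x : R, 0 <= x <= 1 -> `|f x| <= L * x /\ `|f x| <= L * (1 - x).
Hypothesis bg : forall x : R, 0 < x < 1 ->
  `|(ddV x - m2 * V x) * f x| * (Num.sqrt x * Num.sqrt (1 - x)) <= Cg.
Hypothesis hw : wd2 f k.
Hypothesis orth : int01 (fun x => V x * (k x - m2 * f x)) = 0.

Let g (x : R) := (ddV x - m2 * V x) * f x.

Section FixedDelta.
Variables (d : R).
Hypotheses (d0 : 0 < d) (d14 : d <= 4^-1).

Let chi := cutoff d.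
Let dchi := dcutoff d.
Let ddchi := ddcutoff d.
Let h (x : R) := (ddchi x * V x + 2 * dchi x * dV x) * f x.

Let sd := Num.sqrt d.
Let sd0 : 0 < sd. Proof. by rewrite sqrtr_gt0. Qed.
Let sd2 : sd ^+ 2 = d. Proof. by rewrite sqr_sqrtr // ltW. Qed.

(* Either endpoint: y is the distance of x to it. *)
Lemma cutoff_error_le (x y u v w : R) : d / 4 <= y <= d -> `|u| <= Cv * Num.sqrt y ->
  `|v| * Num.sqrt y <= Cv -> `|w| <= L * y ->
  `|(ddchi x * u + 2 * dchi x * v) * w| <= 5 * N * Cv * L / sd.
Proof.
move=> /andP[dy yd] hu hv hw'.
have [_ h1 h2] := cutoffN x d0.
have sy : Num.sqrt y <= sd by apply: ler_wsqrtr.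
have sy2 : sd / 2 <= Num.sqrt y.
  rewrite (_ : sd / 2 = Num.sqrt (d / 4)); first exact: ler_wsqrtr.
  rewrite sqrtrM ?(ltW d0) // -/sd (_ : 4^-1 = (2^-1) ^+ 2 :> R); last by field.
  by rewrite sqrtr_sqr ger0_norm.
have hu' : `|u| <= Cv * sd by apply: le_trans hu _; apply: ler_wpM2l.
have hv' : `|v| <= 2 * Cv / sd.
  rewrite ler_pdivlMr //.
  have : `|v| * (sd / 2) <= Cv by apply: le_trans hv; apply: ler_wpM2l.
  lra.
have hw'' : `|w| <= L * d by apply: le_trans hw' _; apply: ler_wpM2l.
rewrite normrM.
have Np := N0.
have s1 : `|ddchi x * u + 2 * dchi x * v| <= 5 * N * Cv / (d * sd) .
  apply: le_trans (ler_normD _ _) _.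
  have e1 : `|ddchi x * u| <= N / d ^+ 2 * (Cv * sd) by rewrite normrM; apply: ler_pM.
  have e2 : `|2 * dchi x * v| <= 2 * (N / d) * (2 * Cv / sd).
    rewrite normrM; apply: ler_pM => //; rewrite normrM ger0_norm //.
    by apply: ler_wpM2l.
  apply: le_trans (lerD e1 e2) _.
  rewrite -sd2 -subr_ge0 (_ : _ - _ = 0) //.
  by field; rewrite gt_eqF.
apply: le_trans (_ : 5 * N * Cv / (d * sd) * (L * d) <= _); first exact: ler_pM.
rewrite (_ : _ * (L * d) = 5 * N * Cv * L / sd) //.
by field; rewrite !gt_eqF.
Qed.

(** A continuous majorant of the indicator of the two layers of width d, with integral exactly 3
    d. *)
Let iota (x : R) : R := (1 - dramp (d / 2) (x - 3 * d / 2)) + dramp (d / 2) (x - (1 - 3 * d / 2)).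

Let iota_ge0 (x : R) : 0 <= iota x.
Proof.
have d2 : 0 < d / 2 by rewrite divr_gt0.
have /andP[? ?] := dramp_bound (x - 3 * d / 2) d2.
have /andP[? ?] := dramp_bound (x - (1 - 3 * d / 2)) d2.
by rewrite /iota; lra.
Qed.

Let iota_ge1 (x : R) : x <= d \/ 1 - d <= x -> 1 <= iota x.
Proof.
have d2 : 0 < d / 2 by rewrite divr_gt0.
have /andP[? ?] := dramp_bound (x - 3 * d / 2) d2.
have /andP[? ?] := dramp_bound (x - (1 - 3 * d / 2)) d2.
have ? := d0.
move=> [xd|xd]; rewrite /iota.
  by rewrite (@dramp_left _ _ (x - 3 * d / 2) d2); lra.
by rewrite (@dramp_right _ _ (x - (1 - 3 * d / 2)) d2); lra.
Qed.

Let cont_dramp (t : R) : continuous (fun x : R => dramp (d / 2) (x - t)).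
Proof.
apply: continuous_shift => x; apply: differentiable_continuous; apply/derivable1_diffP.
by have [] := @is_derive_dramp R (d / 2) x (divr_gt0 d0 (ltr0n _ 2)).
Qed.

Let integ_dramp (t : R) : integ01 (fun x : R => dramp (d / 2) (x - t)).
Proof.
apply: (eq_integ01 (f := fun x => dramp (d / 2) (x - t) * 1)); first by move=> x _; rewrite mulr1.
by apply: integ01_continuous_mul => //; exact: integ01_cst.
Qed.

Let integ_iota : integ01 iota.
Proof. by apply: integ01_add => //; apply: integ01_sub => //; exact: integ01_cst. Qed.

Let int_iota : int01 iota = 3 * d.
Proof.
have d2 : 0 < d / 2 by rewrite divr_gt0.
have E t : int01 (fun x : R => dramp (d / 2) (x - t)) = ramp (d / 2) (1 - t) - ramp (d / 2) (0 - t).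
  apply: (int01_derive (F := fun x : R => ramp (d / 2) (x - t))); last exact: cont_dramp.
  by move=> x _; apply: is_derive_shift; exact: is_derive_ramp.
rewrite int01_add //; last by apply: integ01_sub => //; exact: integ01_cst.
rewrite int01_sub //; last exact: integ01_cst.
rewrite int01_cst !E; have ? := d14; have ? := d0.
rewrite (@ramp_right _ _ (1 - 3 * d / 2)) //; last by lra.
rewrite (@ramp_left _ _ (0 - 3 * d / 2)) //; last by lra.
rewrite (@ramp_right _ _ (1 - (1 - 3 * d / 2))) //; last by lra.
by rewrite (@ramp_left _ _ (0 - (1 - 3 * d / 2))) //; lra.
Qed.

Lemma h_le (x : R) : 0 < x < 1 -> `|h x| <= 5 * N * Cv * L / sd * iota x.
Proof.
move=> xI; have /andP[x0 x1] := xI.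
have P0 : 0 <= 5 * N * Cv * L / sd by have := N0; have := sd0; have := Cv0; have := L0 => *; pos.
have [v1 v2] := bV xI; have [w1 w2] := bdV xI.
have x01 : 0 <= x <= 1 by rewrite !ltW.
have [f1 f2] := bf x01.
have zero : dchi x = 0 -> ddchi x = 0 -> `|h x| <= 5 * N * Cv * L / sd * iota x.
  move=> e1 e2; rewrite /h e1 e2 !(mul0r, mulr0, addr0) normr0.
  by apply: mulr_ge0.
have [mid|] := boolP (d / 4 <= x <= 1 - d / 4); last by move=> /(cutoff_out d0)[_]; exact: zero.
have [inn|] := boolP (d <= x <= 1 - d); first by have [_] := cutoff_in d0 inn; exact: zero.
move: mid => /andP[le1 le2]; rewrite negb_and -!ltNge => /orP[xd|xd].
  apply: le_trans (_ : 5 * N * Cv * L / sd * 1 <= _).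
    rewrite mulr1; apply: (@cutoff_error_le x x (V x) (dV x) (f x)) => //; first by rewrite le1 ltW.
    by apply: w1; move: xd => /ltW /le_trans -> //; apply: le_trans d14 _; lra.
  by apply: ler_wpM2l => //; apply: iota_ge1; left; exact: ltW.
apply: le_trans (_ : 5 * N * Cv * L / sd * 1 <= _).
  rewrite mulr1; apply: (@cutoff_error_le x (1 - x) (V x) (dV x) (f x)) => //; first by apply/andP; split; lra.
  by apply: w2; have := d14; lra.
by apply: ler_wpM2l => //; apply: iota_ge1; right; exact: ltW.
Qed.

Let cV (x : R) : 0 < x < 1 -> {for x, continuous V}.
Proof. by move=> xI; apply: differentiable_continuous; apply/derivable1_diffP; have [] := DV xI. Qed.

Let cdV (x : R) : 0 < x < 1 -> {for x, continuous dV}.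
Proof. by move=> xI; apply: differentiable_continuous; apply/derivable1_diffP; have [] := DdV xI. Qed.

Let cf' (x : R) : 0 < x < 1 -> {for x, continuous f}.
Proof. by move=> xI; apply: (within_continuous_continuous ltr01 cf); rewrite in_itv. Qed.

Let cchi : continuous chi.
Proof.
move=> x; apply: differentiable_continuous; apply/derivable1_diffP.
by have [] := is_derive_cutoff d x.
Qed.

Let cdchi : continuous dchi.
Proof.
move=> x; apply: differentiable_continuous; apply/derivable1_diffP.
by have [] := is_derive_dcutoff d x.
Qed.

Let cddchi : continuous ddchi. Proof. exact: continuous_ddcutoff. Qed.

Let meas (u : R -> R) : (forall x : R, 0 < x < 1 -> {for x, continuous u}) ->
  measurable_fun (`]0, 1[ : set R) u.
Proof.
move=> cu; apply: open_continuous_measurable_fun; first exact: interval_open.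
by move=> x; rewrite inE /= in_itv /= => /cu.
Qed.

Let If : integ01 f.
Proof.
have [K _ bK] := cont_itv_bounded (@ler01 R) cf.
apply: (integ01_bounded (K := K)); first exact: measurable01_cont_itv.
by move=> x /andP[x0 x1]; apply: bK; rewrite !ltW.
Qed.

Let Ik : integ01 k. Proof. by have [] := hw. Qed.
Let Iu : integ01 (fun x => k x - m2 * f x).
Proof. by apply: integ01_sub => //; exact: integ01_scale. Qed.
Let U := int01 (fun x => `|k x - m2 * f x|).
Let U0 : 0 <= U. Proof. by apply: le_trans (normr_ge0 _) (int01_le_norm Iu (integ01_norm Iu) _). Qed.

Let phi := ext01 (fun x => chi x * V x).
Let dphi := ext01 (fun x => dchi x * V x + chi x * dV x).
Let ddphi := ext01 (fun x => ddchi x * V x + 2 * dchi x * dV x + chi x * ddV x).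

Let d40 : 0 < d / 4. Proof. by rewrite divr_gt0. Qed.
Let d41 : 1 - d / 4 < 1. Proof. by rewrite ltrBlDr ltrDl. Qed.

Lemma cutoff_test : [/\ test_function phi, test_function (derive1 phi) &
  derive1 (derive1 phi) = ddphi].
Proof.
have z1 (y : R) : 0 < y < 1 -> ~~ (d / 4 <= y <= 1 - d / 4) -> chi y * V y = 0.
  by move=> _ /(cutoff_out d0)[e _ _]; rewrite /chi e mul0r.
have z2 (y : R) : 0 < y < 1 -> ~~ (d / 4 <= y <= 1 - d / 4) -> dchi y * V y + chi y * dV y = 0.
  by move=> _ /(cutoff_out d0)[e1 e2 _]; rewrite /chi /dchi e1 e2 !mul0r addr0.
have z3 (y : R) : 0 < y < 1 -> ~~ (d / 4 <= y <= 1 - d / 4) ->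
    ddchi y * V y + 2 * dchi y * dV y + chi y * ddV y = 0.
  by move=> _ /(cutoff_out d0)[e1 e2 e3]; rewrite /chi /dchi /ddchi e1 e2 e3 mulr0 !mul0r !addr0.
have D1 : forall x : R, is_derive x 1 phi (dphi x).
  apply: (is_derive_ext01 d40 d41); [move=> x xI|exact: z1].
  have h1 := DV xI; have h2 : is_derive x 1 chi (dchi x) := is_derive_cutoff d x.
  by eapply is_derive_eq; [der | rewrite /=; ring].
have D2 : forall x : R, is_derive x 1 dphi (ddphi x).
  apply: (is_derive_ext01 d40 d41); [move=> x xI|exact: z2].
  have h1 := DV xI; have h2 : is_derive x 1 chi (dchi x) := is_derive_cutoff d x.
  have h3 := DdV xI; have h4 : is_derive x 1 dchi (ddchi x) := is_derive_dcutoff d x.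
  by eapply is_derive_eq; [der | rewrite /=; ring].
have c2 : continuous ddphi.
  apply: (continuous_ext01 d40 d41) => // x xI.
  apply: cvgD; last by apply: cvgM; [exact: cchi | exact: cddV].
  apply: cvgD; first by apply: cvgM; [exact: cddchi | exact: cV].
  by apply: cvgM; [apply: cvgM; [exact: cvg_cst | exact: cdchi] | exact: cdV].
have c1 : continuous dphi.
  by move=> x; apply: differentiable_continuous; apply/derivable1_diffP; have [] := D2 x.
have vanish (u : R -> R) : (forall y, 0 < y < 1 -> ~~ (d / 4 <= y <= 1 - d / 4) -> u y = 0) ->
    forall x, ~~ (d / 4 <= x <= 1 - d / 4) -> ext01 u x = 0.
  by move=> z x xn; rewrite /ext01; case: ifPn => // xI; exact: z.
have [t1 e1] := test_functionP D1 c1 d40 d41 (vanish _ z1).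
have [t2 e2] := test_functionP D2 c2 d40 d41 (vanish _ z2).
by rewrite e1.
Qed.

(** Testing f with chi V gives int chi g = int chi V (k - m2 f) - int h, where h collects the
    derivatives of chi. By orthogonality chi may be replaced by - (1 - chi) in the first integral;
    this lives in the layers, where V = O(sqrt d). There h is O(d^(-1/2)), on a set of measure
    O(d). *)
Lemma int01_cutoff_le : `|int01 (fun x => chi x * g x)|
  <= ((1 + N) * Cv * U + 15 * N * Cv * L) * sd.
Proof.
have [t1 t2 e2] := cutoff_test.
have [_ H] := hw; have {}H := H phi t1 t2; rewrite e2 in H.
have [_ c2 _] := t2; have c1 := test_continuous t1.
rewrite e2 in c2.
have mh : measurable_fun (`]0, 1[ : set R) h.
  apply: meas => x xI; apply: cvgM; last exact: cf'.
  apply: cvgD; first by apply: cvgM; [exact: cddchi | exact: cV].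
  by apply: cvgM; [apply: cvgM; [exact: cvg_cst | exact: cdchi] | exact: cdV].
have P0 : 0 <= 5 * N * Cv * L / sd by have := N0; have := sd0; have := Cv0; have := L0 => *; pos.
have Ipi : integ01 (fun x => 5 * N * Cv * L / sd * iota x) by exact: integ01_scale.
have Ih : integ01 h.
  apply: (le_integrable _ _ _ Ipi) => //; first exact/measurable_EFinP.
  move=> x; rewrite /= in_itv /= => xI; rewrite lee_fin [leRHS]ger0_norm ?h_le //.
  exact: mulr_ge0.
have Bh : `|int01 h| <= 15 * N * Cv * L * sd.
  apply: le_trans (int01_le_norm Ih Ipi h_le) _; rewrite int01_scale // int_iota.
  rewrite (_ : 3 * d = 3 * (sd * sd)); last by rewrite -expr2 sd2.
  by rewrite -subr_ge0 (_ : _ - _ = 0) //; field; rewrite gt_eqF.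
pose w (x : R) := (1 - chi x) * V x.
have mw : measurable_fun (`]0, 1[ : set R) w.
  by apply: meas => x xI; apply: cvgM; [apply: cvgB; [exact: cvg_cst | exact: cchi] | exact: cV].
have bw (x : R) : 0 < x < 1 -> `|w x| <= (1 + N) * Cv * sd.
  move=> xI; have [v1 v2] := bV xI.
  have [inn|] := boolP (d <= x <= 1 - d).
    have [e _ _] := cutoff_in d0 inn; rewrite /w /chi e subrr mul0r normr0.
    by have := N0; have := sd0; have := Cv0 => *; pos.
  have [b _ _] := cutoffN x d0.
  have b1 : `|1 - chi x| <= 1 + N by apply: le_trans (ler_normB _ _) _; rewrite normr1 lerD2l.
  rewrite negb_and -!ltNge /w normrM -mulrA => /orP[xd|xd].
    apply: ler_pM => //; apply: le_trans v1 _; apply: ler_wpM2l; first exact: Cv0.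
    by apply: ler_wsqrtr; exact: ltW.
  apply: ler_pM => //; apply: le_trans v2 _; apply: ler_wpM2l; first exact: Cv0.
  by apply: ler_wsqrtr; lra.
have Iw : integ01 (fun x => w x * (k x - m2 * f x)) := integ01_mul mw bw Iu.
have Bw := int01_mul_le mw bw Iu; rewrite -/U in Bw.
have mV : measurable_fun (`]0, 1[ : set R) V by apply: meas; exact: cV.
have bV' (x : R) : 0 < x < 1 -> `|V x| <= Cv.
  move=> xI; have [v1 _] := bV xI; apply: le_trans v1 _; rewrite -[leRHS]mulr1.
  apply: ler_wpM2l; first exact: Cv0.
  by rewrite -(sqrtr1 R) ler_wsqrtr //; move: xI => /andP[_ /ltW].
have IV : integ01 (fun x => V x * (k x - m2 * f x)) := integ01_mul mV bV' Iu.
have Iphi : integ01 (fun x => phi x * k x) by exact: integ01_continuous_mul.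
have Iddphi : integ01 (fun x => ddphi x * f x) by exact: integ01_continuous_mul.
(* Equal to chi g on (0,1). Its terms are integrable one by one, and the first three have total
   integral 0 by [wd2] and orthogonality. *)
pose rest (x : R) := ddphi x * f x - phi x * k x + V x * (k x - m2 * f x) - h x - w x * (k x - m2 * f x).
have E : int01 (fun x => chi x * g x) = int01 rest.
  apply: eq_int01 => x xI; rewrite /rest /ddphi /phi /ext01 xI /h /w /g; ring.
have -> : int01 (fun x => chi x * g x) = - int01 h - int01 (fun x => w x * (k x - m2 * f x)).
  rewrite E /rest int01_sub //; last first.
    by apply: integ01_sub => //; apply: integ01_add => //; exact: integ01_sub.
  rewrite int01_sub //; last by apply: integ01_add => //; exact: integ01_sub.
  rewrite int01_add //; last exact: integ01_sub.
  by rewrite int01_sub // H orth; ring.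
apply: le_trans (ler_normB _ _) _; rewrite normrN.
by apply: le_trans (lerD Bh Bw) _; lra.
Qed.

(** A primitive of chi g is one of g on [d, 1 - d]. Its increment there differs from the integral of
    chi g by the two layers, of width d, on which chi g = O(d^(-1/2)). *)
Lemma orth_primitive : exists I : R -> R, [/\ cont_itv d (1 - d) I,
  forall x : R, d < x < 1 - d -> is_derive x 1 I (g x) &
  `|I (1 - d) - I d| <= ((1 + N) * Cv * U + 15 * N * Cv * L + 8 * N * Cg) * sd].
Proof.
pose G := ext01 (fun x => chi x * g x).
have cG : continuous G.
  apply: (continuous_ext01 d40 d41) => [x xI|y _ /(cutoff_out d0)[e _ _]]; last by rewrite /chi e mul0r.
  apply: cvgM; first exact: cchi.
  apply: cvgM; last exact: cf'.
  apply: cvgB; first exact: cddV.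
  by apply: cvgM; [exact: cvg_cst | exact: cV].
(* Starting at -1 makes [I] differentiable around all of [0, 1]; [G] vanishes to the left of 0. *)
pose I (x : R) := (\int[lebesgue_measure]_(t in [set` Interval (BLeft (- 1)) (BRight x)]) G t)%R.
have DI (x : R) : - 1 < x -> is_derive x 1 I (G x).
  move=> x1.
  have IG : lebesgue_measure.-integrable [set` Interval (BLeft (- 1)) (BRight (x + 1))] (EFin \o G).
    apply: continuous_compact_integrable; first exact: segment_compact.
    exact: continuous_subspaceT.
  have xx : x < x + 1 by rewrite ltrDl.
  have [D e] := continuous_FTC1_closed xx IG x1 (cG x).
  by rewrite -e derive1E; apply: DeriveDef.
have tot : int01 (fun x => chi x * g x) = I 1 - I 0.
  rewrite -(int01_derive DI cG); apply: eq_int01 => x xI; by rewrite /G /ext01 xI.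
have cI (a b : R) : 0 <= a -> cont_itv a b I.
  move=> a0; apply: cont_itv_derive => x /andP[ax _]; apply: DI.
  by apply: lt_le_trans ax; apply: lt_le_trans a0; exact: ltrN10.
have d1 : d <= 1 - d by have := d14; lra.
have bG (x y : R) : 0 < x < 1 -> d / 4 <= y <= d -> `|g x| * (Num.sqrt y * Num.sqrt (1 - y)) <= Cg -> `|G x| <= 4 * N * Cg / sd.
  move=> xI /andP[dy yd] hg; rewrite /G /ext01 xI normrM.
  have [b _ _] := cutoffN x d0.
  rewrite (_ : 4 * N * Cg / sd = N * (4 * Cg / sd)); last by ring.
  apply: ler_pM => //; rewrite ler_pdivlMr //.
  have sy2 : sd / 2 <= Num.sqrt y.
    rewrite (_ : sd / 2 = Num.sqrt (d / 4)); first exact: ler_wsqrtr.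
    rewrite sqrtrM ?(ltW d0) // -/sd (_ : 4^-1 = (2^-1) ^+ 2 :> R); last by field.
    by rewrite sqrtr_sqr ger0_norm.
  have s1 : 2^-1 <= Num.sqrt (1 - y).
    rewrite -[leLHS]ger0_norm // -sqrtr_sqr ler_wsqrtr //; have := d14; lra.
  have : `|g x| * (sd / 2 * 2^-1) <= Cg.
    apply: le_trans hg; apply: ler_wpM2l => //; apply: ler_pM => //.
    by have := sd0 => ?; pos.
  lra.
have NG0 : 0 <= 4 * N * Cg / sd by have := N0; have := sd0; have := Cg0 => *; pos.
have sub (x : R) : 0 < x < 1 -> ~~ (d / 4 <= x <= 1 - d / 4) -> `|G x| <= 4 * N * Cg / sd.
  by move=> xI /(cutoff_out d0)[e _ _]; rewrite /G /ext01 xI /chi e mul0r normr0.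
have h1 : `|I d - I 0| <= 4 * N * Cg / sd * (d - 0).
  apply: (derive_le_dist (df := G)); [exact: ltW|by move=> x /andP[x0 _]; apply: DI; apply: lt_trans x0; exact: ltrN10|exact: cI|].
  move=> x /andP[x0 xd]; have xI : 0 < x < 1 by rewrite x0 /=; have := d14; lra.
  have [dx|dx] := leP (d / 4) x; last by apply: sub => //; rewrite negb_and -ltNge dx.
  by apply: (bG x x) => //; [rewrite dx ltW | exact: bg].
have h2 : `|I 1 - I (1 - d)| <= 4 * N * Cg / sd * (1 - (1 - d)).
  apply: (derive_le_dist (df := G)).
  - by rewrite lerBlDr lerDl ltW.
  - by move=> x /andP[x0 _]; apply: DI; apply: lt_trans x0; have := d14; lra.
  - by apply: cI; have := d14; lra.
  - move=> x /andP[x0 x1]; have xI : 0 < x < 1 by rewrite x1 andbT; have := d14; lra.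
    have [dx|dx] := leP x (1 - d / 4); last by apply: sub => //; rewrite negb_and -!ltNge dx orbT.
    apply: (bG x (1 - x)) => //; first by apply/andP; split; lra.
    by rewrite (_ : 1 - (1 - x) = x); [rewrite [Num.sqrt _ * _]mulrC; exact: bg | ring].
exists I; split.
- by apply: cI; exact: ltW.
- move=> x /andP[dx xd]; have xI : 0 < x < 1 by rewrite (lt_trans d0) //=; have := d0; lra.
  have -> : g x = G x.
    have [e _ _] := @cutoff_in R d d0 x (ltac:(by rewrite !ltW)).
    by rewrite /G /ext01 xI /chi e mul1r.
  by apply: DI; apply: lt_trans dx; apply: lt_trans d0; exact: ltrN10.
- have -> : I (1 - d) - I d = int01 (fun x => chi x * g x) - (I 1 - I (1 - d)) - (I d - I 0).
    by rewrite tot; ring.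
  have e : 4 * N * Cg / sd * d = 4 * N * Cg * sd by rewrite [X in _ * X = _](_ : d = sd * sd); [field; rewrite gt_eqF | rewrite -expr2 sd2].
  rewrite subr0 e in h1; rewrite (_ : 1 - (1 - d) = d) ?e in h2; last by ring.
  apply: le_trans (ler_normB _ _) _; apply: le_trans (lerD (ler_normB _ _) (lexx _)) _.
  apply: le_trans (lerD (lerD int01_cutoff_le h2) h1) _.
  lra.
Qed.

End FixedDelta.
End Orthogonality.

Lemma wd2_orth_primitive (R : realType) (V dV ddV f k : R -> R) (m2 Cv L Cg : R) :
  0 <= Cv -> 0 <= L -> 0 <= Cg ->
  (forall x : R, 0 < x < 1 -> is_derive x 1 V (dV x)) ->
  (forall x : R, 0 < x < 1 -> is_derive x 1 dV (ddV x)) ->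
  (forall x : R, 0 < x < 1 -> {for x, continuous ddV}) ->
  (forall x : R, 0 < x < 1 -> `|V x| <= Cv * Num.sqrt x /\ `|V x| <= Cv * Num.sqrt (1 - x)) ->
  (forall x : R, 0 < x < 1 ->
    (x <= 2^-1 -> `|dV x| * Num.sqrt x <= Cv) /\ (2^-1 <= x -> `|dV x| * Num.sqrt (1 - x) <= Cv)) ->
  cont_itv 0 1 f ->
  (forall x : R, 0 <= x <= 1 -> `|f x| <= L * x /\ `|f x| <= L * (1 - x)) ->
  (forall x : R, 0 < x < 1 ->
    `|(ddV x - m2 * V x) * f x| * (Num.sqrt x * Num.sqrt (1 - x)) <= Cg) ->
  wd2 f k -> int01 (fun x => V x * (k x - m2 * f x)) = 0 ->
  exists C : R, forall d : R, 0 < d -> d <= 4^-1 -> exists I : R -> R,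
    [/\ cont_itv d (1 - d) I,
        forall x : R, d < x < 1 - d -> is_derive x 1 I ((ddV x - m2 * V x) * f x) &
        `|I (1 - d) - I d| <= C * Num.sqrt d].
Proof.
move=> Cv0 L0 Cg0 DV DdV cddV bV bdV cf bf bg hw orth.
have [N N0 cutoffN] := cutoff_bound_ex R.
eexists => d d0 d14.
exact: (orth_primitive N0 cutoffN Cv0 L0 Cg0 DV DdV cddV bV bdV cf bf bg hw orth d0 d14).
Qed.

(** * Size of the singular solution at both end points *)

Section EulerSolution.
Context {R : realType}.
Variables (B m2 : R) (V dV : R -> R).
Hypotheses (B14 : 4^-1 < B) (m20 : 0 <= m2).
Hypothesis DV : forall x : R, 0 < x -> is_derive x 1 V (dV x).
Hypothesis DdV : forall x : R, 0 < x -> is_derive x 1 dV ((m2 - B / x ^+ 2) * V x).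

Let a := B - 4^-1.
Let a0 : 0 < a. Proof. by rewrite subr_gt0. Qed.
Let en (x : R) := euler_energy B x (V x) (dV x).
Let den (x : R) := (2 * x * dV x - V x) * (m2 * V x).
Let K : R := m2 * (2 + (2 * a)^-1).

Let Den (x : R) : 0 < x -> is_derive x 1 en (den x).
Proof.
move=> x0; have x0' : 0 < x + 0 by rewrite addr0.
have := is_derive_euler_energy B x0' (DV x0) (DdV x0).
rewrite (_ : (fun y => _) = en); last by apply/funext => y; rewrite addr0.
move=> H; apply: (is_derive_eq H); rewrite addr0 /den; field.
by rewrite gt_eqF.
Qed.

Let den_ge (x : R) : 0 < x <= 1 -> - K * en x <= den x.
Proof.
move=> /andP[x0 x1].
have h1 : (B - 4^-1) * V x ^+ 2 <= x * en x := euler_energy_ge B _ _ x0.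
have h2 : (2 * x * dV x - V x) ^+ 2 <= 4 * x * en x := euler_energy_ge_der _ _ B14 x0.
have e0 : 0 <= en x := euler_energy_ge0 _ _ B14 x0.
have h3 : V x ^+ 2 <= a^-1 * en x.
  rewrite mulrC ler_pdivlMr // mulrC; apply: le_trans h1 _.
  by rewrite -[leRHS]mul1r ler_wpM2r.
have h4 : (2 * x * dV x - V x) ^+ 2 <= 4 * en x.
  apply: le_trans h2 _; rewrite -mulrA; apply: ler_wpM2l => //.
  by rewrite -[leRHS]mul1r ler_wpM2r.
have ai : (2 * a)^-1 = a^-1 / 2 by rewrite invfM mulrC.
have : - (2 + (2 * a)^-1) * en x <= (2 * x * dV x - V x) * V x.
  rewrite ai; move: h3 h4; move: (2 * x * dV x - V x) => p h3 h4.
  by have := sqr_ge0 (p + V x); move: h3 h4; move: (a^-1) (en x) (V x) => b E v; nra.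
move=> /(ler_wpM2l m20); rewrite /K /den; lra.
Qed.

(** The mass term gives en' >= - K en, so en exp (K x) is nondecreasing and its value at 1 bounds
    the energy down to 0. *)
Lemma euler_solution_energy_le (x : R) : 0 < x <= 1 -> en x <= en 1 * expR K.
Proof.
move=> /andP[x0 x1].
have D (y : R) : 0 < y -> is_derive y 1 (fun y => en y * expR (K * y)) ((den y + K * en y) * expR (K * y)).
  move=> y0; have h := Den y0; eapply is_derive_eq; [der | rewrite /=; ring].
have : en x * expR (K * x) <= en 1 * expR (K * 1).
  apply: (derive_ge0_le (f := fun y => en y * expR (K * y)) x1 (df := fun y => (den y + K * en y) * expR (K * y))).
  - by move=> y /andP[xy _]; apply: D; exact: lt_trans x0 xy.
  - by apply: cont_itv_derive => y /andP[xy _]; apply: D; exact: lt_le_trans x0 xy.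
  - move=> y /andP[xy y1]; apply: mulr_ge0; last exact: expR_ge0.
    have := @den_ge y; rewrite (lt_trans x0 xy) (ltW y1) => /(_ isT); lra.
rewrite mulr1; apply: le_trans; rewrite -[leLHS]mulr1; apply: ler_wpM2l.
  exact: euler_energy_ge0.
rewrite -(expR0 R) ler_expR; apply: mulr_ge0; last exact: ltW.
by apply: mulr_ge0 => //; apply: addr_ge0 => //; rewrite invr_ge0 mulr_ge0 // ltW.
Qed.

Hypothesis V1 : V 1 = 0.

(** The energy bound gives V = O(sqrt x) and V' = O(x^(-1/2)). At 1 the solution vanishes linearly;
    the weaker rate sqrt (1 - x) is stated to give both end points the same form, so that the
    reflected solution obeys the same bounds. *)
Lemma euler_solution_bounds : exists2 C : R, 0 <= C & forall x : R, 0 < x < 1 ->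
  [/\ `|V x| <= C * Num.sqrt x, `|V x| <= C * Num.sqrt (1 - x),
      `|dV x| * Num.sqrt x <= C & 2^-1 <= x -> `|dV x| <= C].
Proof.
pose E := en 1 * expR K.
have E0 : 0 <= E by apply: mulr_ge0; [exact: euler_energy_ge0 | exact: expR_ge0].
pose C1 := Num.sqrt (a^-1 * E); pose C2 := 2 * Num.sqrt E.
have ai : 0 <= a^-1 by rewrite invr_ge0 ltW.
have C10 : 0 <= C1 by exact: sqrtr_ge0.
have C20 : 0 <= C2 by apply: mulr_ge0 => //; exact: sqrtr_ge0.
have b1 (x : R) : 0 < x <= 1 -> `|V x| <= C1 * Num.sqrt x.
  move=> xI; have /andP[x0 x1] := xI.
  apply: normr_le_sqrt => //; first exact: ltW.
  have -> : C1 ^+ 2 = a^-1 * E by rewrite /C1 sqr_sqrtr // mulr_ge0.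
  rewrite -mulrA mulrC ler_pdivlMr // mulrC [E * x]mulrC.
  apply: le_trans (euler_energy_ge B _ (dV x) x0) _.
  by apply: ler_wpM2l; [exact: ltW | exact: euler_solution_energy_le].
have b2 (x : R) : 0 < x <= 1 -> `|dV x| * Num.sqrt x <= C1 + C2.
  move=> xI; have /andP[x0 x1] := xI.
  have h : `|2 * x * dV x - V x| <= C2 * Num.sqrt x.
    apply: normr_le_sqrt => //; first exact: ltW.
    have -> : C2 ^+ 2 = 4 * E by rewrite /C2 exprMn sqr_sqrtr //; ring.
    apply: le_trans (euler_energy_ge_der _ _ B14 x0) _.
    have := euler_solution_energy_le xI; rewrite -/E /en => /(ler_wpM2l (ltW x0)); lra.
  have s0 : 0 < Num.sqrt x by rewrite sqrtr_gt0.
  have sx : Num.sqrt x * Num.sqrt x = x by rewrite -expr2 sqr_sqrtr // ltW.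
  rewrite -(ler_pM2r s0) -mulrA sx mulrDl.
  have h' := b1 _ xI.
  have : `|2 * x * dV x| <= C2 * Num.sqrt x + C1 * Num.sqrt x.
    rewrite (_ : 2 * x * dV x = (2 * x * dV x - V x) + V x); last by ring.
    by apply: le_trans (ler_normD _ _) _; exact: lerD.
  rewrite normrM (ger0_norm (mulr_ge0 (ler0n _ 2) (ltW x0))).
  have : 0 <= `|dV x| * x by rewrite mulr_ge0 // ltW.
  by lra.
have b3 (x : R) : 2^-1 <= x <= 1 -> `|dV x| <= 2 * (C1 + C2).
  move=> /andP[x2 x1]; have x0 : 0 < x by apply: lt_le_trans x2; rewrite invr_gt0.
  have := b2 x; rewrite x0 x1 => /(_ isT).
  have sx : 2^-1 <= Num.sqrt x.
    rewrite -[leLHS]ger0_norm // -sqrtr_sqr ler_wsqrtr //.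
    by apply: le_trans x2; rewrite expr2 ler_piMl // invf_le1 // ler1n.
  have : `|dV x| * 2^-1 <= `|dV x| * Num.sqrt x by apply: ler_wpM2l.
  by lra.
have b4 (x : R) : 0 < x < 1 -> `|V x| <= 2 * (C1 + C2) * Num.sqrt (1 - x).
  move=> /andP[x0 x1]; have y0 : 0 < 1 - x by rewrite subr_gt0.
  have sy0 : 0 <= Num.sqrt (1 - x) by exact: sqrtr_ge0.
  have [x2|x2] := leP 2^-1 x.
    have : `|V 1 - V x| <= 2 * (C1 + C2) * (1 - x).
      apply: (derive_le_dist (df := dV)); first exact: ltW.
      - by move=> y /andP[xy _]; apply: DV; exact: lt_trans x0 xy.
      - by apply: (cont_itv_derive (df := dV)) => y /andP[xy _]; apply: DV; exact: lt_le_trans x0 xy.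
      - by move=> y /andP[xy y1]; apply: b3; rewrite (ltW y1) andbT; apply: le_trans x2 (ltW xy).
    rewrite V1 sub0r normrN => /le_trans; apply.
    apply: ler_wpM2l; first by apply: mulr_ge0 => //; exact: addr_ge0.
    rewrite -{1}(sqr_sqrtr (ltW y0)) expr2 -[leRHS]mulr1; apply: ler_wpM2l => //.
    by rewrite -{2}(sqrtr1 R) ler_wsqrtr // lerBlDr lerDl ltW.
  have sy : 2^-1 <= Num.sqrt (1 - x).
    rewrite -[leLHS]ger0_norm // -sqrtr_sqr ler_wsqrtr //.
    by rewrite expr2; move: x2; lra.
  have h1 : `|V x| <= C1 * 1.
    apply: le_trans (b1 x _) _; first by rewrite x0 ltW.
    by apply: ler_wpM2l => //; rewrite -(sqrtr1 R) ler_wsqrtr // ltW.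
  apply: le_trans h1 _; rewrite -mulrA mulrCA.
  apply: ler_pM => //; first by rewrite lerDl.
  by move: sy; lra.
exists (2 * (C1 + C2)) => [|x xI]; first by apply: mulr_ge0 => //; exact: addr_ge0.
have xI' : 0 < x <= 1 by case/andP: xI => -> /ltW ->.
split; [|exact: b4| |].
- apply: le_trans (b1 _ xI') _; apply: ler_wpM2r; first exact: sqrtr_ge0.
  by move: C10 C20; lra.
- by apply: le_trans (b2 _ xI') _; move: C10 C20; lra.
- by move=> x2; apply: b3; case/andP: xI' => _ ->; rewrite x2.
Qed.

End EulerSolution.

Lemma cont_itv_reflect (R : realType) (a b : R) (f : R -> R) :
  cont_itv a b f -> cont_itv (1 - b) (1 - a) (fun x => f (1 - x)).
Proof.
move=> /subspace_continuousP cf; apply/subspace_continuousP => x; rewrite /= in_itv /= => xI.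
have xI' : (1 - x) \in `[a, b] by rewrite in_itv /=; move: xI; lra.
apply: (cvg_comp (fun x : R => 1 - x) f _ (cf _ xI')).
move=> P [e /= e0 Pe]; exists e => //= y xy; rewrite in_itv /= => yI.
apply: Pe; last by rewrite /= in_itv /=; move: yI; lra.
by move: xy; rewrite /= (_ : 1 - x - (1 - y) = - (x - y)) ?normrN //; ring.
Qed.

Section OrthogonalPrimitive.
Context {R : realType}.
Variables (B m2 : R) (V dV : R -> R).
Hypotheses (B14 : 4^-1 < B) (m20 : 0 <= m2).
Hypothesis DV : forall x : R, 0 < x -> is_derive x 1 V (dV x).
Hypothesis DdV : forall x : R, 0 < x -> is_derive x 1 dV ((m2 - B / x ^+ 2) * V x).
Hypothesis V1 : V 1 = 0.
Variables (om rh k : R -> R) (L : R).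
Hypothesis L0 : 0 <= L.
Hypotheses (com : cont_itv 0 1 om) (crh : cont_itv 0 1 rh).
Hypothesis bom : forall x : R, 0 <= x <= 1 -> `|om x| <= L * x /\ `|om x| <= L * (1 - x).
Hypothesis brh : forall x : R, 0 <= x <= 1 -> `|rh x| <= L * x /\ `|rh x| <= L * (1 - x).

Let B0 : 0 < B. Proof. by apply: lt_trans B14; rewrite invr_gt0. Qed.
Let ddV (x : R) := (m2 - B / x ^+ 2) * V x.

Let cddV (x : R) : 0 < x -> {for x, continuous ddV}.
Proof.
move=> x0.
have H : is_derive x 1 ddV (B * (2 * x) / x ^+ 4 * V x + (m2 - B / x ^+ 2) * dV x).
  have h := DV x0; rewrite /ddV; eapply is_derive_eq; first by der; rewrite expf_neq0 // gt_eqF.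
  by rewrite /=; field; rewrite gt_eqF.
by apply: differentiable_continuous; apply/derivable1_diffP; case: H.
Qed.

Let source_le (C M y v w : R) : 0 <= C -> 0 <= M -> 0 < y < 1 -> `|v| <= C * Num.sqrt y -> `|w| <= M * y ->
  `|- (B / y ^+ 2) * v * w| * (Num.sqrt y * Num.sqrt (1 - y)) <= B * C * M.
Proof.
move=> C0 M0 /andP[y0 y1] hv hw.
have s0 : 0 < Num.sqrt y by rewrite sqrtr_gt0.
have sy : Num.sqrt y ^+ 2 = y by rewrite sqr_sqrtr // ltW.
have By0 : 0 <= B / y ^+ 2 by rewrite divr_ge0 ?sqr_ge0 // ltW.
have h1 : `|- (B / y ^+ 2) * v * w| <= B / y ^+ 2 * (C * Num.sqrt y) * (M * y).
  rewrite !normrM normrN (ger0_norm By0); apply: ler_pM => //; first by apply: mulr_ge0.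
  by apply: ler_wpM2l.
have h2 : Num.sqrt y * Num.sqrt (1 - y) <= Num.sqrt y.
  rewrite ler_piMr // ?(ltW s0) // -{2}(sqrtr1 R) ler_wsqrtr //.
  by rewrite lerBlDr lerDl ltW.
apply: le_trans (ler_pM (normr_ge0 _) _ h1 h2) _; first by apply: mulr_ge0; exact: sqrtr_ge0.
move: (Num.sqrt y) s0 sy => s s0 sy.
by rewrite -subr_ge0 (_ : _ - _ = 0) // -sy; field; rewrite gt_eqF.
Qed.

Let lin_le (x s : R) : 0 <= x <= 1 -> `|s| <= 1 ->
  `|rh x - B^-1 * (s * om x)| <= (1 + B^-1) * L * x /\
  `|rh x - B^-1 * (s * om x)| <= (1 + B^-1) * L * (1 - x).
Proof.
move=> xI hs; have [a1 a2] := bom xI; have [b1 b2] := brh xI.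
have Bi : 0 <= B^-1 by rewrite invr_ge0 ltW.
have h : `|rh x - B^-1 * (s * om x)| <= `|rh x| + B^-1 * `|om x|.
  apply: le_trans (ler_normB _ _) _; rewrite lerD2l normrM ger0_norm //.
  by apply: ler_wpM2l => //; rewrite normrM ler_piMl.
have := ler_wpM2l Bi a1; have := ler_wpM2l Bi a2.
by split; apply: le_trans h _; lra.
Qed.

Let sub01 (x : R) : 0 < x < 1 -> 0 < 1 - x < 1.
Proof. by move=> /andP[? ?]; apply/andP; split; lra. Qed.

(** Here lies the origin of F_m: with f = rh - x om / B, the limit source om / x - B rh / x^2 is -
    (B / x^2) f, and V'' - m2 V = - (B / x^2) V. So V times the source is (Delta_m V) f, and two
    integrations by parts turn it into V Delta_m f, that is V F_m. *)
Lemma orthogonal_primitive0 : let f x := rh x - B^-1 * (x * om x) in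
  wd2 f k -> int01 (fun x => V x * (k x - m2 * f x)) = 0 ->
  exists C : R, forall d : R, 0 < d -> d <= 4^-1 -> exists I : R -> R,
    [/\ cont_itv d (1 - d) I,
        forall x : R, d < x < 1 - d -> is_derive x 1 I (V x * (om x / x - B * rh x / x ^+ 2)) &
        `|I (1 - d) - I d| <= C * Num.sqrt d].
Proof.
move=> f hw orth.
have [C C0 bV] := euler_solution_bounds B14 m20 DV DdV V1.
have M0 : 0 <= (1 + B^-1) * L by apply: mulr_ge0 => //; rewrite addr_ge0 // invr_ge0 ltW.
have bf (x : R) : 0 <= x <= 1 -> `|f x| <= (1 + B^-1) * L * x /\ `|f x| <= (1 + B^-1) * L * (1 - x).
  by move=> xI; apply: lin_le => //; case/andP: xI => x0 x1; rewrite ger0_norm.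
have [||||||||H HI] := @wd2_orth_primitive R V dV ddV f k m2 C ((1 + B^-1) * L) (B * C * ((1 + B^-1) * L)) C0 M0 _ _ _ _ _ _ _ bf _ hw orth.
- by apply: mulr_ge0 => //; apply: mulr_ge0 => //; exact: ltW.
- by move=> x /andP[x0 _]; exact: DV.
- by move=> x /andP[x0 _]; exact: DdV.
- by move=> x /andP[x0 _]; exact: cddV.
- by move=> x /bV[].
- move=> x xI; have [_ _ b3 b4] := bV _ xI; split=> [//|/b4 b]; rewrite -[leRHS]mulr1.
  apply: ler_pM => //; rewrite -{2}(sqrtr1 R) ler_wsqrtr //; move: xI; lra.
- rewrite /f; apply: cont_itv_add => //; apply: cont_itv_opp; apply: cont_itv_mul; first exact: cont_itv_cst.
  by apply: cont_itv_mul => //; exact: cont_itv_id.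
- move=> x xI; have [b1 _ _ _] := bV _ xI.
  have xI' : 0 <= x <= 1 by case/andP: xI => /ltW -> /ltW ->.
  have [f1 _] := bf _ xI'.
  rewrite (_ : ddV x - m2 * V x = - (B / x ^+ 2) * V x); last by rewrite /ddV; ring.
  exact: source_le.
exists H => d d0 d14; have [I [cI dI bI]] := HI d d0 d14.
exists I; split=> // x xd; have H1 := dI x xd; apply: (is_derive_eq H1).
have x0 : x != 0 by case/andP: xd => xd _; rewrite gt_eqF // (lt_trans d0 xd).
by rewrite /ddV /f; field; rewrite x0 gt_eqF.
Qed.

(** The solution is now V (1 - x), singular at 1. Reflecting the resulting primitive puts the
    singularity at 0; the simple pole 1 / (x - 1) becomes - 1 / x, whence the sign of [om]. *)
Lemma orthogonal_primitive1 : let f x := rh x - B^-1 * ((x - 1) * om x) in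
  wd2 f k -> int01 (fun x => V (1 - x) * (k x - m2 * f x)) = 0 ->
  exists C : R, forall d : R, 0 < d -> d <= 4^-1 -> exists I : R -> R,
    [/\ cont_itv d (1 - d) I,
        forall x : R, d < x < 1 - d ->
          is_derive x 1 I (V x * (- om (1 - x) / x - B * rh (1 - x) / x ^+ 2)) &
        `|I (1 - d) - I d| <= C * Num.sqrt d].
Proof.
move=> f hw orth.
have [C C0 bV] := euler_solution_bounds B14 m20 DV DdV V1.
have M0 : 0 <= (1 + B^-1) * L by apply: mulr_ge0 => //; rewrite addr_ge0 // invr_ge0 ltW.
have bf (x : R) : 0 <= x <= 1 -> `|f x| <= (1 + B^-1) * L * x /\ `|f x| <= (1 + B^-1) * L * (1 - x).
  move=> xI; apply: lin_le => //; case/andP: xI => x0 x1.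
  by rewrite ler0_norm ?subr_le0 // opprB lerBlDr lerDl.
have D1 (x : R) : is_derive x 1 (fun x : R => 1 - x) (- 1).
  by eapply is_derive_eq; [der | rewrite /=; ring].
have DV' (x : R) : 0 < x < 1 -> is_derive x 1 (fun x => V (1 - x)) (- dV (1 - x)).
  move=> /sub01/andP[y0 _]; have H := is_derive_chain (f := V) (g := fun x : R => 1 - x) (DV y0) (D1 x).
  by apply: (is_derive_eq H); ring.
have DdV' (x : R) : 0 < x < 1 -> is_derive x 1 (fun x => - dV (1 - x)) (ddV (1 - x)).
  move=> /sub01/andP[y0 _]; have H := is_derive_chain (f := dV) (g := fun x : R => 1 - x) (DdV y0) (D1 x).
  by apply: (is_derive_eq (is_derive_opp H)); rewrite /ddV; ring.
have sK (x : R) : 1 - (1 - x) = x by ring.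
have [||||||H HI] := @wd2_orth_primitive R (fun x => V (1 - x)) (fun x => - dV (1 - x)) (fun x => ddV (1 - x)) f k m2 C ((1 + B^-1) * L) (B * C * ((1 + B^-1) * L)) C0 M0 _ DV' DdV' _ _ _ _ bf _ hw orth.
- by apply: mulr_ge0 => //; apply: mulr_ge0 => //; exact: ltW.
- move=> x /sub01/andP[y0 _].
  apply: (@continuous_comp _ _ _ (fun x : R => 1 - x) ddV); last exact: cddV.
  by apply: differentiable_continuous; apply/derivable1_diffP; case: (D1 x).
- by move=> x /sub01/bV[]; rewrite sK.
- move=> x xI; have [_ _ b3 b4] := bV _ (sub01 xI); rewrite normrN; split=> [x2|//].
  rewrite -[leRHS]mulr1; apply: ler_pM => //; first by apply: b4; lra.
  by rewrite -(sqrtr1 R) ler_wsqrtr //; move: xI; lra.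
- rewrite /f; apply: cont_itv_add => //; apply: cont_itv_opp; apply: cont_itv_mul; first exact: cont_itv_cst.
  by apply: cont_itv_mul => //; apply: cont_itv_add; [exact: cont_itv_id | exact: cont_itv_cst].
- move=> x xI; have [b1 _ _ _] := bV _ (sub01 xI).
  have xI' : 0 <= x <= 1 by case/andP: xI => /ltW -> /ltW ->.
  have [_ f1] := bf _ xI'.
  rewrite (_ : ddV (1 - x) - m2 * V (1 - x) = - (B / (1 - x) ^+ 2) * V (1 - x)); last by rewrite /ddV; ring.
  by have := source_le C0 M0 (sub01 xI) b1 f1; rewrite sK [Num.sqrt x * _]mulrC.
exists H => d d0 d14; have [I [cI dI bI]] := HI d d0 d14.
exists (fun x => - I (1 - x)); split.
- apply: cont_itv_opp.
  by have := cont_itv_reflect cI; rewrite sK.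
- move=> x xd; have yd : d < 1 - x < 1 - d by move: xd; lra.
  have H1 := is_derive_chain (f := I) (g := fun x : R => 1 - x) (dI _ yd) (D1 x).
  apply: (is_derive_eq (is_derive_opp H1)).
  have x0 : x != 0 by case/andP: xd => xd _; rewrite gt_eqF // (lt_trans d0 xd).
  by rewrite /ddV /f !sK; field; rewrite x0 gt_eqF.
- by rewrite sK opprK addrC.
Qed.

End OrthogonalPrimitive.

Lemma im_vanishes_primitive (R : realType) (B m2 C : R) (V dV om rh : R -> R) :
  4^-1 < B -> 0 <= m2 -> 0 <= C ->
  (forall x : R, 0 < x -> is_derive x 1 V (dV x)) ->
  (forall x : R, 0 < x -> is_derive x 1 dV ((m2 - B / x ^+ 2) * V x)) ->
  V 1 = 0 -> dV 1 != 0 ->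
  (forall y : R, 0 <= y <= 1 -> `|om y| <= C * y) ->
  (forall y : R, 0 <= y <= 1 -> `|rh y| <= C * y) ->
  (exists C1 : R, forall d : R, 0 < d -> d <= 4^-1 -> exists I : R -> R,
    [/\ cont_itv d (1 - d) I,
        forall x : R, d < x < 1 - d -> is_derive x 1 I (V x * (om x / x - B * rh x / x ^+ 2)) &
        `|I (1 - d) - I d| <= C1 * Num.sqrt d]) ->
  im_vanishes B m2 om rh.
Proof.
move=> B14 m20 C0 DV DdV V1 dV1 bom brh [C1 HI].
pose c := (dV 1)^-1.
apply: (im_vanishes_supercritical B14 m20 C0 bom brh (U := fun x => c * V x) (dU := fun x => c * dV x) (C1 := `|c| * C1)).
- move=> d d0; apply: (cont_itv_derive (df := fun x => c * dV x)) => x /andP[dx _].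
  have H := DV _ (lt_le_trans d0 dx); by eapply is_derive_eq; [der | rewrite /=; ring].
- move=> d d0; apply: (cont_itv_derive (df := fun x => c * ((m2 - B / x ^+ 2) * V x))) => x /andP[dx _].
  have H := DdV _ (lt_le_trans d0 dx); by eapply is_derive_eq; [der | rewrite /=; ring].
- by move=> x /andP[x0 _]; have H := DV _ x0; eapply is_derive_eq; [der | rewrite /=; ring].
- by move=> x /andP[x0 _]; have H := DdV _ x0; eapply is_derive_eq; [der | rewrite /=; ring].
- by rewrite V1 mulr0.
- by rewrite /c mulVf.
- move=> d d0 d14; have [I [cI DI bI]] := HI d d0 d14.
  exists (fun x => c * I x); split.
  + by apply: cont_itv_mul => //; exact: cont_itv_cst.
  + by move=> x xd; have H := DI _ xd; eapply is_derive_eq; [der | rewrite /=; ring].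
  + by rewrite -mulrBr normrM -mulrA ler_wpM2l.
Qed.

(** * From the complex problem to the real system *)

Section Data.
Context {R : realType}.
Implicit Types (beta : R) (m : nat) (omega rho f : R -> R[i]).

(** [P] is [rePart] or [imPart]: after symmetrization the two parts of the data give independent
    real problems, and the same statements treat both. *)
Let Fpart (P : (R -> R[i]) -> R -> R) beta m omega rho (y0 z : R) : R :=
  P (wderive (wderive rho)) z
    - (beta ^+ 2)^-1 * P (wderive (wderive (fun x => (x - y0)%:C * omega x))) z
    - m%:R ^+ 2 * (P rho z - (beta ^+ 2)^-1 * ((z - y0) * P omega z)).

Lemma Fm_parts beta m omega rho (z y0 : R) : Fm beta m omega rho z y0 =
  Fpart (@rePart R) beta m omega rho y0 z +i* Fpart (@imPart R) beta m omega rho y0 z.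
Proof.
rewrite /Fm /wDelta /Fpart /rePart /imPart natr_complex.
move: (wderive (wderive rho) z) => [a b]; move: (wderive _ z) => [c d].
move: (omega z) => [e g]; move: (rho z) => [h i].
by simpc; rewrite /=; congr (_ +i* _); ring.
Qed.


(** As phi = i V with V real, the complex condition amounts to two real ones, for the real and for
    the imaginary part of the data. The sign in the second one is absorbed later by taking - V as
    the solution. *)
Lemma phi_orthogonality (phi : R -> R[i]) (V : R -> R) beta m omega rho (y0 : R) :
  (forall z : R, 0 < z < 1 -> phi z = 0 +i* V z) ->
  cintegral `]0, 1[ (fun z => phi z * Fm beta m omega rho z y0) = 0 ->
  int01 (fun z => V z * Fpart (@rePart R) beta m omega rho y0 z) = 0 /\
  int01 (fun z => - V z * Fpart (@imPart R) beta m omega rho y0 z) = 0.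
Proof.
move=> phiV; rewrite /cintegral => -[h1 h2]; split.
  rewrite -[RHS]h2; apply: eq_int01 => z zI.
  by rewrite /imPart phiV // Fm_parts; simpc; rewrite /=.
rewrite -[RHS]h1; apply: eq_int01 => z zI.
by rewrite /rePart phiV // Fm_parts; simpc; rewrite /=; ring.
Qed.

Lemma part_linear_bound (P : (R -> R[i]) -> R -> R) f :
  P = @rePart R \/ P = @imPart R -> inH2_Dirichlet f ->
  [/\ cont_itv 0 1 (P f), wd2 (P f) (P (wderive (wderive f))) &
  exists2 L : R, 0 <= L & forall x, 0 <= x <= 1 -> `|P f x| <= L * x /\ `|P f x| <= L * (1 - x)].
Proof.
move=> HP [/inH2_wd2[w1 w2] [c1 c2] f0 f1].
case: HP => ->; split; [exact: c1|exact: w1| |exact: c2|exact: w2|].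
  by apply: (wd2_linear_bound c1 w1); rewrite /rePart ?f0 ?f1.
by apply: (wd2_linear_bound c2 w2); rewrite /imPart ?f0 ?f1.
Qed.

Lemma part_wd2 (P : (R -> R[i]) -> R -> R) beta omega rho (y0 : R) :
  P = @rePart R \/ P = @imPart R -> inH2_Dirichlet omega -> inH2_Dirichlet rho ->
  wd2 (fun x => P rho x - (beta ^+ 2)^-1 * ((x - y0) * P omega x))
    (fun x => P (wderive (wderive rho)) x
      - (beta ^+ 2)^-1 * P (wderive (wderive (fun x => (x - y0)%:C * omega x))) x).
Proof.
move=> HP Ho Hr; have [_ wr _] := part_linear_bound HP Hr.
have [co _ _] := part_linear_bound HP Ho; have [cr _ _] := part_linear_bound HP Hr.
have I (f : R -> R) : cont_itv 0 1 f -> integ01 f.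
  move=> cf; have [K _ bK] := cont_itv_bounded (@ler01 R) cf.
  apply: (integ01_bounded (K := K)); first exact: measurable01_cont_itv.
  by move=> x /andP[x0 x1]; apply: bK; rewrite !ltW.
have [Ho2 _ _ _] := Ho; have [w1 w2] := inH2_wd2 (inH2_mulX y0 Ho2).
have e : P (fun x => (x - y0)%:C * omega x) = fun x => (x - y0) * P omega x.
  apply/funext => x; case: HP => ->; rewrite /rePart /imPart; case: (omega x) => a b; simpc; by rewrite /=.
have Io : integ01 (fun x : R => (x - y0) * P omega x).
  apply: I; apply: cont_itv_mul; last exact: co.
  by apply: cont_itv_add; [exact: cont_itv_id | exact: cont_itv_cst].
apply: (wd2_comb _ (I _ cr) Io wr).
by rewrite -e; case: HP => ->; [exact: w1 | exact: w2].
Qed.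

Variables (beta : R) (m : nat) (omega rho : R -> R[i]).
Hypotheses (beta0 : 0 < beta) (m1 : (1 <= m)%N).
Hypotheses (Ho : inH2_Dirichlet omega) (Hr : inH2_Dirichlet rho).

Let B := beta ^+ 2.
Let m2 : R := m%:R ^+ 2.
Let B0 : 0 < B. Proof. by apply: exprn_gt0. Qed.
Let m20 : 0 <= m2. Proof. exact: sqr_ge0. Qed.

Lemma part_im_vanishes0 (P : (R -> R[i]) -> R -> R) (V dV : R -> R) :
  P = @rePart R \/ P = @imPart R ->
  (4^-1 < B -> [/\ forall x : R, 0 < x -> is_derive x 1 V (dV x),
    forall x : R, 0 < x -> is_derive x 1 dV ((m2 - B / x ^+ 2) * V x),
    V 1 = 0, dV 1 != 0 &
    int01 (fun z => V z * Fpart P beta m omega rho 0 z) = 0]) ->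
  im_vanishes B m2 (P omega) (P rho).
Proof.
move=> HP HV; have [co wo [L1 L10 bo]] := part_linear_bound HP Ho.
have [cr wr [L2 L20 br]] := part_linear_bound HP Hr.
have bo' (x : R) : 0 <= x <= 1 -> `|P omega x| <= (L1 + L2) * x /\ `|P omega x| <= (L1 + L2) * (1 - x).
  move=> xI; have [b1 b2] := bo x xI; case/andP: xI => x0 x1; rewrite !mulrDl.
  by split; [apply: le_trans b1 _ | apply: le_trans b2 _]; rewrite lerDl mulr_ge0 // subr_ge0.
have br' (x : R) : 0 <= x <= 1 -> `|P rho x| <= (L1 + L2) * x /\ `|P rho x| <= (L1 + L2) * (1 - x).
  move=> xI; have [b1 b2] := br x xI; case/andP: xI => x0 x1; rewrite !mulrDl.
  by split; [apply: le_trans b1 _ | apply: le_trans b2 _]; rewrite lerDr mulr_ge0 // subr_ge0.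
have L0 : 0 <= L1 + L2 by exact: addr_ge0.
have [B14|B14] := leP B 4^-1.
  by apply: (im_vanishes_subcritical (ltW B0) B14 m20 L0) => x xI; [have [] := bo' x xI|have [] := br' x xI].
have [DV DdV V1 dV1 orth] := HV B14.
apply: (im_vanishes_primitive B14 m20 L0 DV DdV V1 dV1) => [x xI|x xI|]; [by have [] := bo' x xI|by have [] := br' x xI|].
have w := part_wd2 beta 0 HP Ho Hr.
have e : (fun x : R => P rho x - (beta ^+ 2)^-1 * ((x - 0) * P omega x)) =
  fun x : R => P rho x - (beta ^+ 2)^-1 * (x * P omega x) by apply/funext => x; rewrite subr0.
rewrite e in w.
apply: (orthogonal_primitive0 B14 m20 DV DdV V1 L0 co cr bo' br' w).
by rewrite -[RHS]orth; apply: eq_int01 => x _; rewrite /Fpart subr0.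
Qed.

Lemma part_im_vanishes1 (P : (R -> R[i]) -> R -> R) (V dV : R -> R) :
  P = @rePart R \/ P = @imPart R ->
  (4^-1 < B -> [/\ forall x : R, 0 < x -> is_derive x 1 V (dV x),
    forall x : R, 0 < x -> is_derive x 1 dV ((m2 - B / x ^+ 2) * V x),
    V 1 = 0, dV 1 != 0 &
    int01 (fun z => V (1 - z) * Fpart P beta m omega rho 1 z) = 0]) ->
  im_vanishes B m2 (fun x => - P omega (1 - x)) (fun x => P rho (1 - x)).
Proof.
move=> HP HV; have [co wo [L1 L10 bo]] := part_linear_bound HP Ho.
have [cr wr [L2 L20 br]] := part_linear_bound HP Hr.
have bo' (x : R) : 0 <= x <= 1 -> `|P omega x| <= (L1 + L2) * x /\ `|P omega x| <= (L1 + L2) * (1 - x).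
  move=> xI; have [b1 b2] := bo x xI; case/andP: xI => x0 x1; rewrite !mulrDl.
  by split; [apply: le_trans b1 _ | apply: le_trans b2 _]; rewrite lerDl mulr_ge0 // subr_ge0.
have br' (x : R) : 0 <= x <= 1 -> `|P rho x| <= (L1 + L2) * x /\ `|P rho x| <= (L1 + L2) * (1 - x).
  move=> xI; have [b1 b2] := br x xI; case/andP: xI => x0 x1; rewrite !mulrDl.
  by split; [apply: le_trans b1 _ | apply: le_trans b2 _]; rewrite lerDr mulr_ge0 // subr_ge0.
have L0 : 0 <= L1 + L2 by exact: addr_ge0.
have sb (x : R) : 0 <= x <= 1 -> 0 <= 1 - x <= 1 by move=> /andP[? ?]; apply/andP; split; lra.
have sK (x : R) : 1 - (1 - x) = x by ring.
have ro (x : R) : 0 <= x <= 1 -> `|- P omega (1 - x)| <= (L1 + L2) * x.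
  by move=> /sb/bo'[_]; rewrite normrN sK.
have rr (x : R) : 0 <= x <= 1 -> `|P rho (1 - x)| <= (L1 + L2) * x.
  by move=> /sb/br'[_]; rewrite sK.
have [B14|B14] := leP B 4^-1.
  exact: (im_vanishes_subcritical (ltW B0) B14 m20 L0).
have [DV DdV V1 dV1 orth] := HV B14.
apply: (im_vanishes_primitive B14 m20 L0 DV DdV V1 dV1) => //.
apply: (orthogonal_primitive1 B14 m20 DV DdV V1 L0 co cr bo' br' (part_wd2 beta 1 HP Ho Hr)).
by rewrite -[RHS]orth; apply: eq_int01 => x _.
Qed.

Lemma im_vanishes0 :
  (4^-1 < B -> cintegral `]0, 1[ (fun z => phi_u beta m z * Fm beta m omega rho z 0) = 0) ->
  im_vanishes B m2 (rePart omega) (rePart rho) /\ im_vanishes B m2 (imPart omega) (imPart rho).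
Proof.
move=> orth.
have [B14|B14] := ltP 4^-1 B; last first.
  by split; apply: (@part_im_vanishes0 _ (fun=> 0) (fun=> 0)); [left|move=> h; move: (lt_le_trans h B14); rewrite ltxx|right|move=> h; move: (lt_le_trans h B14); rewrite ltxx].
have [V [dV [phiV DV DdV V1 dV1]]] := phi_u_real B14 m1.
have phiV' (z : R) : 0 < z < 1 -> phi_u beta m z = 0 +i* V z by move=> /andP[z0 _]; exact: phiV.
have [or1 or2] := phi_orthogonality phiV' (orth B14).
split; first by apply: (@part_im_vanishes0 _ V dV) => //; left.
apply: (@part_im_vanishes0 _ (fun x => - V x) (fun x => - dV x)); first by right.
move=> _; split => //; last by rewrite oppr_eq0.
- by move=> x x0; apply: is_derive_opp; exact: DV.
- by move=> x x0; have H := is_derive_opp (DdV x x0); apply: (is_derive_eq H); rewrite mulrN.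
- by rewrite V1 oppr0.
Qed.

Lemma im_vanishes1 :
  (4^-1 < B -> cintegral `]0, 1[ (fun z => phi_l beta m z * Fm beta m omega rho z 1) = 0) ->
  im_vanishes B m2 (fun x => - rePart omega (1 - x)) (fun x => rePart rho (1 - x)) /\
  im_vanishes B m2 (fun x => - imPart omega (1 - x)) (fun x => imPart rho (1 - x)).
Proof.
move=> orth.
have [B14|B14] := ltP 4^-1 B; last first.
  by split; apply: (@part_im_vanishes1 _ (fun=> 0) (fun=> 0)); [left|move=> h; move: (lt_le_trans h B14); rewrite ltxx|right|move=> h; move: (lt_le_trans h B14); rewrite ltxx].
have [V [dV [phiV DV DdV V1 dV1]]] := phi_u_real B14 m1.
have phiV' (z : R) : 0 < z < 1 -> phi_l beta m z = 0 +i* V (1 - z).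
  by move=> /andP[z0 z1]; apply: (phiV (1 - z)); rewrite subr_gt0.
have [or1 or2] := phi_orthogonality (V := fun z => V (1 - z)) phiV' (orth B14).
split; first by apply: (@part_im_vanishes1 _ V dV) => //; left.
apply: (@part_im_vanishes1 _ (fun x => - V x) (fun x => - dV x)); first by right.
move=> _; split => //; last by rewrite oppr_eq0.
- by move=> x x0; apply: is_derive_opp; exact: DV.
- by move=> x x0; have H := is_derive_opp (DdV x x0); apply: (is_derive_eq H); rewrite mulrN.
- by rewrite V1 oppr0.
Qed.

End Data.

(* McShane's formula: the infimum of the cones of slope K over the graph of f. *)
Lemma lipschitz_extension (R : realType) (f : R -> R) (K : R) : 0 <= K ->
  (forall x y : R, 0 < x < 1 -> 0 < y < 1 -> `|f x - f y| <= K * `|x - y|) ->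
  exists2 g : R -> R, continuous g & forall x, 0 < x < 1 -> g x = f x.
Proof.
move=> K0 lf.
pose S (x : R) := [set f z + K * `|x - z| | z in [set z : R | 0 < z < 1]].
have h2 : 0 < (2^-1 : R) < 1 by rewrite invr_gt0 invf_lt1 ?ltr0n ?ltr1n.
have lbS x : lbound (S x) (f 2^-1 - K * `|x - 2^-1|).
  move=> _ [z zI <-].
  have := lf _ _ h2 zI. rewrite ler_norml => /andP[_ h].
  have : K * `|2^-1 - z| <= K * (`|x - 2^-1| + `|x - z|).
    apply: ler_wpM2l => //; rewrite (_ : 2^-1 - z = (x - z) - (x - 2^-1)); last by ring.
    by apply: le_trans (ler_normB _ _) _; rewrite addrC.
  rewrite mulrDr; lra.
have iS x : has_inf (S x).
  by split; [exists (f 2^-1 + K * `|x - 2^-1|), 2^-1 | exists (f 2^-1 - K * `|x - 2^-1|); exact: lbS].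
pose g x := inf (S x).
have Lg x y : g x <= g y + K * `|x - y|.
  rewrite -lerBlDr; apply: lb_le_inf; first by case: (iS y).
  move=> _ [z zI <-]; rewrite lerBlDr.
  apply: le_trans (_ : f z + K * `|x - z| <= _).
    by apply: ge_inf; [case: (iS x) | exists z].
  rewrite -addrA lerD2l -mulrDr; apply: ler_wpM2l => //.
  by rewrite (_ : x - z = (y - z) + (x - y)) ?ler_normD //; ring.
exists g => [x|x xI].
  apply/cvgrPdist_lt => e e0; have K1 : 0 < K + 1 by rewrite ltr_pwDr.
  near=> y.
  have d : `|x - y| < e / (K + 1) by near: y; exact: (@cvgr_dist_lt _ _ _ _ _ id x cvg_id _ (divr_gt0 e0 K1)).
  have h : (K + 1) * `|x - y| < e by rewrite mulrC -ltr_pdivlMr.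
  have h1 := Lg x y; have h3 := Lg y x; rewrite (distrC y x) in h3.
  have n0 : 0 <= `|x - y| by [].
  by rewrite ltr_norml; apply/andP; split; lra.
apply/eqP; rewrite eq_le; apply/andP; split.
  by apply: ge_inf; [case: (iS x) | exists x; rewrite // subrr normr0 mulr0 addr0].
apply: lb_le_inf; first by case: (iS x).
move=> _ [z zI <-]; have := lf _ _ xI zI.
by rewrite ler_norml => /andP[_]; rewrite lerBlDr addrC.
Unshelve. all: by end_near.
Qed.

(** A bounded derivative makes f Lipschitz on (0,1), so f extends continuously. Applied to psi', on
    whose boundary values [Dirichlet_solution] says nothing. *)
Lemma derivative_extension (R : realType) (f df : R -> R) (K : R) : 0 <= K ->
  (forall x : R, 0 < x < 1 -> is_derive x 1 f (df x)) ->
  (forall x : R, 0 < x < 1 -> `|df x| <= K) ->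
  exists g : R -> R, [/\ cont_itv 0 1 g, forall x, 0 < x < 1 -> g x = f x &
    forall x : R, 0 < x < 1 -> is_derive x 1 g (df x)].
Proof.
move=> K0 Df bdf.
have lip (x y : R) : x <= y -> 0 < x < 1 -> 0 < y < 1 -> `|f y - f x| <= K * (y - x).
  move=> xy /andP[x0 x1] /andP[y0 y1]; apply: (derive_le_dist (df := df) xy).
  - by move=> z /andP[xz zy]; apply: Df; rewrite (lt_trans x0 xz) (lt_trans zy y1).
  - by apply: (cont_itv_derive (df := df)) => z /andP[xz zy]; apply: Df; rewrite (lt_le_trans x0 xz) (le_lt_trans zy y1).
  - by move=> z /andP[xz zy]; apply: bdf; rewrite (lt_trans x0 xz) (lt_trans zy y1).
have lip' (x y : R) : 0 < x < 1 -> 0 < y < 1 -> `|f x - f y| <= K * `|x - y|.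
  move=> xI yI; have [xy|/ltW yx] := leP x y.
    by rewrite distrC (distrC x) (@ger0_norm _ (y - x)) ?subr_ge0 //; exact: lip.
  by rewrite (@ger0_norm _ (x - y)) ?subr_ge0 //; exact: lip.
have [g cg ge] := lipschitz_extension K0 lip'.
exists g; split => //; first exact: continuous_subspaceT.
move=> x xI; have xI' : x \in `]0, 1[ by rewrite in_itv.
have n : \forall y \near x, f y = g y.
  by have := near_in_itvoo xI'; apply: filterS => y; rewrite in_itv /= => /ge.
exact: near_eq_is_derive n (Df _ xI).
Qed.

(** For fixed e > 0 the coefficients are continuous on [0, 1], so the second derivatives are bounded
    and the first ones extend continuously to the end points. *)
Lemma real_sol_intro (R : realType) (B m2 e : R) (om rh p q dp dq : R -> R) : 0 < e ->
  cont_itv 0 1 om -> cont_itv 0 1 rh -> cont_itv 0 1 p -> cont_itv 0 1 q ->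
  p 0 = 0 -> p 1 = 0 -> q 0 = 0 -> q 1 = 0 ->
  (forall y : R, 0 < y < 1 -> is_derive y 1 p (dp y)) ->
  (forall y : R, 0 < y < 1 -> is_derive y 1 q (dq y)) ->
  (forall y : R, 0 < y < 1 -> is_derive y 1 dp
    (m2 * p y - B * (wre e y * p y + wim e y * q y) + srcre B (om y) (rh y) e y)) ->
  (forall y : R, 0 < y < 1 -> is_derive y 1 dq
    (m2 * q y - B * (wre e y * q y - wim e y * p y) + srcim B (om y) (rh y) e y)) ->
  exists dp' dq', real_sol B m2 om rh e p q dp' dq'.
Proof.
move=> e0 co cr cp cq p0 p1 q0 q1 Dp Dq Ddp Ddq.
have nz (y : R) : (y ^+ 2 + e ^+ 2 != 0) by rewrite gt_eqF // sqnorm_gt0.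
have nz2 (y : R) : ((y ^+ 2 + e ^+ 2) ^+ 2 != 0) by rewrite expf_neq0.
have cid : cont_itv 0 1 (fun x : R => x) by exact: cont_itv_id.
have cw : cont_itv 0 1 (wre e) by rewrite /wre; cont.
have cw' : cont_itv 0 1 (wim e) by rewrite /wim; cont.
have c1 : cont_itv 0 1 (fun y => m2 * p y - B * (wre e y * p y + wim e y * q y) + srcre B (om y) (rh y) e y).
  by rewrite /srcre; cont.
have c2 : cont_itv 0 1 (fun y => m2 * q y - B * (wre e y * q y - wim e y * p y) + srcim B (om y) (rh y) e y).
  by rewrite /srcim; cont.
have [K1 K10 b1] := cont_itv_bounded (@ler01 R) c1.
have [K2 K20 b2] := cont_itv_bounded (@ler01 R) c2.
have [|g1 [cg1 e1 D1]] := derivative_extension K10 Ddp.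
  by move=> x /andP[x0 x1]; apply: b1; rewrite !ltW.
have [|g2 [cg2 e2 D2]] := derivative_extension K20 Ddq.
  by move=> x /andP[x0 x1]; apply: b2; rewrite !ltW.
by exists g1, g2; split => // y yI; rewrite ?e1 ?e2 //; auto.
Qed.

Section Reduction.
Context {R : realType}.
Variables (beta : R) (m : nat) (omega rho : R -> R[i]).

Let B := beta ^+ 2.
Let m2 : R := m%:R ^+ 2.

Lemma invcE (y d : R) :
  (y +i* d)^-1 = (y / (y ^+ 2 + d ^+ 2)) +i* (- (d / (y ^+ 2 + d ^+ 2))).
Proof. by []. Qed.

Lemma Dirichlet_solution_parts (y0 d : R) (psi : R -> R[i]) (y : R) :
  d != 0 -> Dirichlet_solution beta m omega rho y0 d psi -> 0 < y < 1 ->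
  let a := rePart psi in let b := imPart psi in let x := y - y0 in
  [/\ is_derive y 1 a (derive1 a y), is_derive y 1 b (derive1 b y),
    is_derive y 1 (derive1 a) (m2 * a y - B * (wre d x * a y + wim d x * b y)
      + (x * rePart omega y + d * imPart omega y) / (x ^+ 2 + d ^+ 2)
      - B * (wre d x * rePart rho y + wim d x * imPart rho y)) &
    is_derive y 1 (derive1 b) (m2 * b y - B * (wre d x * b y - wim d x * a y)
      + (x * imPart omega y - d * rePart omega y) / (x ^+ 2 + d ^+ 2)
      - B * (wre d x * imPart rho y - wim d x * rePart rho y))].
Proof.
move=> d0 [_ _ _ H] yI; have [[da db] [dda ddb] E] := H y yI.
move=> a b x.
have D (f : R -> R) : derivable f y 1 -> is_derive y 1 f (derive1 f y).
  by move=> df; rewrite derive1E; exact: DeriveDef.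
have Da : is_derive y 1 a (derive1 a y) by exact: (D a da).
have Db : is_derive y 1 b (derive1 b y) by exact: (D b db).
have n0 : x ^+ 2 + d ^+ 2 != 0.
  by rewrite gt_eqF // ltr_wpDl ?sqr_ge0 // exprn_even_gt0 //= d0.
(* u - i v is 1 / (x + i d); in terms of u and v both sides of the equation are polynomials. *)
pose u := x / (x ^+ 2 + d ^+ 2); pose v := d / (x ^+ 2 + d ^+ 2).
have ewre : wre d x = u * u - v * v by rewrite /wre /u /v; field.
have ewim : wim d x = 2 * (u * v) by rewrite /wim /u /v; field.
have e1 : (x * rePart omega y + d * imPart omega y) / (x ^+ 2 + d ^+ 2)
  = u * rePart omega y + v * imPart omega y by rewrite /u /v; field.
have e2 : (x * imPart omega y - d * rePart omega y) / (x ^+ 2 + d ^+ 2)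
  = u * imPart omega y - v * rePart omega y by rewrite /u /v; field.
have {}E : [/\ derive1 (derive1 a) y = m2 * a y - B * (wre d x * a y + wim d x * b y)
      + (x * rePart omega y + d * imPart omega y) / (x ^+ 2 + d ^+ 2)
      - B * (wre d x * rePart rho y + wim d x * imPart rho y) &
    derive1 (derive1 b) y = m2 * b y - B * (wre d x * b y - wim d x * a y)
      + (x * imPart omega y - d * rePart omega y) / (x ^+ 2 + d ^+ 2)
      - B * (wre d x * imPart rho y - wim d x * rePart rho y)].
  rewrite ewre ewim e1 e2; clear ewre ewim e1 e2; move: E.
  rewrite /Delta -exprVn -/x invcE natr_complex -/u -/v.
  rewrite (_ : cderive (cderive psi) y = derive1 (derive1 a) y +i* derive1 (derive1 b) y) //.
  rewrite (_ : psi y = a y +i* b y); last by rewrite /a /b /rePart /imPart; case: (psi y).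
  rewrite (_ : omega y = rePart omega y +i* imPart omega y); last by rewrite /rePart /imPart; case: (omega y).
  rewrite (_ : rho y = rePart rho y +i* imPart rho y); last by rewrite /rePart /imPart; case: (rho y).
  rewrite /m2 /B.
  move: (a y) (b y) (derive1 (derive1 a) y) (derive1 (derive1 b) y) u v => a1 b1 a2 b2 {}u {}v.
  move: (rePart omega y) (imPart omega y) (rePart rho y) (imPart rho y) => w1 w2 r1 r2.
  simpc => -[] /= E1 E2; split.
    move/eqP: E1; rewrite -subr_eq0 => /eqP E1; apply/eqP; rewrite -subr_eq0; apply/eqP.
    by rewrite -[RHS]E1; ring.
  move/eqP: E2; rewrite -subr_eq0 => /eqP E2; apply/eqP; rewrite -subr_eq0; apply/eqP.
  by rewrite -[RHS]E2; ring.
have [E1 E2] := E.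
split; [exact: Da|exact: Db| |].
  exact: (is_derive_eq (D (derive1 a) dda) E1).
exact: (is_derive_eq (D (derive1 b) ddb) E2).
Qed.

End Reduction.

Section SymmetrizedPair.
Context {R : realType}.

(** The system before the singular point is moved to 0 and before the derivatives are extended to
    the end points. *)
Record shifted_sol (B m2 y0 e : R) (w r p q dp dq : R -> R) : Prop := ShiftedSol {
  ss_cp : cont_itv 0 1 p; ss_cq : cont_itv 0 1 q;
  ss_p0 : p 0 = 0; ss_p1 : p 1 = 0; ss_q0 : q 0 = 0; ss_q1 : q 1 = 0;
  ss_dp : forall y : R, 0 < y < 1 -> is_derive y 1 p (dp y);
  ss_dq : forall y : R, 0 < y < 1 -> is_derive y 1 q (dq y);
  ss_ddp : forall y : R, 0 < y < 1 -> is_derive y 1 dp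
    (m2 * p y - B * (wre e (y - y0) * p y + wim e (y - y0) * q y)
     + srcre B (w y) (r y) e (y - y0));
  ss_ddq : forall y : R, 0 < y < 1 -> is_derive y 1 dq
    (m2 * q y - B * (wre e (y - y0) * q y - wim e (y - y0) * p y)
     + srcim B (w y) (r y) e (y - y0)) }.

Variables (B m2 : R) (w r : R -> R).
Hypotheses (cw : cont_itv 0 1 w) (cr : cont_itv 0 1 r).

Lemma shifted_sol0_small : im_vanishes B m2 w r -> forall eta : R, 0 < eta ->
  exists2 e0 : R, 0 < e0 & forall e p q dp dq, 0 < e < e0 ->
    shifted_sol B m2 0 e w r p q dp dq -> forall y, 0 <= y <= 1 -> `|q y| <= eta.
Proof.
move=> H eta /H[e0 e00 He]; exists e0 => // e p q dp dq eI.
move=> [cp cq p0 p1 q0 q1 Dp Dq Ddp Ddq].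
have e_gt0 : 0 < e by case/andP: eI.
have [dp' [dq' sol]] : exists dp' dq', real_sol B m2 w r e p q dp' dq'.
  apply: (real_sol_intro e_gt0 cw cr cp cq p0 p1 q0 q1 Dp Dq) => y yI.
    by have := Ddp y yI; rewrite subr0.
  by have := Ddq y yI; rewrite subr0.
exact: He eI sol.
Qed.

(** Under y -> 1 - y the variable y - 1 becomes - y. As [wre] is even and [wim] odd, the system
    keeps its form once q and the datum [w] of the simple pole change sign. *)
Lemma shifted_sol1_small :
  im_vanishes B m2 (fun x => - w (1 - x)) (fun x => r (1 - x)) -> forall eta : R, 0 < eta ->
  exists2 e0 : R, 0 < e0 & forall e p q dp dq, 0 < e < e0 ->
    shifted_sol B m2 1 e w r p q dp dq -> forall y, 0 <= y <= 1 -> `|q y| <= eta.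
Proof.
move=> H eta /H[e0 e00 He]; exists e0 => // e p q dp dq eI.
move=> [cp cq p0 p1 q0 q1 Dp Dq Ddp Ddq] y yI.
have e_gt0 : 0 < e by case/andP: eI.
have refl (f : R -> R) : cont_itv 0 1 f -> cont_itv 0 1 (fun x => f (1 - x)).
  by move=> /cont_itv_reflect; rewrite subrr subr0.
have D1 (x : R) : is_derive x 1 (fun x : R => 1 - x) (- 1).
  by eapply is_derive_eq; [der | rewrite /=; ring].
have sK (x : R) : 1 - (1 - x) = x by ring.
have sI (x : R) : 0 < x < 1 -> 0 < 1 - x < 1 by move=> /andP[? ?]; apply/andP; split; lra.
have D (f df : R -> R) : (forall y : R, 0 < y < 1 -> is_derive y 1 f (df y)) ->
    forall y : R, 0 < y < 1 -> is_derive y 1 (fun x => f (1 - x)) (- df (1 - y)).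
  move=> Df x xI; have h := is_derive_chain (f := f) (g := fun x : R => 1 - x) (Df _ (sI _ xI)) (D1 x).
  by apply: (is_derive_eq h); ring.
have e2 (x : R) : x ^+ 2 + e ^+ 2 != 0 by rewrite gt_eqF // sqnorm_gt0.
have sx (x : R) : 1 - x - 1 = - x by ring.
have [dp' [dq' sol]] : exists dp' dq', real_sol B m2 (fun x => - w (1 - x)) (fun x => r (1 - x)) e
    (fun x => p (1 - x)) (fun x => - q (1 - x)) dp' dq'.
  apply: (real_sol_intro (dp := fun x => - dp (1 - x)) (dq := fun x => dq (1 - x)) e_gt0).
  - by apply: cont_itv_opp; exact: refl.
  - exact: refl.
  - exact: refl.
  - by apply: cont_itv_opp; exact: refl.
  - by rewrite subr0.
  - by rewrite subrr.
  - by rewrite subr0 q1 oppr0.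
  - by rewrite subrr q0 oppr0.
  - by move=> x xI; have h := is_derive_opp (D _ _ Dq x xI); rewrite opprK in h.
  - move=> x xI; apply: (is_derive_eq (is_derive_opp (D _ _ Ddp x xI))).
    by rewrite /srcre /wre /wim !sx; field; exact: e2.
  - move=> x xI; apply: (is_derive_eq (D _ _ Ddq x xI)).
    by rewrite /srcim /wre /wim !sx; field; exact: e2.
have yI' : 0 <= 1 - y <= 1 by move/andP: yI => [? ?]; apply/andP; split; lra.
by have := He _ _ _ _ _ eI sol _ yI'; rewrite sK normrN.
Qed.

End SymmetrizedPair.

Section Conclusion.
Context {R : realType}.
Variables (beta : R) (m : nat) (omega rho : R -> R[i]) (y0 e : R) (psip psim : R -> R[i]).
Hypothesis e0 : 0 < e.
Hypothesis solp : Dirichlet_solution beta m omega rho y0 e psip.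
Hypothesis solm : Dirichlet_solution beta m omega rho y0 (- e) psim.

Let wreN (x : R) : wre (- e) x = wre e x.
Proof. by rewrite /wre sqrrN. Qed.

Let wimN (x : R) : wim (- e) x = - wim e x.
Proof. by rewrite /wim sqrrN mulrN !mulNr. Qed.

Let parts (y : R) (yI : 0 < y < 1) := (Dirichlet_solution_parts (lt0r_neq0 e0) solp yI).
Let eN0 : - e != 0. Proof. by rewrite oppr_eq0 gt_eqF. Qed.
Let partsm (y : R) (yI : 0 < y < 1) := (Dirichlet_solution_parts eN0 solm yI).

Let n0 (x : R) : x ^+ 2 + e ^+ 2 != 0. Proof. by rewrite gt_eqF // sqnorm_gt0. Qed.

(** The conjugate of psi^- solves the equation of psi^+ with conjugate data, so (psi^+ + conj psi^-)
    / 2 solves it with the real parts of the data; p and q are the two parts of this function. *)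
Lemma shifted_sol_re : shifted_sol (beta ^+ 2) (m%:R ^+ 2) y0 e (rePart omega) (rePart rho)
  (fun y => 2^-1 * (rePart psip y + rePart psim y)) (fun y => 2^-1 * (imPart psip y - imPart psim y))
  (fun y => 2^-1 * (derive1 (rePart psip) y + derive1 (rePart psim) y))
  (fun y => 2^-1 * (derive1 (imPart psip) y - derive1 (imPart psim) y)).
Proof.
have [[cp1 cp2] p0 p1 _] := solp; have [[cm1 cm2] q0 q1 _] := solm.
split.
- by apply: cont_itv_mul; [exact: cont_itv_cst | apply: cont_itv_add].
- by apply: cont_itv_mul; [exact: cont_itv_cst | apply: cont_itv_add => //; exact: cont_itv_opp].
- by rewrite /rePart p0 q0 /= addr0 mulr0.
- by rewrite /rePart p1 q1 /= addr0 mulr0.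
- by rewrite /imPart p0 q0 /= subr0 mulr0.
- by rewrite /imPart p1 q1 /= subr0 mulr0.
- move=> y yI; have [h1 _ _ _] := parts yI; have [h2 _ _ _] := partsm yI.
  by eapply is_derive_eq; [der | rewrite /=; ring].
- move=> y yI; have [_ h1 _ _] := parts yI; have [_ h2 _ _] := partsm yI.
  by eapply is_derive_eq; [der | rewrite /=; ring].
- move=> y yI; have [_ _ h1 _] := parts yI; have [_ _ h2 _] := partsm yI.
  eapply is_derive_eq; [der | rewrite /= wreN wimN /srcre sqrrN; field; exact: n0].
- move=> y yI; have [_ _ _ h1] := parts yI; have [_ _ _ h2] := partsm yI.
  eapply is_derive_eq; [der | rewrite /= wreN wimN /srcim sqrrN; field; exact: n0].
Qed.

(** Here p + i q is (psi^+ - conj psi^-) / (2 i), whose data are the imaginary parts of omega and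
    rho. *)
Lemma shifted_sol_im : shifted_sol (beta ^+ 2) (m%:R ^+ 2) y0 e (imPart omega) (imPart rho)
  (fun y => 2^-1 * (imPart psip y + imPart psim y)) (fun y => 2^-1 * (rePart psim y - rePart psip y))
  (fun y => 2^-1 * (derive1 (imPart psip) y + derive1 (imPart psim) y))
  (fun y => 2^-1 * (derive1 (rePart psim) y - derive1 (rePart psip) y)).
Proof.
have [[cp1 cp2] p0 p1 _] := solp; have [[cm1 cm2] q0 q1 _] := solm.
split.
- by apply: cont_itv_mul; [exact: cont_itv_cst | apply: cont_itv_add].
- by apply: cont_itv_mul; [exact: cont_itv_cst | apply: cont_itv_add => //; exact: cont_itv_opp].
- by rewrite /imPart p0 q0 /= addr0 mulr0.
- by rewrite /imPart p1 q1 /= addr0 mulr0.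
- by rewrite /rePart p0 q0 /= subr0 mulr0.
- by rewrite /rePart p1 q1 /= subr0 mulr0.
- move=> y yI; have [_ h1 _ _] := parts yI; have [_ h2 _ _] := partsm yI.
  by eapply is_derive_eq; [der | rewrite /=; ring].
- move=> y yI; have [h1 _ _ _] := parts yI; have [h2 _ _ _] := partsm yI.
  by eapply is_derive_eq; [der | rewrite /=; ring].
- move=> y yI; have [_ _ _ h1] := parts yI; have [_ _ _ h2] := partsm yI.
  eapply is_derive_eq; [der | rewrite /= wreN wimN /srcre sqrrN; field; exact: n0].
- move=> y yI; have [_ _ h1 _] := parts yI; have [_ _ h2 _] := partsm yI.
  eapply is_derive_eq; [der | rewrite /= wreN wimN /srcim sqrrN; field; exact: n0].
Qed.

(** The two half differences bound |psi^- - psi^+|^2 pointwise by 8 eta^2, below (4 eta)^2, and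
    (0,1) has measure 1. *)
Lemma L2norm_difference_le (eta : R) : 0 <= eta ->
  (forall y, 0 <= y <= 1 -> `|2^-1 * (imPart psip y - imPart psim y)| <= eta) ->
  (forall y, 0 <= y <= 1 -> `|2^-1 * (rePart psim y - rePart psip y)| <= eta) ->
  (L2norm (fun y => psim y - psip y)%R <= (4 * eta)%:E)%E.
Proof.
move=> eta0 him hre.
have [[cp1 cp2] _ _ _] := solp; have [[cm1 cm2] _ _ _] := solm.
have Ere : rePart (fun y => psim y - psip y) = fun y => rePart psim y - rePart psip y.
  by apply/funext => y; rewrite /rePart; case: (psim y) => a b; case: (psip y).
have Eim : imPart (fun y => psim y - psip y) = fun y => imPart psim y - imPart psip y.
  by apply/funext => y; rewrite /imPart; case: (psim y) => a b; case: (psip y).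
apply: L2norm_le; first by apply: mulr_ge0.
- by rewrite Ere; apply: measurable01_cont_itv; apply: cont_itv_add => //; exact: cont_itv_opp.
- by rewrite Eim; apply: measurable01_cont_itv; apply: cont_itv_add => //; exact: cont_itv_opp.
move=> y /andP[ya yb]; have yI : 0 <= y <= 1 by rewrite !ltW.
rewrite /sqn Ere Eim.
have /ler_normlP[a1 a2] := him _ yI; have /ler_normlP[b1 b2] := hre _ yI.
move: a1 a2 b1 b2; move: (rePart psim y - _) => s.
rewrite -(opprB (imPart psim y)); move: (imPart psim y - _) => t; rewrite mulrN => a1 a2 b1 b2.
have h (z : R) : - (2^-1 * z) <= eta -> 2^-1 * z <= eta -> z ^+ 2 <= (2 * eta) ^+ 2.
  by move=> z1 z2; rewrite -[leLHS]real_normK ?num_real // lerXn2r ?nnegrE ?mulr_ge0 // ler_norml; apply/andP; split; lra.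
have := h s b1 b2; have : t ^+ 2 <= (2 * eta) ^+ 2 by apply: h; lra.
have := sqr_ge0 eta; rewrite !exprMn; lra.
Qed.

End Conclusion.

Lemma cvg0_of_L2norm_le (R : realType) (f : R -> R -> R[i]) :
  (forall eta : R, 0 < eta -> exists2 e0 : R, 0 < e0 & forall e : R, 0 < e < e0 ->
    (L2norm (f e) <= eta%:E)%E) ->
  L2norm (f e) @[e --> 0^'+] --> 0%E.
Proof.
move=> H.
have H' (eta : R) : 0 < eta -> \forall e \near 0^'+, (L2norm (f e) <= eta%:E)%E.
  move=> /H[e0 e00 He]; near=> e; apply: He; apply/andP; split; first by near: e; exact: nbhs_right_gt.
  by near: e; exact: nbhs_right_lt.
have L0 e : (0 <= L2norm (f e))%E by exact: Lnorm_ge0.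
apply/fine_cvgP; split.
  have := H' 1 ltr01; apply: filterS => e h.
  by rewrite ge0_fin_numE //; apply: le_lt_trans h _; rewrite ltry.
apply/cvgrPdist_le => eta eta0; have := H' _ eta0; apply: filterS => e h.
have fL : (L2norm (f e) \is a fin_num)%E.
  by rewrite ge0_fin_numE //; apply: le_lt_trans h _; rewrite ltry.
rewrite sub0r normrN ger0_norm; last exact: fine_ge0.
by rewrite -lee_fin fineK.
Unshelve. all: by end_near.
Qed.

Theorem theorem4 (R : realType) (beta : R) (m : nat) (omega rho : R -> R[i])
    (beta_gt0 : 0 < beta) (m_ge1 : (1 <= m)%N)
    (omegaH2 : inH2_Dirichlet omega) (rhoH2 : inH2_Dirichlet rho)
    (orth : 4^-1 < beta ^+ 2 ->
      cintegral `]0, 1[ (fun z => phi_u beta m z * Fm beta m omega rho z 0) = 0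
      /\ cintegral `]0, 1[ (fun z => phi_l beta m z * Fm beta m omega rho z 1)
         = 0) :
  forall y0 : R, y0 = 0 \/ y0 = 1 ->
  forall psip psim : R -> R -> R[i],
    (forall eps : R, 0 < eps ->
       Dirichlet_solution beta m omega rho y0 eps (psip eps)) ->
    (forall eps : R, 0 < eps ->
       Dirichlet_solution beta m omega rho y0 (- eps) (psim eps)) ->
    L2norm (fun y => psim eps y - psip eps y) @[eps --> 0^'+] --> 0%E.
Proof.
move=> y0 Hy0 psip psim solp solm.
have [_ [cw1 cw2] _ _] := omegaH2; have [_ [cr1 cr2] _ _] := rhoH2.
have small : forall eta : R, 0 < eta -> exists2 e0 : R, 0 < e0 & forall e : R, 0 < e < e0 ->
    (forall y : R, 0 <= y <= 1 -> `|2^-1 * (imPart (psip e) y - imPart (psim e) y)| <= eta) /\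
    (forall y : R, 0 <= y <= 1 -> `|2^-1 * (rePart (psim e) y - rePart (psip e) y)| <= eta).
  move=> eta eta0; case: Hy0 => E; rewrite E in solp solm.
    have orth0 h := (orth h).1.
    have [v1 v2] := im_vanishes0 beta_gt0 m_ge1 omegaH2 rhoH2 orth0.
    have [e1 e10 H1] := shifted_sol0_small cw1 cr1 v1 eta0.
    have [e2 e20 H2] := shifted_sol0_small cw2 cr2 v2 eta0.
    exists (Num.min e1 e2) => [|e /andP[e0]]; first by rewrite lt_min e10.
    rewrite lt_min => /andP[ee1 ee2].
    have I1 : 0 < e < e1 by rewrite e0.
    have I2 : 0 < e < e2 by rewrite e0.
    split; first exact: (H1 _ _ _ _ _ I1 (shifted_sol_re e0 (solp e e0) (solm e e0))).
    exact: (H2 _ _ _ _ _ I2 (shifted_sol_im e0 (solp e e0) (solm e e0))).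
  have orth1 h := (orth h).2.
  have [v1 v2] := im_vanishes1 beta_gt0 m_ge1 omegaH2 rhoH2 orth1.
  have [e1 e10 H1] := shifted_sol1_small cw1 cr1 v1 eta0.
  have [e2 e20 H2] := shifted_sol1_small cw2 cr2 v2 eta0.
  exists (Num.min e1 e2) => [|e /andP[e0]]; first by rewrite lt_min e10.
  rewrite lt_min => /andP[ee1 ee2].
  have I1 : 0 < e < e1 by rewrite e0.
  have I2 : 0 < e < e2 by rewrite e0.
  split; first exact: (H1 _ _ _ _ _ I1 (shifted_sol_re e0 (solp e e0) (solm e e0))).
  exact: (H2 _ _ _ _ _ I2 (shifted_sol_im e0 (solp e e0) (solm e e0))).
apply: cvg0_of_L2norm_le => eta eta0.
have eta4 : 0 < eta / 4 by apply: divr_gt0.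
have [e0 e00 He] := small _ eta4.
exists e0 => // e eI; have [him hre] := He e eI; have /andP[e_gt0 _] := eI.
have := L2norm_difference_le (solp e e_gt0) (solm e e_gt0) (ltW eta4) him hre.
by rewrite mulrC divfK.
Qed.
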